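(* Let $\mu$ be a quasi-Bernoulli independent random measure on $\mathbb{A}$, and assume that $\tau_\mu$ is twice continuously differentiable. Let $J=\{q\in\mathbb{R}:\tau_\mu'(q)q-\tau_\mu(q)>0\}$. Let $\eta>0$, let $N\ge1$ be an integer, and let $\widetilde\varepsilon=(\varepsilon_n)_{n\ge1}$ be a sequence of positive numbers going to $0$ such that for all $M,a>0$ the series $\sum_{n\ge1}b^{Mn^{3/4}\log(n)}b^{-na\varepsilon_n^2}$ converges, and such that $\varepsilon_n\ge n^{-1/8}\log(n)^{1/2+\eta}$ for all $n$. Let $\alpha>1$. For every compact subinterval $K$ of $J$, with probability one, for $j$ large enough and for all $q\in K$, setting $\mathcal{S}_j=\big[\exp\big(\sqrt{\alpha\log(j)}\big)\big]$, one has $$\max\Big(GS\big(\mu_q^{(j)},\mu^{(j)},\tau_\mu'(q),N,\widetilde\varepsilon\big),\ GS\big(\mu_q^{(j)},\mu_q^{(j)},\tau_\mu'(q)q-\tau_\mu(q),N,\widetilde\varepsilon\big)\Big)\le\mathcal{S}_j .$$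
   Context: **Symbolic space.** $b\ge 2$ is an integer, $\mathcal{A}=\{0,\dots,b-1\}$, $\mathcal{A}^*=\bigcup_{n\ge1}\mathcal{A}^n$, and $\mathbb{A}=\mathcal{A}^{\{1,2,3,\dots\}}$ with the product topology. For a finite word $w$ of length $n$, $[w]\subset\mathbb{A}$ is the cylinder of sequences whose first $n$ letters form $w$; for $t\in\mathbb{A}$, $t|n=t_1\cdots t_n$. $\ell$ is the measure on $\mathbb{A}$ with $\ell([w])=b^{-n}$ for $w\in\mathcal{A}^n$. For $w\in\mathcal{A}^n$, $i(w)\in\{0,\dots,b^n-1\}$ is the integer with $i(w)b^{-n}=\sum_{k=1}^n w_kb^{-k}$; for $v,w\in\mathcal{A}^n$, $\delta(v,w)=|i(v)-i(w)|$. For a real number $x$, $[x]$ is its integer part. All random variables are defined on a probability space $(\Omega,\mathcal{B},\mathbb{P})$. **Quasi-Bernoulli independent random measure.** A random probability measure $\mu=\mu(\omega)$ on $\mathbb{A}$ is a quasi-Bernoulli independent random measure if there exist a constant $C>0$ and two sequences of random measures $(\mu_j)_{j\ge1}$ and $(\mu^{(j)})_{j\ge1}$ on $\mathbb{A}$ such that for every $j\ge1$: (P1) for all $(v,w)\in\mathcal{A}^j\times\mathcal{A}^*$, $\frac1C\mu_j([v])\mu^{(j)}([w])\le\mu([vw])\le C\mu_j([v])\mu^{(j)}([w])$; (P2) for every $r\in\{0,\dots,b-1\}$, $0<\operatorname{ess\,inf}\mu([r])\le\operatorname{ess\,sup}\mu([r])<\infty$; (P3) $(\mu^{(j)}([w]))_{w\in\mathcal{A}^*}$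 and $(\mu([w]))_{w\in\mathcal{A}^*}$ have the same distribution; $\mu$ is also denoted $\mu^{(0)}$; (P4) the $\sigma$-algebras $\sigma(\mu_j([v]):v\in\mathcal{A}^j)$ and $\sigma(\mu^{(j)}([w]):w\in\mathcal{A}^* )$ are independent. The measures $\mu^{(j)}$ in the claim are these copies of $\mu$. **The function $\tau_\mu$.** $\tau_\mu(q)=\liminf_{j\to\infty}-\frac1j\log_b\sum_{w\in\mathcal{A}^j}\mu([w])^q$ for $q\in\mathbb{R}$. With probability one this is a limit for all $q\in\mathbb{R}$, and $\tau_\mu$ is a deterministic real-valued function of $q$. **Auxiliary measures $\mu_q^{(j)}$.** For $\omega$ in an event of probability one, for $j\ge0$, $q\in\mathbb{R}$ and $n\ge1$, let $\mu^{(j)}_{q,n}$ be the probability measure on $\mathbb{A}$ whose density with respect to $\ell$ is constant on each cylinder $[v]$, $v\in\mathcal{A}^n$, and proportional there to $\mu^{(j)}([v])^q$; so $\mu^{(j)}_{q,n}([v])=\mu^{(j)}([v])^q/\sum_{u\in\mathcal{A}^n}\mu^{(j)}([u])^q$. The measure $\mu^{(j)}_q$ is a weak limit of some subsequence of $(\mu^{(j)}_{q,n})_n$ (a choice of such a limit is fixed for each $j$, $q$ and $\omega$). **Singularity sets and growth speed.** For a probability measure $\nu$ on $\mathbb{A}$, $\beta\ge0$, an integer $N$, and a positive sequence $\widetilde\varepsilon=(\varepsilon_n)$, for $p\ge1$ let $E^{\nu}_{\beta,p}(N,\widetilde\varepsilon)$ be the set of $t\in\mathbb{A}$ such that for all $n\ge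 p$, all $\gamma\in\{-1,1\}$ and all $w\in\mathcal{A}^n$ with $\delta(w,t|n)\le N$, $b^{\gamma n(\beta-\gamma\varepsilon_n)}\nu([w])^\gamma\le1$ (equivalently $b^{-n(\beta+\varepsilon_n)}\le\nu([w])\le b^{-n(\beta-\varepsilon_n)}$). For probability measures $m,\nu$ on $\mathbb{A}$, the growth speed is $$GS(m,\nu,\beta,N,\widetilde\varepsilon)=\inf\Big\{p\ge1:\ m\big(E^{\nu}_{\beta,p}(N,\widetilde\varepsilon)\big)\ge 1/2\Big\}.$$ *)

(* Defs.v *)
From HB Require Import structures.
From mathcomp Require Import all_boot all_order all_algebra.
From mathcomp Require Import all_classical all_reals all_analysis.
From mathcomp Require Import measurable_realfun ess_sup_inf.

Set Implicit Arguments.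
Unset Strict Implicit.
Unset Printing Implicit Defensive.

Import Order.TTheory GRing.Theory Num.Theory.
Import numFieldNormedType.Exports.

Local Open Scope classical_set_scope.
Local Open Scope ring_scope.

(* An integer [b >= 2] is written [m.+2] with [m] a natural number, so that the
   alphabet is never empty: MathComp-Analysis only puts topologies and
   sigma-algebras on types with a distinguished point. *)
Definition letter (m : nat) := discrete_topology 'I_m.+2.

HB.instance Definition _ m := Topological.on (letter m).
HB.instance Definition _ m := isPointed.Build (letter m) ord0.

(* Indices start at 0: the letter [t_k] of the text is [t k.-1]. *)
Definition symb (m : nat) : Type := prod_topology (fun _ : nat => letter m).

HB.instance Definition _ m := Topological.copy (symb m)
  (prod_topology (fun _ : nat => letter m)).
HB.instance Definition _ m := Pointed.on (symb m).

(* Borel sigma-algebra of the product topology. *)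
HB.instance Definition _ m :=
  Measurable.copy (symb m) (g_sigma_algebraType (@open (symb m))).


Section symbolic_space.
Variable m : nat.
Local Notation b := m.+2.
Local Notation word := (seq 'I_b).

(* [trunc t n] is the word [t|n], and [cyl w] the cylinder [[w]]. *)
Definition trunc (t : symb m) (n : nat) : word := mkseq t n.

Definition cyl (w : word) : set (symb m) := [set t | trunc t (size w) = w].

Lemma cyl_nil : cyl [::] = setT.
Proof. by apply/seteqP; split. Qed.

Lemma cyl_rcons w a : cyl (rcons w a) = cyl w `&` [set t | t (size w) = a].
Proof.
apply/seteqP; split => t; rewrite /cyl /trunc /= size_rcons mkseqS.
  by move/rcons_inj => -[].
by move=> [-> ->].
Qed.

Lemma open_letter (k : nat) (a : 'I_b) : open [set t : symb m | t k = a].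
Proof.
have kc : continuous (proj k : symb m -> letter m) by exact: proj_continuous.
have oa : open ([set a] : set (letter m)) by exact: discrete_open.
exact: (@open_comp _ _ (proj k : symb m -> letter m) _ (fun t _ => kc t) oa).
Qed.

Lemma open_cyl w : open (cyl w).
Proof.
elim/last_ind: w => [|w a IH]; first by rewrite cyl_nil; exact: openT.
by rewrite cyl_rcons; apply: openI => //; exact: open_letter.
Qed.

Lemma measurable_cyl w : measurable (cyl w).
Proof. by apply: sub_sigma_algebra; exact: open_cyl. Qed.

Lemma cyl_trunc t n : cyl (trunc t n) t.
Proof. by rewrite /cyl /= size_mkseq. Qed.

Lemma cyl_truncP t n s : cyl (trunc t n) s <-> forall k, (k < n)%N -> s k = t k.
Proof.
rewrite /cyl /= size_mkseq; split => [st k kn|st].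
  by rewrite -(nth_mkseq ord0 s kn) [mkseq _ _]st nth_mkseq.
by apply/eq_in_map => k; rewrite mem_iota => /andP[_ kn]; exact: st.
Qed.

Lemma nbhs_cyl (t : symb m) (U : set (symb m)) :
  nbhs t U -> exists n, cyl (trunc t n) `<=` U.
Proof.
pose F := filter_from [set: nat] (fun n => cyl (trunc t n)).
have FF : Filter F.
  apply: filter_from_filter; first by exists 0%N.
  move=> i j _ _; exists (maxn i j) => // s /cyl_truncP st.
  by split; apply/cyl_truncP => k ki; apply: st; rewrite leq_max ki ?orbT.
have : F --> t.
  apply/cvg_sup => k V [W] [[B] oB <-] Bt BV.
  exists k.+1 => // s /cyl_truncP st; apply: BV => /=.
  by rewrite /= st.
by move=> Ft /Ft [n _ ?]; exists n.
Qed.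

Lemma open_bigcup_cyl (U : set (symb m)) :
  open U -> U = \bigcup_(w in [set w | cyl w `<=` U]) cyl w.
Proof.
move=> oU; apply/seteqP; split => [t Ut|t [w /= wU /wU //]].
have [n tU] := nbhs_cyl (open_nbhs_nbhs (conj oU Ut)).
by exists (trunc t n) => //; exact: cyl_trunc.
Qed.

Lemma measurable_to_symb d (T : measurableType d) (f : T -> symb m) :
  (forall w, measurable (f @^-1` cyl w)) -> measurable_fun setT f.
Proof.
move=> mf; apply: (@measurability _ _ _ _ setT f (@open (symb m))) => // _ [U oU <-].
rewrite setTI.
rewrite (open_bigcup_cyl oU) preimage_bigcup.
rewrite bigcup_mkcond; apply: countable_bigcupT_measurable => // w.
by case: ifP.
Qed.

(* The integer [i(w)] with [i(w) b^-n = \sum_(1 <= k <= n) w_k b^-k]. *)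
Definition idx (w : word) : nat :=
  (\sum_(k < size w) nth ord0 w k * b ^ (size w - k.+1))%N.

Lemma idx_rcons w a : idx (rcons w a) = (idx w * b + a)%N.
Proof.
rewrite /idx size_rcons big_ord_recr /= nth_rcons ltnn eqxx subnn expn0 muln1.
congr (_ + _)%N; rewrite big_distrl /=; apply: eq_bigr => k _.
by rewrite nth_rcons ltn_ord subSn // expnS -mulnA (mulnC b).
Qed.

Definition delta (v w : word) : nat := `|(idx v)%:Z - (idx w)%:Z|%N.

End symbolic_space.

Section uniform_measure.
Variables (R : realType) (m : nat).
Local Notation b := m.+2.

Definition digits (x : R) : symb m :=
  fun k => inord (Num.truncn (x * b%:R ^+ k.+1) %% b).

Lemma measurable_digits : measurable_fun setT digits.
Proof.
apply: measurable_to_symb => w; elim/last_ind: w => [|w a IH].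
  by rewrite cyl_nil preimage_setT.
rewrite cyl_rcons preimage_setI; apply: measurableI => //.
set c : R := b%:R ^+ (size w).+1.
have -> : digits @^-1` [set t | t (size w) = a] =
    \bigcup_(q in [set q | (q %% b)%N = a :> nat])
      [set x | Num.truncn (x * c) = q].
  apply/seteqP; split => x /=.
    move=> <-; exists (Num.truncn (x * c)) => //=.
    by rewrite inordK // ltn_mod.
  by move=> [q /= qa xq]; apply/val_inj; rewrite /= /digits inordK ?ltn_mod // -/c xq.
apply: bigcup_measurable => q _.
have mlt (r : R) : measurable [set x : R | x * c < r].
  have -> : [set x : R | x * c < r] = `]-oo, r / c[%classic.
    by apply/seteqP; split => x /=; rewrite in_itv /= ltr_pdivlMr ?exprn_gt0.
  exact: measurable_itv.
case: q => [|q].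
  have -> : [set x : R | Num.truncn (x * c) = 0%N] = [set x | x * c < 1].
    by apply/seteqP; split => x /=; rewrite -[1]/(1%:R) -truncn_le_nat leqn0 => /eqP.
  exact: mlt.
have -> : [set x : R | Num.truncn (x * c) = q.+1] =
    [set x | x * c < q.+2%:R] `\` [set x | x * c < q.+1%:R].
  apply/seteqP; split => x /=; rewrite -!truncn_le_nat.
    by move=> ->; rewrite leqnn ltnn.
  by move=> [le1 /negP]; rewrite -ltnNge => le2; apply/eqP; rewrite eqn_leq le1.
exact: measurableD.
Qed.

(* [ell] is the law of the base-[b] digits of a uniform point of [0, 1[. *)
Definition ell : set (symb m) -> \bar R :=
  pushforward (mrestr lebesgue_measure (measurable_itv `[(0 : R), 1[)) digits.

Let ell0 : ell set0 = 0%E.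
Proof. by rewrite /ell /pushforward preimage_set0 measure0. Qed.

Let ell_ge0 A : (0 <= ell A)%E.
Proof. by rewrite /ell /pushforward measure_ge0. Qed.

Let ell_sigma_additive : semi_sigma_additive ell.
Proof.
by apply: measure_semi_sigma_additive; exact: measurable_digits.
Qed.

HB.instance Definition _ := isMeasure.Build _ _ _ ell
  ell0 ell_ge0 ell_sigma_additive.

Lemma truncn_divb (x : R) n : 0 <= x ->
  (Num.truncn (x * b%:R ^+ n.+1) %/ b)%N = Num.truncn (x * b%:R ^+ n).
Proof.
move=> x0; apply/esym/eqP; rewrite truncn_eq ?mulr_ge0 ?exprn_ge0 //.
set q := Num.truncn _.
have /truncn_itv/andP[] : 0 <= x * b%:R ^+ n.+1 by rewrite mulr_ge0 ?exprn_ge0.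
rewrite -/q exprSr mulrA => qle ltq.
apply/andP; split.
  rewrite -(ler_pM2r (_ : 0 < b%:R)) // (le_trans _ qle) // -natrM ler_nat.
  exact: leq_divM.
rewrite -(ltr_pM2r (_ : 0 < b%:R)) // (lt_le_trans ltq) // -natrM ler_nat.
by rewrite ltn_ceil.
Qed.

Lemma digits_cyl (x : R) w : 0 <= x < 1 ->
  cyl w (digits x) <-> Num.truncn (x * b%:R ^+ size w) = idx w.
Proof.
move=> /andP[x0 x1]; elim/last_ind: w => [|w a IH].
  rewrite /idx big_ord0 expr0 mulr1; split => // _.
  by apply/eqP; rewrite truncn_eq // x0.
rewrite cyl_rcons size_rcons idx_rcons /=.
set q := Num.truncn _.
have qb : (q %/ b)%N = Num.truncn (x * b%:R ^+ size w) by exact: truncn_divb.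
split.
  move=> [/IH xw xa]; rewrite (divn_eq q b) qb xw -xa /digits inordK ?ltn_mod //.
move=> qE; have qb' : (q %/ b)%N = idx w by rewrite qE divnMDl // divn_small ?addn0.
split; first by apply/IH; rewrite -qb.
apply/val_inj; rewrite /= /digits inordK ?ltn_mod // -/q qE modnMDl modn_small //.
Qed.

Lemma ltn_idx (w : seq 'I_b) : (idx w < b ^ size w)%N.
Proof.
elim/last_ind: w => [|w a IH]; first by rewrite /idx big_ord0.
rewrite idx_rcons size_rcons expnSr (@leq_trans ((idx w).+1 * b)) //.
  by rewrite mulSn addnC ltn_add2r.
by rewrite leq_mul2r IH orbT.
Qed.

Lemma ell_cyl w : ell (cyl w) = (b%:R ^- size w)%:E.
Proof.
set c : R := b%:R ^+ size w; have c0 : 0 < c by rewrite exprn_gt0.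
rewrite /ell /pushforward /mrestr.
have -> : digits @^-1` cyl w `&` `[0, 1[ =
    `[(idx w)%:R / c, (idx w).+1%:R / c[%classic.
  apply/seteqP; split => x /=; rewrite !in_itv /= ler_pdivrMr // ltr_pdivlMr //.
    move=> [xw x01]; have /andP[x0 x1] := x01.
    have /(digits_cyl w x01)/eqP := xw.
    by rewrite truncn_eq // mulr_ge0 // ltW.
  move=> xw; have /andP[lex ltx] := xw.
  have x0 : 0 <= x by rewrite -(pmulr_lge0 _ c0) (le_trans _ lex).
  have x1 : x < 1.
    rewrite -(ltr_pM2r c0) mul1r (lt_le_trans ltx) // /c -natrX ler_nat.
    exact: ltn_idx.
  split; last by rewrite x0.
  by apply/(digits_cyl w); rewrite ?x0 //; apply/eqP; rewrite truncn_eq // mulr_ge0 // ltW.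
rewrite lebesgue_measure_itv /= lte_fin ltr_pM2r ?invr_gt0 // ltr_nat ltnSn.
by rewrite -EFinD -mulrBl -natrB // subSnn mul1r.
Qed.

Let ell_setT : ell setT = 1%E.
Proof. by rewrite -(@cyl_nil m) ell_cyl expr0 invr1. Qed.

HB.instance Definition _ := Measure_isProbability.Build _ _ R ell ell_setT.

End uniform_measure.

Section measures_on_symb.
Variables (R : realType) (m : nat).
Local Notation b := m.+2.
Local Notation word := (seq 'I_b).
Implicit Types (nu : set (symb m) -> \bar R) (q beta : R) (eps : nat -> R).

(* Real powers are [powR], for which [0 `^ q = 0] if [q != 0], even for
   [q < 0]; the measures considered below almost surely charge all
   cylinders. *)
Definition partition_sum nu q (n : nat) : R :=
  \sum_(w : n.-tuple 'I_b) fine (nu (cyl w)) `^ q.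

(* The factor [b ^ n = 1 / ell [w]] makes [gibbs] give mass
   [nu [w] ^ q / partition_sum nu q n] to the cylinder [[w]], [w] of length
   [n]. *)
Definition gibbs_density nu q n (t : symb m) : R :=
  b%:R ^+ n * (fine (nu (cyl (trunc t n))) `^ q / partition_sum nu q n).

Lemma partition_sum_ge0 nu q n : 0 <= partition_sum nu q n.
Proof. by apply: sumr_ge0 => w _; exact: powR_ge0. Qed.

Lemma gibbs_density_ge0 nu q n t : 0 <= gibbs_density nu q n t.
Proof.
by rewrite mulr_ge0 ?exprn_ge0 // divr_ge0 ?powR_ge0 ?partition_sum_ge0.
Qed.

Lemma measurable_trunc (h : word -> R) n :
  measurable_fun setT (fun t : symb m => h (trunc t n)).
Proof.
move=> _ B _; rewrite setTI.
have -> : (fun t : symb m => h (trunc t n)) @^-1` B =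
    \bigcup_w (if (h w \in B) && (size w == n) then cyl w else set0).
  apply/seteqP; split => t /=.
    move=> Bt; exists (trunc t n) => //.
    by rewrite mem_set // size_mkseq eqxx /=; exact: cyl_trunc.
  move=> [w _]; case: ifP => // /andP[/set_mem Bw /eqP <-].
  by rewrite /cyl /= => ->.
apply: countable_bigcupT_measurable => // w.
by case: ifP => // _; exact: measurable_cyl.
Qed.

Lemma measurable_gibbs_density nu q n : measurable_fun setT (gibbs_density nu q n).
Proof.
exact: (measurable_trunc
  (fun w => b%:R ^+ n * (fine (nu (cyl w)) `^ q / partition_sum nu q n))).
Qed.

Definition gibbs nu q n : set (symb m) -> \bar R :=
  fun A => (\int[@ell R m]_(t in A) (gibbs_density nu q n t)%:E)%E.

Let gibbs0 nu q n : gibbs nu q n set0 = 0%E.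
Proof. exact: integral_set0. Qed.

Let gibbs_ge0 nu q n A : (0 <= gibbs nu q n A)%E.
Proof. by apply: integral_ge0 => t _; rewrite lee_fin gibbs_density_ge0. Qed.

Let gibbs_sigma_additive nu q n : semi_sigma_additive (gibbs nu q n).
Proof.
move=> /= F mF tF mUF; rewrite /gibbs; apply: cvg_toP.
  apply: ereal_nondecreasing_is_cvgn => i j ij.
  by apply: lee_sum_nneg_natr => // k _ _; exact: gibbs_ge0.
rewrite ge0_integral_bigcup //=.
- apply/measurable_EFinP; apply: (@measurable_funS _ _ _ _ setT) => //.
  exact: measurable_gibbs_density.
- by move=> t _; rewrite lee_fin gibbs_density_ge0.
Qed.

HB.instance Definition _ nu q n := isMeasure.Build _ _ _ (gibbs nu q n)
  (gibbs0 nu q n) (gibbs_ge0 nu q n) (@gibbs_sigma_additive nu q n).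

Lemma gibbs_cyl nu q n (w : n.-tuple 'I_b) :
  gibbs nu q n (cyl w) = (fine (nu (cyl w)) `^ q / partition_sum nu q n)%:E.
Proof.
pose c := b%:R ^+ n * (fine (nu (cyl w)) `^ q / partition_sum nu q n).
rewrite /gibbs.
under eq_integral => t.
  rewrite inE /cyl /= size_tuple => tw.
  rewrite /gibbs_density tw -/c; over.
rewrite integral_cst /=; last exact: measurable_cyl.
by rewrite [X in (_ * X)%E](ell_cyl R w) size_tuple -EFinM mulrAC mulfV ?mul1r //.
Qed.

Definition weak_cvg (nus : nat -> {measure set (symb m) -> \bar R})
    (nu : {measure set (symb m) -> \bar R}) :=
  forall f : symb m -> R, continuous f ->
    (\int[nus k]_t (f t)%:E)%E @[k --> \oo] --> (\int[nu]_t (f t)%:E)%E.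

(* [nuq] is a weak limit of a subsequence of the measures [gibbs nu q n],
   [n >= 1]. *)
Definition gibbs_weak_limit nu q (nuq : probability (symb m) R) :=
  exists phi : nat -> nat,
    [/\ forall k, (1 <= phi k)%N,
        {homo phi : k l / (k < l)%N} &
        weak_cvg (fun k => gibbs nu q (phi k)) nuq].

(* The condition [b ^ (g n (beta - g eps_n)) nu[w] ^ g <= 1] for both [g = 1]
   and [g = -1], written as a two-sided bound on [nu[w]]: so a null cylinder is
   correctly excluded, whereas [0 `^ (-1) = 0] for [powR]. *)
Definition sing_set nu beta (N : nat) eps (p : nat) : set (symb m) :=
  [set t | forall n, (p <= n)%N -> forall w : n.-tuple 'I_b,
    (delta w (trunc t n) <= N)%N ->
    ((b%:R `^ (- (n%:R * (beta + eps n))))%:E <= nu (cyl w)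
      <= (b%:R `^ (- (n%:R * (beta - eps n))))%:E)%E].

(* Extended-real valued, [+oo] being the infimum of the empty set. *)
Definition growth_speed (mm nu : set (symb m) -> \bar R) beta (N : nat) eps :
    \bar R :=
  ereal_inf [set p%:R%:E | p in
    [set p | (1 <= p)%N /\ ((2^-1)%:E <= mm (sing_set nu beta N eps p))%E]].

(* The liminf defining [tau_nu(q)] for a single measure [nu]; its term of
   index [0] is irrelevant. *)
Definition lim_tau nu q : \bar R :=
  limn_einf (fun j : nat =>
    (- (j%:R^-1 * (ln (partition_sum nu q j) / ln b%:R)))%:E).

End measures_on_symb.

Section random_measures.
Context {R : realType} {d : measure_display} {Omega : measurableType d}.

(* The sigma-algebra generated by the [X i] for [i] in [D]. *)
Definition sigma_gen (T I : Type) (D : set I) (X : I -> T -> \bar R) :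
    set (set T) :=
  <<s [set A | exists i (B : set (\bar R)),
         [/\ D i, measurable B & A = X i @^-1` B]] >>.

(* Equality of the laws of [(X i)_(i in D)] and [(Y i)_(i in D)] on the product
   sigma-algebra, the one generated by the coordinates of index in [D]. *)
Definition same_law (P : probability Omega R) (I : Type) (D : set I)
    (X Y : I -> Omega -> \bar R) :=
  forall B : set (I -> \bar R), sigma_gen D (fun i x => x i) B ->
    P [set omega | B (X ^~ omega)] = P [set omega | B (Y ^~ omega)].

Definition independent (P : probability Omega R) (F G : set (set Omega)) :=
  forall A B, F A -> G B -> P (A `&` B) = (P A * P B)%E.

Variable m : nat.

(* [mupre j] is [mu_j], [mupost j] is [mu^(j)], and random measures are
   kernels from the probability space to the space of texts. *)
Record quasi_bernoulli (P : probability Omega R) (mu : R.-pker Omega ~> symb m)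
    (C : R) (mupre mupost : nat -> R.-ker Omega ~> symb m) : Prop :=
  QuasiBernoulli {
  qb_C_gt0 : 0 < C;
  qb_post0 : forall omega (A : set (symb m)), measurable A ->
    mupost 0%N omega A = mu omega A;
  qb_P1 : forall j, (1 <= j)%N -> {ae P, forall omega,
    forall (v : j.-tuple 'I_m.+2) (w : seq 'I_m.+2), w != [::] ->
      (C^-1%:E * (mupre j omega (cyl v) * mupost j omega (cyl w))
         <= mu omega (cyl (v ++ w))
         <= C%:E * (mupre j omega (cyl v) * mupost j omega (cyl w)))%E};
  qb_P2 : forall r : 'I_m.+2, let X omega := mu omega (cyl [:: r]) in
    (0 < ess_inf P X /\ ess_inf P X <= ess_sup P X /\ ess_sup P X < +oo)%E;
  qb_P3 : forall j, (1 <= j)%N ->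
    same_law P [set w : seq 'I_m.+2 | w != [::]]
      (fun w omega => mupost j omega (cyl w)) (fun w omega => mu omega (cyl w));
  qb_P4 : forall j, (1 <= j)%N ->
    independent P
      (sigma_gen [set: j.-tuple 'I_m.+2] (fun v omega => mupre j omega (cyl v)))
      (sigma_gen [set w : seq 'I_m.+2 | w != [::]]
        (fun w omega => mupost j omega (cyl w))) }.

(* [tau] is the deterministic function almost surely equal to [tau_mu]. *)
Definition is_tau (P : probability Omega R) (mu : R.-pker Omega ~> symb m)
    (tau : R -> R) :=
  {ae P, forall omega, forall q, lim_tau (mu omega) q = (tau q)%:E}.

End random_measures.

Definition twice_continuously_differentiable (R : realType) (f : R -> R) :=
  [/\ forall x, derivable f x 1, forall x, derivable (derive1 f) x 1 &
      continuous (derive1n 2 f)].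

(* Main.v *)
Require Import Defs.
From HB Require Import structures.
From mathcomp Require Import all_boot all_order all_algebra.
From mathcomp Require Import all_classical all_reals all_analysis.
From mathcomp Require Import measurable_realfun ess_sup_inf.
From mathcomp Require Import ring lra zify.

(** Write [f w] for the mass of the cylinder of [w] under one of the copies
    [mu^(j)], [Z_n(q)] for the sum of [f w `^ q] over the words of length [n]
    ([zeta f q n]), and [L = ln b].

    For one sample. The quasi-Bernoulli property says that [f (v ++ w) / f v]
    depends on [v] only through its length, up to a constant
    ([quasi_bernoulli_regular]). Hence the words of length [k] keep nearly the
    same shares in all later partition sums, and every weak limit of the Gibbs
    measures gives to the cylinder of [w] a mass comparable with
    [f w `^ q / Z_n(q)] ([gibbs_limit_bounds]). Suppose now that
    [ln Z_n(q') = - n * tau q' * L] up to [O(n^(3/4) * ln n)] for all [n >= p]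
    and all [q'] close to [K]. An exponential Chebyshev inequality, which compares
    [Z_n(q + s)] with [Z_n(q)], and the second order Taylor bound on [tau] show
    that the words of length [n] with [f w] outside of
    [b^(- n * (tau' q -+ eps n))] have Gibbs mass at most
    [b^(M * n^(3/4) * ln n - a * n * (eps n)^2)] ([tail_mass]), the general term of
    the convergent series of the hypotheses. As for the neighbours of a word [v],
    they share all but the last [l] letters of [v] unless the block of these
    letters is one of the [2 * N] blocks next to an edge of the range of its digit
    expansion. Such blocks have exponentially small Gibbs mass, because every
    letter takes a fixed share ([gibbs_near_edge]); and [l] letters change [f] by
    at most [exp (kap * l)], which is absorbed by the band when [l] is a small
    multiple of [n * eps n]. So both singularity sets have mass at least [1 / 2]
    from level [p] on, once [p] exceeds a constant that depends neither on the
    sample nor on [q] ([deterministic_growth]); the Gibbs measure itself is covered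
    because its weights are known from [f] and [Z_n(q)].

    Probability. Splitting a word at position [k] shows that [ln Z_n(q)] is almost
    additive, the second block being independent of the first and distributed as a
    block started at the origin. Multiplying the Laplace transforms of blocks of
    length [sqrt n] gives, for every [A], a constant [M] with
    [P (|ln Z_n(q) - n * x| > M * n^(3/4) * ln n) <= 2 * exp (- A * (ln n)^2)]
    ([almost_additive_concentration]); the slope [x] can only be [- tau q * L],
    the almost sure growth rate ([concentration_tau]). As [ln Z_n(q)] and
    [n * tau q] are Lipschitz in [q] with constant [O(n)], a grid of step [1 / n]
    makes the estimate uniform in [q]. The probability that it fails at some level
    [n >= p] is at most a constant times [exp (- 8 * (ln p)^2)], which for
    [p = S_j] is at most a constant times [j^(-2)]. Since [mu^(j)] has the law of
    [mu], the Borel-Cantelli lemma shows that almost surely, for [j] large enough,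
    [mu^(j)] satisfies the assumption made above with [p = S_j]
    ([eventually_not_bad]). *)

Set Implicit Arguments.
Unset Strict Implicit.
Unset Printing Implicit Defensive.

Import Order.TTheory GRing.Theory Num.Theory.
Import numFieldNormedType.Exports.

Local Open Scope classical_set_scope.
Local Open Scope ring_scope.

(** * Sums over words *)

Section sums_over_words.
Variables (V : nmodType) (T : finType).
Implicit Types F : seq T -> V.

Lemma sum_tuple_cat k l F :
  \sum_(w : (k + l).-tuple T) F w =
  \sum_(v : k.-tuple T) \sum_(u : l.-tuple T) F (v ++ u).
Proof.
rewrite pair_big /= (reindex (fun p : k.-tuple T * l.-tuple T =>
  [tuple of p.1 ++ p.2])) //=.
apply: onW_bij; apply: inj_card_bij.
  move=> [v u] [v' u'] /(congr1 val) /eqP /=.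
  by rewrite eqseq_cat ?size_tuple // => /andP[/eqP/val_inj -> /eqP/val_inj ->].
by rewrite card_prod !card_tuple expnD.
Qed.

Lemma sum_tuple_rcons l F :
  \sum_(w : l.+1.-tuple T) F w =
  \sum_(v : l.-tuple T) \sum_a F (rcons v a).
Proof.
rewrite pair_big /= (reindex (fun p : l.-tuple T * T =>
  [tuple of rcons p.1 p.2])) //=.
apply: onW_bij; apply: inj_card_bij.
  by move=> [v u] [v' u'] /(congr1 val) /rcons_inj [/val_inj -> ->].
by rewrite card_prod !card_tuple expnSr.
Qed.

Lemma sum_tuple0 F : \sum_(w : 0.-tuple T) F w = F [::].
Proof.
rewrite (bigD1 [tuple]) //= big1 ?addr0 // => w /eqP[].
by apply: val_inj; case: w => -[].
Qed.

Lemma additive_sum_tuple F : (forall w, F w = \sum_a F (rcons w a)) ->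
  forall l w, \sum_(u : l.-tuple T) F (w ++ u) = F w.
Proof.
move=> FD; elim=> [|l IH] w; first by rewrite (@sum_tuple0 (fun u => F (w ++ u))) cats0.
rewrite (@sum_tuple_rcons l (fun u => F (w ++ u))) -[RHS]IH.
apply: eq_bigr => u _.
by rewrite FD; apply: eq_bigr => a _; rewrite rcons_cat.
Qed.

End sums_over_words.

(** * Quasi-multiplicative weights and their partition sums *)

Section powR_ratio.
Variable R : realType.
Implicit Types x y q d : R.

Lemma powR_expR x q : 0 < x -> x `^ q = expR (q * ln x).
Proof. by move=> x0; rewrite /powR gt_eqF. Qed.

(** A two-sided bound on a ratio bounds its real powers whatever their sign;
    this is what keeps negative [q] on the same footing as positive [q]. *)
Lemma powR_quasi_le x y q d : 0 < x -> 0 < y ->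
  x <= expR d * y -> y <= expR d * x -> x `^ q <= expR (`|q| * d) * y `^ q.
Proof.
move=> x0 y0 xy yx; rewrite !powR_expR // -expRD ler_expR.
have E z : 0 < z -> expR (ln z) = z by move=> z0; rewrite lnK // posrE.
have {}xy : ln x <= d + ln y by rewrite -ler_expR expRD !E.
have {}yx : ln y <= d + ln x by rewrite -ler_expR expRD !E.
rewrite -lerBlDr -mulrBr (le_trans (ler_norm _)) // normrM ler_wpM2l //.
by rewrite ler_norml; apply/andP; split; lra.
Qed.

Lemma sum_powR_gt0 (I : finType) (x : I -> R) (q : R) :
  (forall i, 0 < x i) -> (0 < #|I|)%N -> 0 < \sum_i x i `^ q.
Proof.
move=> x0 /card_gt0P[i0 _]; rewrite (bigD1 i0) //= ltr_pwDl ?powR_gt0 //.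
by apply: sumr_ge0 => i _; exact: powR_ge0.
Qed.

Lemma ln_sum_ratio (I : finType) (x y : I -> R) (D q : R) :
  (forall i, 0 < x i) -> (forall i, 0 < y i) -> (0 < #|I|)%N ->
  (forall i, x i <= expR D * y i) -> (forall i, y i <= expR D * x i) ->
  `|ln (\sum_i x i `^ q) - ln (\sum_i y i `^ q)| <= `|q| * D.
Proof.
move=> x0 y0 I0 xy yx.
have S0 (z : I -> R) : (forall i, 0 < z i) -> 0 < \sum_i z i `^ q.
  by move=> z0; exact: sum_powR_gt0.
have half (z t : I -> R) : (forall i, 0 < z i) -> (forall i, 0 < t i) ->
    (forall i, z i <= expR D * t i) -> (forall i, t i <= expR D * z i) ->
    ln (\sum_i z i `^ q) <= `|q| * D + ln (\sum_i t i `^ q).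
  move=> z0 t0 zt tz.
  rewrite -[X in X + _]expRK -lnM ?posrE ?expR_gt0 ?S0 //.
  rewrite ler_ln ?posrE ?mulr_gt0 ?expR_gt0 ?S0 // mulr_sumr.
  by apply: ler_sum => i _; exact: powR_quasi_le.
have h1 := half x y x0 y0 xy yx; have h2 := half y x y0 x0 yx xy.
by rewrite ler_norml; apply/andP; split; lra.
Qed.

End powR_ratio.

Section weights.
Variables (R : realType) (m : nat).
Local Notation b := m.+2.
Local Notation word := (seq 'I_b).
Implicit Types (f : word -> R) (q kap d : R).

Definition zeta f q n : R := \sum_(w : n.-tuple 'I_b) f w `^ q.

(** [rw_qb] says that, up to [expR d], the ratio [f (v ++ w) / f v] depends on
    [v] only through its length. It is the quasi-Bernoulli property written in
    terms of the weight alone, without the measures that carry the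
    continuations, so that it passes to every measure with the same law. *)
Record regular_weight kap d f : Prop := RegularWeight {
  rw_nil : f [::] = 1;
  rw_add : forall w, f w = \sum_a f (rcons w a);
  rw_low : forall w a, expR (- kap) * f w <= f (rcons w a);
  rw_qb : forall v v' w, size v = size v' ->
    f (v ++ w) * f v' <= expR d * (f v * f (v' ++ w)) }.

Section regular.
Variables (kap d : R) (f : word -> R).
Hypothesis rf : regular_weight kap d f.

Lemma rw_gt0 w : 0 < f w.
Proof.
elim/last_ind: w => [|w a IH]; first by rewrite (rw_nil rf).
by apply: lt_le_trans (rw_low rf w a); rewrite mulr_gt0 ?expR_gt0.
Qed.

Lemma rw_rcons_le w a : f (rcons w a) <= f w.
Proof.
rewrite (rw_add rf w) (bigD1 a) //= lerDl sumr_ge0 // => i _.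
exact/ltW/rw_gt0.
Qed.

Lemma rw_cat_le v u : f (v ++ u) <= f v.
Proof.
elim/last_ind: u => [|u a IH]; first by rewrite cats0.
by rewrite -rcons_cat (le_trans (rw_rcons_le _ _)).
Qed.

Lemma rw_cat_ge v u : expR (- kap * (size u)%:R) * f v <= f (v ++ u).
Proof.
elim/last_ind: u => [|u a IH]; first by rewrite cats0 mulr0 expR0 mul1r.
rewrite -rcons_cat size_rcons (le_trans _ (rw_low rf _ a)) //.
have -> : - kap * (size u).+1%:R = - kap + - kap * (size u)%:R :> R.
  by rewrite -natr1; ring.
by rewrite expRD -mulrA ler_wpM2l ?expR_ge0.
Qed.

Lemma rw_le1 w : f w <= 1.
Proof. by rewrite -(rw_nil rf) -{1}[w]cat0s rw_cat_le. Qed.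

Lemma rw_ge w : expR (- kap * (size w)%:R) <= f w.
Proof. by have := rw_cat_ge [::] w; rewrite (rw_nil rf) mulr1. Qed.

Lemma zeta_gt0 q n : 0 < zeta f q n.
Proof.
have wt : n.-tuple 'I_b := [tuple of nseq n ord0].
rewrite /zeta (bigD1 wt) //= ltr_pwDl ?powR_gt0 ?rw_gt0 //.
by rewrite sumr_ge0 // => i _; rewrite powR_ge0.
Qed.

Lemma quasi_power q v v' w : size v = size v' ->
  f (v ++ w) `^ q * f v' `^ q <= expR (`|q| * d) * (f v `^ q * f (v' ++ w) `^ q).
Proof.
move=> sv; have f0 z : 0 <= f z by exact/ltW/rw_gt0.
rewrite -!powRM //; apply: powR_quasi_le; rewrite ?mulr_gt0 ?rw_gt0 ?(rw_qb rf) //.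
by rewrite [f v * _]mulrC [f (v ++ w) * _]mulrC (rw_qb rf).
Qed.

Lemma quasi_sum q l v v' : size v = size v' ->
  (\sum_(u : l.-tuple 'I_b) f (v ++ u) `^ q) * f v' `^ q <=
  expR (`|q| * d) * (f v `^ q * \sum_(u : l.-tuple 'I_b) f (v' ++ u) `^ q).
Proof.
move=> sv; rewrite mulr_suml !mulr_sumr; apply: ler_sum => u _.
exact: quasi_power.
Qed.

(** By [quasi_sum] the words of length [k] contribute to the partition sum of
    level [k + l] in nearly the same proportions [f v `^ q / zeta f q k] as to
    the partition sum of level [k]. The error does not grow with [l], so it
    survives the limit defining the Gibbs measures. *)
Lemma gibbs_upper q k l (v : k.-tuple 'I_b) :
  (\sum_(u : l.-tuple 'I_b) f (v ++ u) `^ q) / zeta f q (k + l) <=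
  expR (`|q| * d) * (f v `^ q / zeta f q k).
Proof.
rewrite mulrA ler_pdivlMr ?zeta_gt0 // mulrAC ler_pdivrMr ?zeta_gt0 //.
rewrite /zeta (@sum_tuple_cat _ _ k l (fun w => f w `^ q)) -mulrA !mulr_sumr.
by apply: ler_sum => v' _; rewrite quasi_sum // !size_tuple.
Qed.

Lemma gibbs_lower q k l (v : k.-tuple 'I_b) :
  expR (- (`|q| * d)) * (f v `^ q / zeta f q k) <=
  (\sum_(u : l.-tuple 'I_b) f (v ++ u) `^ q) / zeta f q (k + l).
Proof.
rewrite expRN ler_pdivrMl ?expR_gt0 // mulrA ler_pdivrMr ?zeta_gt0 // mulrAC.
rewrite ler_pdivlMr ?zeta_gt0 //.
rewrite /zeta (@sum_tuple_cat _ _ k l (fun w => f w `^ q)) -!mulrA !mulr_sumr.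
apply: ler_sum => v' _; rewrite [leLHS]mulrC [X in _ <= _ * X]mulrC quasi_sum //.
by rewrite !size_tuple.
Qed.

End regular.
End weights.

(** * Cylinders and weak limits of Gibbs measures *)

Section cylinders.
Variables (R : realType) (m : nat).
Local Notation b := m.+2.
Local Notation word := (seq 'I_b).

Lemma cyl_split (w : word) : cyl w = \big[setU/set0]_(a < b) cyl (rcons w a).
Proof.
rewrite -bigcup_mkord_ord; apply/seteqP; split => t.
  move=> wt; exists (t (size w)) => //=.
  by rewrite inord_val cyl_rcons.
by move=> [a _]; rewrite cyl_rcons => -[].
Qed.

Lemma measure_cyl_rcons (nu : {measure set (symb m) -> \bar R}) (w : word) :
  nu (cyl w) = (\sum_a nu (cyl (rcons w a)))%E.
Proof.
rewrite {1}cyl_split measure_bigsetU_ord //; first by move=> a; exact: measurable_cyl.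
apply/trivIsetP => a a' _ _ aa'; rewrite !cyl_rcons.
by apply/seteqP; split => t // -[[_ /= ta] [_ /= ta']]; move: aa'; rewrite -ta -ta' eqxx.
Qed.

Lemma measure_cyl_cat (nu : {measure set (symb m) -> \bar R}) l (w : word) :
  nu (cyl w) = (\sum_(u : l.-tuple 'I_b) nu (cyl (w ++ u)))%E.
Proof.
exact/esym/(@additive_sum_tuple _ _ (fun w => nu (cyl w)) (measure_cyl_rcons nu)).
Qed.

(** Cylinders are open and closed, so weak limits can be tested on them. *)
Lemma continuous_indic_cyl (w : word) :
  continuous (\1_(cyl w) : symb m -> R).
Proof.
move=> t.
have H : \forall s \near t, \1_(cyl w) s = \1_(cyl w) t :> R.
  have : nbhs t (cyl (trunc t (size w))).
    by apply: open_nbhs_nbhs; split; [exact: open_cyl|exact: cyl_trunc].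
  apply: filterS => s; rewrite /cyl /= size_mkseq /trunc => st.
  by rewrite !indicE; congr (nat_of_bool _)%:R; apply/idP/idP;
    rewrite !inE /cyl /= /trunc st.
exact: (cvg_near_cst _ H).
Qed.

Definition weight (nu : set (symb m) -> \bar R) (w : word) : R := fine (nu (cyl w)).

Lemma weightE (nu : probability (symb m) R) w : nu (cyl w) = (weight nu w)%:E.
Proof. rewrite /weight fineK //; apply: fin_num_measure; exact: measurable_cyl. Qed.

End cylinders.

Section gibbs_limits.
Variables (R : realType) (m : nat).
Local Notation b := m.+2.
Local Notation word := (seq 'I_b).
Variables (nu : set (symb m) -> \bar R) (q : R) (nuq : probability (symb m) R).

Lemma gibbs_cyl_cat k l (v : k.-tuple 'I_b) :
  gibbs nu q (k + l) (cyl v) =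
  ((\sum_(u : l.-tuple 'I_b) weight nu (v ++ u) `^ q)
    / zeta (weight nu) q (k + l))%:E.
Proof.
rewrite (measure_cyl_cat _ l v) mulr_suml -sumEFin; apply: eq_bigr => u _.
exact: (gibbs_cyl nu q [tuple of v ++ u]).
Qed.

Hypothesis lim : gibbs_weak_limit nu q nuq.

Lemma gibbs_limit_cyl (w : word) : exists phi : nat -> nat,
  {homo phi : k l / (k < l)%N} /\
  (gibbs nu q (phi k) (cyl w) @[k --> \oo] --> (weight nuq w)%:E).
Proof.
have [phi [_ phi_lt cvg_phi]] := lim; exists phi; split => //.
have := cvg_phi _ (@continuous_indic_cyl R m w).
rewrite integral_indic ?setIT; [|exact: measurableT|exact: measurable_cyl].
rewrite -(weightE nuq); apply: cvg_trans; apply: near_eq_cvg; apply: nearW => k.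
by rewrite integral_indic ?setIT //; exact: measurable_cyl.
Qed.

Variables (kap d Q : R).
Hypotheses (d0 : 0 <= d) (rf : regular_weight kap d (weight nu)).
Hypothesis qQ : `|q| <= Q.
Local Notation f := (weight nu).
Local Notation g := (weight nuq).

(** The bounds on [gibbs nu q n] are uniform in [n], so they hold for every weak
    limit; all later facts about Gibbs measures are deduced from them. *)
Lemma gibbs_limit_bounds (w : word) :
  expR (- (Q * d)) * (f w `^ q / zeta f q (size w)) <= g w
    <= expR (Q * d) * (f w `^ q / zeta f q (size w)).
Proof.
have [phi [phi_lt cvg_phi]] := gibbs_limit_cyl w.
have ratio_ge0 : 0 <= f w `^ q / zeta f q (size w).
  by rewrite divr_ge0 ?powR_ge0 // ltW // (zeta_gt0 rf).
have phi_ge k : (k <= phi k)%N.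
  by elim: k => // k IH; apply: (leq_ltn_trans IH); exact: phi_lt.
have qd : `|q| * d <= Q * d by rewrite ler_wpM2r.
rewrite -2!lee_fin; apply/andP; split.
  apply: (cvge_ge _ cvg_phi).
  exists (size w) => // k /= wk; have wp := leq_trans wk (phi_ge k).
  rewrite -(subnKC wp) (@gibbs_cyl_cat _ _ (in_tuple w)) lee_fin.
  apply: le_trans (gibbs_lower rf _ _ _).
  by rewrite ler_wpM2r // ler_expR lerN2.
apply: (cvge_le _ cvg_phi).
exists (size w) => // k /= wk; have wp := leq_trans wk (phi_ge k).
rewrite -(subnKC wp) (@gibbs_cyl_cat _ _ (in_tuple w)) lee_fin.
apply: (le_trans (gibbs_upper rf _ _ _)).
by rewrite ler_wpM2r // ler_expR.
Qed.

End gibbs_limits.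

(** * Neighbouring words *)

Section neighbours.
Variable m : nat.
Local Notation b := m.+2.
Local Notation word := (seq 'I_b).
Implicit Types v u w : word.

Lemma idx_cat v u : idx (v ++ u) = (idx v * b ^ size u + idx u)%N.
Proof.
elim/last_ind: u => [|u a IH].
  by rewrite cats0 /= expn0 muln1 /idx [X in (_ + X)%N]big_ord0 addn0.
by rewrite -rcons_cat !idx_rcons IH size_rcons expnSr; lia.
Qed.

Lemma idx_inj v w : size v = size w -> idx v = idx w -> v = w.
Proof.
elim/last_ind: v w => [|v a IH] w.
  by case: w.
case/lastP: w => [|w a']; rewrite !size_rcons // => -[svw].
rewrite !idx_rcons => e.
have aE : a = a' :> nat.
  by move: (congr1 (modn^~ b) e); rewrite /= !modnMDl !modn_small.
congr rcons; last exact: val_inj.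
apply: IH => //; apply/eqP; rewrite -(eqn_pmul2r (_ : 0 < b)%N) //.
by move: e; rewrite aE => /addIn ->.
Qed.

(** The digit blocks [u] for which adding or subtracting at most [N] can carry
    over to the digits before [u]. *)
Definition near_edge (N : nat) u := (idx u < N)%N || (b ^ size u <= idx u + N)%N.

Lemma near_edgePn N v v' u u' : size u = size u' -> size v = size v' ->
  ~~ near_edge N u -> (delta (v' ++ u') (v ++ u) <= N)%N -> v' = v.
Proof.
move=> su sv; rewrite negb_or -leqNgt -ltnNge => /andP[Nu uN].
rewrite /delta !idx_cat => dN; apply: idx_inj => //.
have := ltn_idx u'; rewrite -su in dN * => u'l.
set B := (b ^ size u)%N in dN uN u'l.
have B0 : (0 < B)%N by rewrite expn_gt0.
have lo : (idx v * B <= idx v' * B + idx u')%N by lia.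
have hi : (idx v' * B + idx u' < (idx v).+1 * B)%N by rewrite mulSn; lia.
have E : idx v' = ((idx v' * B + idx u') %/ B)%N.
  by rewrite divnMDl // divn_small // addn0.
apply/eqP; rewrite eqn_leq; apply/andP; split.
  by rewrite -ltnS E ltn_divLR.
by rewrite E leq_divRL.
Qed.

Lemma card_near_edge N l : (#|[pred u : l.-tuple 'I_b | near_edge N u]| <= N.*2)%N.
Proof.
rewrite cardE -(size_map (fun u : l.-tuple 'I_b => idx u)).
have -> : N.*2 = size (iota 0 N ++ iota (b ^ l - N) N).
  by rewrite size_cat !size_iota addnn.
apply: uniq_leq_size.
  rewrite map_inj_uniq ?enum_uniq // => u u' /idx_inj e.
  by apply: val_inj; apply: e; rewrite !size_tuple.
move=> i /mapP[u]; rewrite mem_enum inE /near_edge size_tuple => hu ->.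
rewrite mem_cat !mem_iota; have := ltn_idx u; rewrite size_tuple.
set B := (b ^ l)%N in hu *; set k := idx u in hu *.
by move=> iB; case/orP: hu => hu; lia.
Qed.

End neighbours.

(** * Gibbs weights are spread out *)

Section gibbs_decay.
Variables (R : realType) (m : nat).
Local Notation b := m.+2.
Local Notation word := (seq 'I_b).
Variables (f g : word -> R) (kap d Q q : R).
Hypotheses (kap0 : 0 <= kap) (d0 : 0 <= d) (rf : regular_weight kap d f).
Hypotheses (qQ : `|q| <= Q).
Hypotheses (g1 : g [::] = 1) (gD : forall w, g w = \sum_a g (rcons w a)).
Hypothesis gf : forall w, expR (- (Q * d)) * (f w `^ q / zeta f q (size w)) <= g w
    <= expR (Q * d) * (f w `^ q / zeta f q (size w)).

Let Q0 : 0 <= Q. Proof. exact: le_trans qQ. Qed.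

(** The least share that a letter can receive from the Gibbs weight of the word
    it extends. *)
Definition decay : R := b%:R^-1 * expR (- (2 * Q * (d + kap))).

Lemma decay_gt0 : 0 < decay.
Proof. by rewrite mulr_gt0 ?expR_gt0 ?invr_gt0. Qed.

Lemma decay_lt1 : decay < 1.
Proof.
rewrite /decay mulrC ltr_pdivrMr // mul1r (@le_lt_trans _ _ 1) ?ltr1n //.
by rewrite -expR0 ler_expR oppr_le0 !mulr_ge0 ?addr_ge0.
Qed.

Lemma gibbs_ge0 w : 0 <= g w.
Proof.
have /andP[+ _] := gf w; apply: le_trans.
by rewrite mulr_ge0 ?expR_ge0 // divr_ge0 ?powR_ge0 // ltW // (zeta_gt0 rf).
Qed.

Let f_rcons w a : expR (- (Q * kap)) * f w `^ q <= f (rcons w a) `^ q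
  /\ f (rcons w a) `^ q <= expR (Q * kap) * f w `^ q.
Proof.
have qk : `|q| * kap <= Q * kap by rewrite ler_wpM2r.
have E : 1 <= expR kap by rewrite -expR0 ler_expR.
have le1 : f w <= expR kap * f (rcons w a).
  by have := rw_low rf w a; rewrite expRN ler_pdivrMl ?expR_gt0.
have le2 : f (rcons w a) <= expR kap * f w.
  apply: (le_trans (rw_rcons_le rf w a)).
  by rewrite ler_peMl // ltW // (rw_gt0 rf).
have f0 := rw_gt0 rf.
split.
  rewrite expRN ler_pdivrMl ?expR_gt0 //.
  apply: (le_trans (powR_quasi_le q (f0 w) (f0 (rcons w a)) le1 le2)).
  by rewrite ler_wpM2r ?powR_ge0 // ler_expR.
apply: (le_trans (powR_quasi_le q (f0 (rcons w a)) (f0 w) le2 le1)).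
by rewrite ler_wpM2r ?powR_ge0 // ler_expR.
Qed.

Let zeta_succ n : zeta f q n.+1 <= b%:R * expR (Q * kap) * zeta f q n.
Proof.
rewrite /zeta (@sum_tuple_rcons _ _ n (fun w => f w `^ q)) mulr_sumr.
apply: ler_sum => v _.
rewrite (@le_trans _ _ (\sum_(a < b) expR (Q * kap) * f v `^ q)) //.
  by apply: ler_sum => a _; have [] := f_rcons v a.
by rewrite sumr_const card_ord -mulrA mulr_natl.
Qed.

Lemma gibbs_rcons_low w a : decay * g w <= g (rcons w a).
Proof.
have /andP[+ _] := gf (rcons w a); apply: le_trans.
have /andP[_ gw] := gf w; have [fl _] := f_rcons w a.
rewrite size_rcons in gw *.
have zs := zeta_succ (size w).
have Z0 n := zeta_gt0 rf q n.
apply: (le_trans (ler_wpM2l (ltW decay_gt0) gw)).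
have A0 : expR (Q * d) != 0 by rewrite gt_eqF ?expR_gt0.
have K0 : expR (Q * kap) != 0 by rewrite gt_eqF ?expR_gt0.
rewrite expRN in fl; rewrite expRN.
set A := expR (Q * d) in A0 *; set K := expR (Q * kap) in K0 fl zs *.
have -> : decay = b%:R^-1 * (A^-1 * A^-1 * (K^-1 * K^-1)).
  by rewrite /decay -!expRN -!expRD; congr (_ * expR _); ring.
set F := f w `^ q in fl *; set F' := f _ `^ q in fl *.
have z0 : zeta f q (size w) != 0 by rewrite gt_eqF.
have -> : b%:R^-1 * (A^-1 * A^-1 * (K^-1 * K^-1)) * (A * (F / zeta f q (size w)))
   = A^-1 * (K^-1 * F * (b%:R * K * zeta f q (size w))^-1).
  by field; rewrite z0 K0 A0 andbT /= -natrD pnatr_eq0.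
rewrite ler_wpM2l ?invr_ge0 ?expR_ge0 // ler_pM ?mulr_ge0 ?invr_ge0 ?expR_ge0 ?powR_ge0 //.
  by rewrite !mulr_ge0 ?expR_ge0 // ltW.
by rewrite lef_pV2 ?posrE ?mulr_gt0 ?expR_gt0.
Qed.

(** There are at least two letters, and another one takes a share [decay]. *)
Lemma gibbs_rcons_up w a : g (rcons w a) <= (1 - decay) * g w.
Proof.
have [a' aa'] : exists a' : 'I_b, a' != a.
  have [->|a0] := eqVneq a ord0; last by exists ord0; rewrite eq_sym.
  by exists ord_max.
rewrite mulrBl mul1r lerBrDr {2}(gD w) (bigD1 a) //= (bigD1 a') //= lerD2l.
rewrite (le_trans (gibbs_rcons_low w a')) // lerDl sumr_ge0 // => i _.
exact: gibbs_ge0.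
Qed.

Lemma gibbs_cat_up w u : g (w ++ u) <= (1 - decay) ^+ size u * g w.
Proof.
elim/last_ind: u => [|u a IH]; first by rewrite cats0 expr0 mul1r.
rewrite -rcons_cat size_rcons exprS -mulrA (le_trans (gibbs_rcons_up _ _)) //.
by rewrite ler_wpM2l // subr_ge0 ltW // decay_lt1.
Qed.

(** The words carrying a digit block within [N] of the edge of its range are
    rare because each of the [2 N] possible blocks is exponentially light. *)
Lemma gibbs_near_edge N k l :
  \sum_(w : (k + l).-tuple 'I_b | near_edge N (drop k w)) g w <=
    N.*2%:R * (1 - decay) ^+ l.
Proof.
rewrite big_mkcond /=.
rewrite (@sum_tuple_cat _ _ k l (fun w => if near_edge N (drop k w) then g w else 0)).
have gsum : \sum_(v : k.-tuple 'I_b) g v = 1.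
  by rewrite -g1 -(additive_sum_tuple gD k [::]).
rewrite (@le_trans _ _ (N.*2%:R * (1 - decay) ^+ l * \sum_(v : k.-tuple 'I_b) g v)) //;
  last by rewrite gsum mulr1.
rewrite mulr_sumr; apply: ler_sum => v _.
under eq_bigr => u _ do rewrite drop_size_cat ?size_tuple //.
rewrite -big_mkcond /=.
rewrite (@le_trans _ _ (\sum_(u : l.-tuple 'I_b | near_edge N u)
  (1 - decay) ^+ l * g v)) //.
  by apply: ler_sum => u _; rewrite (le_trans (gibbs_cat_up _ _)) // size_tuple.
rewrite sumr_const -[leLHS]mulr_natl -mulrA ler_wpM2r ?ler_nat ?card_near_edge //.
by rewrite mulr_ge0 ?gibbs_ge0 // exprn_ge0 // subr_ge0 ltW // decay_lt1.
Qed.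

(** Exponential Chebyshev inequality: weighting the Gibbs mass by [f ^ s]
    replaces the temperature [q] by [q + s]. *)
Lemma gibbs_chebyshev n s x (B : {pred n.-tuple 'I_b}) :
  0 <= x -> (forall w, B w -> 1 <= f w `^ s * x) ->
  \sum_(w : n.-tuple 'I_b | B w) g w <=
    expR (Q * d) * (zeta f (q + s) n / zeta f q n) * x.
Proof.
move=> x0 Bx.
rewrite {1}/zeta mulr_suml mulr_sumr mulr_suml big_mkcond /=; apply: ler_sum => w _.
have f0 := rw_gt0 rf w.
have /andP[_] := gf w; rewrite size_tuple => gw.
have pos : 0 <= f w `^ (q + s) / zeta f q n.
  by rewrite divr_ge0 ?powR_ge0 // ltW // (zeta_gt0 rf).
case: ifPn => [/Bx Bw|_]; last by rewrite mulr_ge0 // mulr_ge0 ?expR_ge0.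
apply: (le_trans gw); rewrite -mulrA ler_wpM2l ?expR_ge0 //.
rewrite powRD; last by rewrite (gt_eqF f0) implybT.
have -> : f w `^ q * f w `^ s / zeta f q n * x =
  f w `^ q / zeta f q n * (f w `^ s * x) by ring.
by rewrite ler_peMr // divr_ge0 ?powR_ge0 // ltW // (zeta_gt0 rf).
Qed.

End gibbs_decay.

(** * From words to points *)

Section sing_set_mass.
Variables (R : realType) (m : nat).
Local Notation b := m.+2.
Local Notation word := (seq 'I_b).

Lemma measurable_trunc_set (G : word -> Prop) n :
  measurable [set t : symb m | G (trunc t n)].
Proof.
have mh := @measurable_trunc R m (fun w => (`[< G w >])%:R) n.
have -> : [set t : symb m | G (trunc t n)] =
    setT `&` (fun t => (`[< G (trunc t n) >])%:R : R) @^-1` [set 1].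
  rewrite setTI; apply/seteqP; split => t /=.
    by move=> Gt; rewrite asboolT.
  by case: asboolP => // _ /eqP; rewrite eq_sym oner_eq0.
exact: (mh measurableT _ (measurable_set1 1)).
Qed.

Lemma measurable_sing_set (nu : set (symb m) -> \bar R) beta N eps p :
  measurable (sing_set nu beta N eps p).
Proof.
have -> : sing_set nu beta N eps p = \bigcap_(n in [set n | (p <= n)%N])
    [set t | forall w : n.-tuple 'I_b, (delta w (trunc t n) <= N)%N ->
    ((b%:R `^ (- (n%:R * (beta + eps n))))%:E <= nu (cyl w)
      <= (b%:R `^ (- (n%:R * (beta - eps n))))%:E)%E].
  by apply/seteqP; split => t h n /= pn w; exact: h.
apply: bigcap_measurable => [|n _]; first by exists p => /=.
exact: (measurable_trunc_set (fun v => forall w : n.-tuple 'I_b,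
  (delta w v <= N)%N -> _)).
Qed.

Lemma measure_trunc_set (nu : {measure set (symb m) -> \bar R}) (bad : pred word) n :
  (nu [set t | bad (trunc t n)] <= \sum_(v : n.-tuple 'I_b | bad v) nu (cyl v))%E.
Proof.
have mS := measurable_trunc_set (fun w => bad w) n.
have := measure_cyl_cat (mrestr nu mS) n [::].
rewrite /= /mrestr cyl_nil setTI => ->.
rewrite [leRHS]big_mkcond /=; apply: lee_sum => v _.
case: ifPn => bv.
  apply: le_measure; rewrite ?inE //; last exact: measurable_cyl.
  by apply: measurableI => //; exact: measurable_cyl.
rewrite (_ : _ `&` _ = set0) ?measure0 //.
apply/seteqP; split => // t [/=]; rewrite /cyl /= size_tuple => ->.
by move: bv => /negP.
Qed.

(** The complement of the singularity set is covered by the cylinders of the bad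
    words of length at least [p]. One family of bad words serves two measures
    [nu] when the lemma is used twice. *)
Lemma sing_set_mass (nu : set (symb m) -> \bar R) (P : probability (symb m) R)
    beta N eps p (bad : pred word) (u : nat -> \bar R) :
  (forall n v w, (p <= n)%N -> size v = n -> size w = n -> ~~ bad v ->
     (delta w v <= N)%N ->
     ((b%:R `^ (- (n%:R * (beta + eps n))))%:E <= nu (cyl w)
      <= (b%:R `^ (- (n%:R * (beta - eps n))))%:E)%E) ->
  (forall n, (p <= n)%N ->
     (\sum_(v : n.-tuple 'I_b | bad v) P (cyl v) <= u n)%E) ->
  (\sum_(p <= n <oo) u n <= (2^-1)%:E)%E ->
  ((2^-1)%:E <= P (sing_set nu beta N eps p))%E.
Proof.
move=> good mass tail.
pose A n := [set t : symb m | bad (trunc t n)].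
have mA n : measurable (A n) by exact: (measurable_trunc_set (fun w => bad w)).
pose B := \bigcup_(n in [set n | (p <= n)%N]) A n.
have mB : measurable B by apply: bigcup_measurable => n _; exact: mA.
have PB : (P B <= (2^-1)%:E)%E.
  apply: le_trans tail.
  apply: (@le_trans _ _ (\sum_(p <= n <oo) P (A n))%E).
    apply: measure_sigma_subadditive_tail => // t [n /= pn At]; exists n => //=.
    by apply/negP; rewrite -leqNgt.
  rewrite eseries_cond [leRHS]eseries_cond.
  apply: lee_nneseries => [n _ _|n /= pn]; first exact: measure_ge0.
  rewrite (le_trans (measure_trunc_set _ _ _)) // mass //; exact: (andP pn).2.
have sub : ~` B `<=` sing_set nu beta N eps p.
  move=> t Bt n pn w dw; apply: (good n (trunc t n)) => //.
  - by rewrite size_mkseq.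
  - by rewrite size_tuple.
  - by apply/negP => bt; apply: Bt; exists n.
apply: (@le_trans _ _ (P (~` B))).
  rewrite probability_setC // (le_trans _ (leeB (lexx 1%E) PB)) //.
  by rewrite -EFinB lee_fin; lra.
apply: le_measure; rewrite ?inE //; first exact: measurableC.
exact: measurable_sing_set.
Qed.

End sing_set_mass.

(** * Atypical words at one level *)

Section one_level.
Variables (R : realType) (m : nat).
Local Notation b := m.+2.
Local Notation word := (seq 'I_b).
Local Notation L := (ln b%:R : R).
Variables (f g : word -> R) (kap d Q q beta : R).
Hypothesis rf : regular_weight kap d f.
Hypotheses (qQ : `|q| <= Q).
Hypothesis gf : forall w, expR (- (Q * d)) * (f w `^ q / zeta f q (size w)) <= g w
    <= expR (Q * d) * (f w `^ q / zeta f q (size w)).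

Lemma lnb_gt0 : 0 < L.
Proof. by rewrite ln_gt0 // ltr1n. Qed.

(** The logarithm of [h w / b^(- n * gam)] for a word [w] of length [n]. *)
Definition offset (h : word -> R) (gam : R) (w : word) : R :=
  ln (h w) + (size w)%:R * (L * gam).

Lemma offset_band (h : word -> R) gam e w : 0 < h w ->
  `|offset h gam w| <= (size w)%:R * (L * e) ->
  b%:R `^ (- ((size w)%:R * (gam + e))) <= h w
    <= b%:R `^ (- ((size w)%:R * (gam - e))).
Proof.
move=> h0; rewrite ler_norml /offset => /andP[lo hi].
have {1 2}<- : expR (ln (h w)) = h w by rewrite lnK // posrE.
by rewrite !powR_expR // !ler_expR; apply/andP; split; lra.
Qed.

(** A word can be bad for its own weight, or because a neighbour does not share
    all but its last [l] letters. *)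
Definition atypical (N l : nat) (c : R) (w : word) : bool :=
  (c < `|offset f beta w|) || near_edge N (drop (size w - l) w).

(** A neighbour of a word that is not atypical shares all but [l] letters with
    it, and each letter changes the weight by a factor at most [expR kap]. *)
Lemma offset_neighbour N l c v w : size w = size v -> (l <= size v)%N ->
  ~~ atypical N l c v -> (delta w v <= N)%N ->
  `|offset f beta w| <= c + kap * l%:R.
Proof.
move=> sw lv; rewrite negb_or -leNgt => /andP[cv ne] dN.
set k := (size v - l)%N in ne.
have sd u : size u = size v -> size (drop k u) = l.
  by move=> su; rewrite size_drop su /k subKn.
have E : take k w = take k v.
  apply: (@near_edgePn _ N _ _ (drop k v) (drop k w)) => //.
  - by rewrite !sd.
  - by rewrite !size_take sw.
  - by rewrite !cat_take_drop.
have near p u : size u = l ->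
    ln (f p) - kap * l%:R <= ln (f (p ++ u)) <= ln (f p).
  move=> su; have f0 := rw_gt0 rf; apply/andP; split; last first.
    by rewrite ler_ln ?posrE // (rw_cat_le rf).
  have := rw_cat_ge rf p u.
  rewrite su -ler_ln ?posrE ?mulr_gt0 ?expR_gt0 //.
  by rewrite lnM ?posrE ?expR_gt0 // expRK mulNr addrC.
have /andP[w1 w2] := near (take k w) _ (sd _ _ sw).
have /andP[v1 v2] := near (take k v) _ (sd _ _ erefl).
rewrite !cat_take_drop in w1 w2 v1 v2.
move: cv; rewrite E /offset sw in w1 w2 *; rewrite !ler_norml => /andP[c1 c2].
by apply/andP; split; lra.
Qed.

Lemma gibbs_gt0 w : 0 < g w.
Proof.
have /andP[+ _] := gf w; apply: lt_le_trans.
by rewrite mulr_gt0 ?expR_gt0 // divr_gt0 ?powR_gt0 ?(rw_gt0 rf) // (zeta_gt0 rf).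
Qed.

(** Gibbs weights are [f w `^ q / zeta f q n] up to a constant, so their local
    exponent is [q * beta - tau q] as soon as that of [f] is [beta]. *)
Lemma offset_gibbs tauq x w :
  `|ln (zeta f q (size w)) + (size w)%:R * (L * tauq)| <= x ->
  `|offset g (q * beta - tauq) w| <= Q * `|offset f beta w| + Q * d + x.
Proof.
move=> zx; have f0 := rw_gt0 rf w; have z0 := zeta_gt0 rf q (size w).
have /andP[lo hi] := gf w.
have p0 : 0 < f w `^ q / zeta f q (size w) by rewrite divr_gt0 ?powR_gt0.
have lnp : ln (f w `^ q / zeta f q (size w)) = q * ln (f w) - ln (zeta f q (size w)).
  by rewrite lnM ?posrE ?powR_gt0 ?invr_gt0 // lnV ?posrE // ln_powR.
have {}lo : - (Q * d) + (q * ln (f w) - ln (zeta f q (size w))) <= ln (g w).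
  rewrite -lnp -[X in X + _]expRK -lnM ?posrE ?expR_gt0 //.
  by rewrite ler_ln // posrE ?gibbs_gt0 // mulr_gt0 ?expR_gt0.
have {}hi : ln (g w) <= Q * d + (q * ln (f w) - ln (zeta f q (size w))).
  rewrite -lnp -[X in X + _]expRK -lnM ?posrE ?expR_gt0 //.
  by rewrite ler_ln // posrE ?gibbs_gt0 // mulr_gt0 ?expR_gt0.
set o := offset f beta w.
have qo : `|q * o| <= Q * `|o| by rewrite normrM ler_wpM2r.
have E : offset g (q * beta - tauq) w = q * o + (ln (g w) - (q * ln (f w) - ln (zeta f q (size w))))
   - (ln (zeta f q (size w)) + (size w)%:R * (L * tauq)).
  by rewrite /o /offset; ring.
rewrite E (le_trans (ler_normB _ _)) // lerD // (le_trans (ler_normD _ _)) // lerD //.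
by rewrite ler_norml; apply/andP; split; lra.
Qed.

(** By [gibbs_chebyshev] with [h = s] or [h = - s], the mass of the words with an
    offset beyond [n * (L * e)] is, up to constants, [b] to the power
    [n * (tau q + h * beta - tau (q + h) - s * e)], and the second order Taylor
    bound on [tau] makes this quadratic in [s]. *)
Lemma tail_mass (tau : R -> R) M2 e x n : 0 < e -> 0 < M2 ->
  let s := e / (2 * M2) in
  (forall q', `|q' - q| <= s ->
     `|ln (zeta f q' n) + n%:R * (L * tau q')| <= x) ->
  (forall h, `|h| <= s -> tau q + h * beta - M2 * h ^+ 2 <= tau (q + h)) ->
  \sum_(w : n.-tuple 'I_b | n%:R * (L * e) < `|offset f beta w|) g w <=
    2 * expR (Q * d + 2 * x - n%:R * (L * (e ^+ 2 / (4 * M2)))).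
Proof.
(* This [s] minimises [M2 * s ^+ 2 - s * e], with minimum [- e ^+ 2 / (4 * M2)]. *)
move=> e0 M0 s zx taylor.
have s0 : 0 < s by rewrite divr_gt0 // mulr_gt0.
have side h : `|h| = s ->
    \sum_(w : n.-tuple 'I_b | s * (n%:R * (L * e)) < h * offset f beta w) g w <=
    expR (Q * d + 2 * x - n%:R * (L * (e ^+ 2 / (4 * M2)))).
  move=> hs.
  pose X := expR (h * (n%:R * (L * beta)) - s * (n%:R * (L * e))).
  apply: (@le_trans _ _ (expR (Q * d) * (zeta f (q + h) n / zeta f q n) * X)).
    apply: (gibbs_chebyshev rf gf); first exact: expR_ge0.
    move=> w; rewrite /offset size_tuple powR_expR ?(rw_gt0 rf) // -expRD => hw.
    by rewrite -[leLHS]expR0 ler_expR; lra.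
  have z0 q' : 0 < zeta f q' n by exact: (zeta_gt0 rf).
  have zE q' : zeta f q' n = expR (ln (zeta f q' n)) by rewrite lnK // posrE.
  rewrite (zE (q + h)) (zE q) -expRN -!expRD ler_expR.
  have := zx (q + h); rewrite [q + h - q]addrC addKr hs => /(_ (lexx _)).
  have := zx q; rewrite subrr normr0 => /(_ (ltW s0)).
  rewrite !ler_norml => /andP[z1 z2] /andP[z3 z4].
  have := taylor h; rewrite hs => /(_ (lexx _)) th.
  have h2 : h ^+ 2 = s ^+ 2 by rewrite -(real_normK (num_real h)) hs.
  have nL : 0 <= n%:R * L by rewrite mulr_ge0 // ltW // lnb_gt0.
  have := ler_wpM2l nL th; rewrite h2.
  have -> : e ^+ 2 / (4 * M2) = s * e - M2 * s ^+ 2.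
    by rewrite /s; field; rewrite gt_eqF.
  clear -z1 z2 z3 z4.
  lra.
rewrite [leRHS](_ : _ = expR (Q * d + 2 * x - n%:R * (L * (e ^+ 2 / (4 * M2))))
  + expR (Q * d + 2 * x - n%:R * (L * (e ^+ 2 / (4 * M2))))); last by ring.
have s1 : `|s| = s by rewrite gtr0_norm.
have s2 : `|- s| = s by rewrite normrN.
apply: le_trans (lerD (side s s1) (side (- s) s2)).
rewrite [leLHS]big_mkcond [X in _ <= X + _]big_mkcond [X in _ <= _ + X]big_mkcond.
rewrite -big_split /=; apply: ler_sum => w _.
have g0 := ltW (gibbs_gt0 w).
rewrite ltr_pM2l // mulNr -mulrN ltr_pM2l //.
case: ifPn => [|_]; last by rewrite addr_ge0 //; case: ifP.
by rewrite lter_normr => /orP[] ->; rewrite ?lerDl ?lerDr //; case: ifP.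
Qed.

End one_level.

(** * Series, growth of powers and second order Taylor bound *)

Section real_analysis.
Variable R : realType.
Implicit Types (f : R -> R) (u : nat -> R).

Lemma near_powR_ge (a A : R) : 0 < a -> \forall n \near \oo, A <= n%:R `^ a.
Proof.
move=> a0; pose A1 := Num.max A 0.
have A10 : 0 <= A1 by rewrite le_max lexx orbT.
near=> n; apply: (@le_trans _ _ A1); first by rewrite le_max lexx.
have -> : A1 = (A1 `^ a^-1) `^ a.
  by rewrite -powRrM mulVf ?lt0r_neq0 // powRr1.
rewrite ge0_ler_powR ?nnegrE //.
- exact: ltW.
- exact: powR_ge0.
- by near: n; exact: nbhs_infty_ger.
Unshelve. all: by end_near. Qed.

Lemma ln_le_powR (a x : R) : 0 < x -> a * ln x <= x `^ a.
Proof.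
by move=> x0; rewrite -ln_powR ltW // ln_sublinear // powR_gt0.
Qed.

Lemma eseries_lt_pinfty u : (forall k, 0 <= u k) -> cvgn (series u) ->
  (\sum_(k <oo) (u k)%:E < +oo)%E.
Proof.
move=> u0 cu; apply: (@le_lt_trans _ _ (limn (series u))%:E); last exact: ltry.
apply: lime_le.
  by apply: is_cvg_nneseries => k _ _; rewrite lee_fin.
apply: nearW => n; rewrite sumEFin lee_fin.
apply: nondecreasing_cvgn_le => //.
by apply: nondecreasing_series => k _ _; exact: u0.
Qed.

Lemma eseries_tail u (e : R) : 0 < e -> (forall k, 0 <= u k) ->
  (\sum_(k <oo) (u k)%:E < +oo)%E ->
  \forall p \near \oo, (\sum_(p <= k <oo) (u k)%:E <= e%:E)%E.
Proof.
move=> e0 u0 fin.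
have := nneseries_tail_cvg fin (fun k _ => u0 k).
move=> /(_ [set x | (x < e%:E)%E]) H.
have /H : nbhs 0%E [set x : \bar R | (x < e%:E)%E].
  apply: open_nbhs_nbhs; split; first exact: open_ereal_lt_ereal.
  by rewrite /= lte_fin.
by move=> [n0 _ hn]; exists n0 => // p /hn /ltW.
Qed.

Lemma eseries_recl_lt_pinfty u : (forall k, 0 <= u k) ->
  (\sum_(k <oo) (u k.+1)%:E < +oo)%E -> (\sum_(k <oo) (u k)%:E < +oo)%E.
Proof.
move=> u0 fin; rewrite nneseries_recl //; last by move=> k _; rewrite lee_fin.
rewrite -(@nneseries_addn R (fun k => (u k)%:E) 1%N); last by move=> k; rewrite lee_fin.
by under eq_eseriesr => k _ do rewrite addn1; rewrite lte_add_pinfty // ltry.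
Qed.

Lemma continuous_ball_bounded f (c r : R) : continuous f ->
  exists M : R, 0 < M /\ forall z, `|z - c| <= r -> `|f z| <= M.
Proof.
move=> cf; have [r0|r0] := ltP r 0.
  exists 1; split => // z; rewrite leNgt => /negP[].
  exact: (lt_le_trans r0).
have ab : c - r <= c + r by lra.
have cnf : {within `[c - r, c + r], continuous (fun z => `|f z|)}.
  apply: continuous_subspaceT => z; apply: (@continuous_comp _ _ _ f (fun y : R => `|y|)).
    exact: cf.
  exact: norm_continuous.
have [x _ fx] := EVT_max ab cnf.
exists (`|f x| + 1); split => [|z zr]; first by rewrite ltr_wpDl.
rewrite (le_trans (fx z _)) ?lerDl //.
by move: zr; rewrite in_itv /= ler_norml => /andP[? ?]; apply/andP; split; lra.
Qed.

Lemma derive_ball_lipschitz f (c r M x y : R) : (forall z, derivable f z 1) ->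
  (forall z, `|z - c| <= r -> `|derive1 f z| <= M) ->
  `|x - c| <= r -> `|y - c| <= r -> `|f x - f y| <= M * `|x - y|.
Proof.
move=> df fM; wlog xy : x y / y <= x.
  move=> H xr yr; have [yx|/ltW xy] := leP y x; first exact: H.
  by rewrite distrC [`|x - y|]distrC H.
move=> xr yr.
have isd (z : R) : is_derive z (1 : R) f (derive1 f z).
  by rewrite derive1E; apply/derivableP.
have cf : {within `[y, x], continuous f}.
  apply: continuous_subspaceT => z; apply: differentiable_continuous.
  exact/derivable1_diffP.
have [z zyx ->] := MVT_segment xy (fun z _ => isd z) cf.
rewrite normrM ler_wpM2r // fM //.
move: zyx xr yr; rewrite in_itv /= !ler_norml => /andP[? ?] /andP[? ?] /andP[? ?].
by apply/andP; split; lra.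
Qed.

(** The mean value inequality is applied to [tau] minus its tangent at [q], whose
    derivative is in turn [O(h)] by the same inequality for [derive1 tau]. *)
Lemma taylor2_lower (tau : R -> R) (Q : R) : twice_continuously_differentiable tau ->
  exists M : R, 0 < M /\ forall q h, `|q| <= Q -> `|h| <= 1 ->
    tau q + h * derive1 tau q - M * h ^+ 2 <= tau (q + h).
Proof.
move=> [d1 d2 c2].
have [M [M0 HM]] := continuous_ball_bounded 0 (Q + 1) c2.
exists M; split => // q h qQ h1.
pose g : R -> R := tau - derive1 tau q *: (id : R -> R).
have gE z : g z = tau z - derive1 tau q * z by [].
have isg (z : R) : is_derive z (1 : R) g (derive1 tau z - derive1 tau q *: 1).
  apply: is_deriveB.
  by rewrite derive1E; apply/derivableP.
have dg (z : R) : derivable g z 1 by have [] := isg z.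
have g'E z : derive1 g z = derive1 tau z - derive1 tau q.
  by rewrite derive1E; have [_ ->] := isg z; rewrite /GRing.scale /= mulr1.
have sub z : `|z - q| <= `|h| -> `|z - 0| <= Q + 1.
  move=> zq; rewrite subr0 -(subrK q z) addrC (le_trans (ler_normD _ _)) // lerD //.
  exact: le_trans h1.
have g'M z : `|z - q| <= `|h| -> `|derive1 g z| <= M * `|h|.
  move=> zq; rewrite g'E.
  have := derive_ball_lipschitz (x := z) (y := q) d2 HM (sub _ zq).
  rewrite subr0 => /(_ _); rewrite (le_trans qQ) ?lerDl // => /(_ isT) H.
  by rewrite (le_trans H) // ler_wpM2l // ltW.
have := derive_ball_lipschitz (x := q + h) (y := q) dg g'M.
rewrite subrr normr0 [q + h - q]addrC addKr => /(_ (lexx _) (normr_ge0 _)).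
rewrite -mulrA -normrM ger0_norm -?expr2 ?sqr_ge0 // ler_norml !gE => /andP[lo _].
lra.
Qed.

End real_analysis.

(** * Growth speed for one sample *)

Section deterministic.
Variables (R : realType) (m : nat).
Local Notation b := m.+2.
Local Notation word := (seq 'I_b).
Local Notation L := (ln b%:R : R).

Let L0 : 0 < L. Proof. exact: lnb_gt0. Qed.

Lemma weightE_of_regular (nu : {measure set (symb m) -> \bar R}) kap d w :
  regular_weight kap d (weight nu) -> nu (cyl w) = (weight nu w)%:E.
Proof.
move=> rf; rewrite /weight fineK // ge0_fin_numE //.
apply: (@le_lt_trans _ _ (nu (cyl [::]))).
  by apply: le_measure; rewrite ?inE ?cyl_nil //; exact: measurable_cyl.
have := rw_nil rf; rewrite /weight; case: (nu _) => [r _| /= /eqP|]; first exact: ltry.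
  by rewrite eq_sym oner_eq0.
by [].
Qed.

Lemma near_edge_mass (g : word -> R) (f : word -> R) kap d Q q N n l :
  0 <= kap -> 0 <= d -> regular_weight kap d f -> `|q| <= Q ->
  g [::] = 1 -> (forall w, g w = \sum_a g (rcons w a)) ->
  (forall w, expR (- (Q * d)) * (f w `^ q / zeta f q (size w)) <= g w
    <= expR (Q * d) * (f w `^ q / zeta f q (size w))) ->
  (l <= n)%N ->
  \sum_(w : n.-tuple 'I_b | near_edge N (drop (n - l) w)) g w <=
    N.*2%:R * (1 - decay m kap d Q) ^+ l.
Proof.
move=> kap0 d0 rf qQ g1 gD gf /subnK; move: (n - l)%N => k <-.
exact: (gibbs_near_edge kap0 d0 rf qQ).
Qed.

Section growth.
Variables (tau : R -> R) (N : nat) (eps : nat -> R) (eta Q kap d M0 : R).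
Hypotheses (htau2 : twice_continuously_differentiable tau) (heta : 0 < eta).
Hypotheses (eps_gt0 : forall n, (1 <= n)%N -> 0 < eps n)
  (eps_cvg : eps n @[n --> \oo] --> 0).
Hypothesis eps_series : forall M a : R, 0 < M -> 0 < a ->
  cvgn (series (fun k : nat => let n := k.+1 in
    m.+2%:R `^ (M * n%:R `^ (3 / 4) * ln n%:R)
    * m.+2%:R `^ (- (n%:R * a * eps n ^+ 2)))).
Hypothesis eps_ge : forall n, (1 <= n)%N ->
  n%:R `^ (- (1 / 8)) * ln n%:R `^ (1 / 2 + eta) <= eps n.
Hypotheses (kap0 : 0 < kap) (d0 : 0 <= d) (Q0 : 0 <= Q) (M00 : 0 <= M0).

(** The error allowed in [ln (zeta f q n) = - n * tau q * ln b]. *)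
Definition fluct (n : nat) : R := n%:R `^ (3 / 4) * ln n%:R.

Lemma fluct_ge0 n : 0 <= fluct n.
Proof.
rewrite mulr_ge0 ?powR_ge0 //; case: n => [|n]; first by rewrite ln0.
by rewrite ln_ge0 // ler1n.
Qed.

Lemma near_ln_ge1 : \forall n \near \oo, 1 <= ln n%:R :> R.
Proof.
near=> n.
rewrite -[leLHS]expRK ler_ln ?posrE ?expR_gt0 //.
  by near: n; exact: nbhs_infty_ger.
by rewrite ltr0n; near: n; exact: nbhs_infty_gt.
Unshelve. all: by end_near. Qed.

(** Since [ln n] is below [16 * n^(1/16)], the fluctuation [n^(3/4) * ln n] is
    at most of order [n^(13/16)], while [n * eps n] is at least [n^(14/16)]. *)
Lemma near_fluct_le (A B c : R) : 0 <= A -> 0 <= B -> 0 < c ->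
  \forall n \near \oo, A + B * fluct n <= c * (n%:R * eps n).
Proof.
move=> A0 B0 c0; near=> n.
have n1 : (1 <= n)%N by near: n; exact: nbhs_infty_gt.
have nR : 0 < n%:R :> R by rewrite ltr0n.
have ln1 : 1 <= ln n%:R :> R by near: n; exact: near_ln_ge1.
pose y : R := n%:R `^ 16^-1.
have y1 : 1 <= y.
  by rewrite /y; near: n; apply: near_powR_ge; rewrite invr_gt0.
have yA : (A + B * 16) / c <= y.
  by rewrite /y; near: n; apply: near_powR_ge; rewrite invr_gt0.
have yk (k : nat) : n%:R `^ (k%:R / 16) = y ^+ k.
  by rewrite mulrC powRrM powR_mulrn ?powR_ge0.
have E1 : n%:R `^ (3 / 4) = y ^+ 12.
  by rewrite -yk; congr (_ `^ _); lra.
have E2 : n%:R * n%:R `^ (- (1 / 8)) = y ^+ 14.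
  rewrite -yk -{1}[n%:R]powRr1 ?ltW // -powRD; first by congr (_ `^ _); lra.
  by rewrite (gt_eqF nR) implybT.
have lny : ln n%:R <= 16 * y.
  have := ln_le_powR (16^-1) nR; rewrite -/y => h.
  by rewrite -ler_pdivrMl // mulrC mulrC.
have le1 : n%:R `^ (- (1 / 8)) <= eps n.
  apply: le_trans (eps_ge n1); rewrite ler_peMr ?powR_ge0 //.
  have e0 : 0 <= 1 / 2 + eta by rewrite addr_ge0 // ltW.
  have := ge0_ler_powR e0 (ler01 : 1 \is Num.nneg) _ ln1.
  by rewrite powR1 nnegrE (le_trans ler01 ln1) => /(_ isT).
apply: (@le_trans _ _ (c * y ^+ 14)); last first.
  by rewrite -E2 ler_pM2l // ler_pM2l.
rewrite /fluct E1.
apply: (@le_trans _ _ ((A + B * 16) * y ^+ 13)).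
  rewrite mulrDl lerD //.
    by rewrite ler_peMr // exprn_ege1.
  rewrite -mulrA ler_wpM2l // [y ^+ 13]exprS mulrA mulrC ler_wpM2r ?exprn_ge0 //.
  by rewrite (le_trans _ y1).
rewrite [y ^+ 14]exprS mulrA ler_wpM2r ?exprn_ge0 ?(le_trans _ y1) //.
by rewrite -ler_pdivrMl // mulrC.
Unshelve. all: by end_near. Qed.

Let c0 : R := (4 * (Q + 1))^-1.
Let c00 : 0 < c0.
Proof. by rewrite invr_gt0 mulr_gt0 // ltr_wpDl. Qed.

Let c0Q : 4 * (Q * c0) <= 1.
Proof.
rewrite /c0 mulrA ler_pdivrMr ?mul1r ?ler_wpM2l ?lerDl //.
by rewrite mulr_gt0 // ltr_wpDl.
Qed.

Let c01 : 4 * c0 <= 1.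
Proof.
rewrite /c0 ler_pdivrMr ?mul1r; first by rewrite ler_peMr // lerDr.
by rewrite mulr_gt0 // ltr_wpDl.
Qed.

Definition series_term (M a : R) (n : nat) : R :=
  b%:R `^ (M * n%:R `^ (3 / 4) * ln n%:R) * b%:R `^ (- (n%:R * a * eps n ^+ 2)).

Lemma series_termE M a n :
  series_term M a n = expR (L * (M * fluct n) - L * (n%:R * a * eps n ^+ 2)).
Proof.
have bE x : b%:R `^ x = expR (x * L) by rewrite powR_expR.
by rewrite /series_term !bE -expRD /fluct; congr expR; ring.
Qed.

Lemma near_series_term_tail C M a : 0 <= C -> 0 < M -> 0 < a ->
  \forall p \near \oo,
    (\sum_(p <= n <oo) (C * series_term M a n)%:E <= (2^-1)%:E)%E.
Proof.
move=> C0 M_0 a0.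
have u0 n : 0 <= C * series_term M a n.
  by rewrite mulr_ge0 // mulr_ge0 ?powR_ge0.
apply: eseries_tail => //; apply: eseries_recl_lt_pinfty => //.
apply: (@eseries_lt_pinfty _ (fun n => C * series_term M a n.+1)) => //.
exact: (is_cvg_seriesZ (k := C) (eps_series M_0 a0)).
Qed.

(** At level [n] the band of width [c0 * eps n] is demanded of the word itself,
    and [l n] is chosen so that the last [l n] letters cost no more. The mass of
    the atypical words is then a multiple of the general term of [eps_series]:
    through [eps n ^+ 2] for the tilted sums, and through
    [eps n >= eps n ^+ 2] for the digit blocks near an edge. The constant
    [c0 = 1 / (4 * (Q + 1))] leaves room for the multiplication by [q] in the
    exponent of the Gibbs weight. *)
Theorem deterministic_growth : \forall p \near \oo,
  forall nu : {measure set (symb m) -> \bar R}, regular_weight kap d (weight nu) ->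
  (forall n q, (p <= n)%N -> `|q| <= Q + 1 ->
    `|ln (zeta (weight nu) q n) + n%:R * (L * tau q)| <= M0 * fluct n) ->
  forall q, `|q| <= Q -> forall nuq, gibbs_weak_limit nu q nuq ->
    ((2^-1)%:E <= nuq (sing_set nu (derive1 tau q) N eps p))%E /\
    ((2^-1)%:E <= nuq (sing_set nuq (derive1 tau q * q - tau q) N eps p))%E.
Proof.
have [M2 [M20 taylor]] := taylor2_lower Q htau2.
pose rr := 1 - decay m kap d Q.
have rr1 : rr < 1 by rewrite ltrBlDr ltrDl decay_gt0.
have rr0 : 0 < rr.
  rewrite subr_gt0; apply: (@decay_lt1 _ _ kap d Q Q) => //; first exact: ltW.
  by rewrite ger0_norm.
have lnrr : ln rr < 0 by rewrite ln_lt0 // rr0.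
(* [rr ^+ l n] is about [expR (- (n * eps n * a2))]. *)
pose a2 := - ln rr * c0 * L / kap.
have a20 : 0 < a2 by rewrite divr_gt0 // mulr_gt0 // mulr_gt0 // oppr_gt0.
pose a := Num.min (c0 ^+ 2 / (4 * M2)) (a2 / L).
have a0 : 0 < a.
  rewrite lt_min; apply/andP; split; apply: divr_gt0 => //; first exact: exprn_gt0.
  exact: mulr_gt0.
pose M := 2 * M0 / L + 1.
have M_0 : 0 < M by rewrite ltr_wpDl // divr_ge0 ?mulr_ge0 // ltW.
pose C1 := N.*2%:R / rr + 2 * expR (Q * d).
have C10 : 0 <= C1.
  by apply: addr_ge0; [rewrite divr_ge0 // ltW|rewrite mulr_ge0 ?expR_ge0].
pose e n := c0 * eps n.
pose l n := Num.truncn (n%:R * (L * e n) / kap).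
have : \forall n \near \oo, [/\ (1 <= n)%N, eps n <= 1, L * e n <= kap,
    e n / (2 * M2) <= 1 & Q * d + M0 * fluct n <= L / 2 * (n%:R * eps n)].
  have eps_le c : 0 < c -> \forall n \near \oo, eps n <= c.
    by move: eps_cvg => /cvgr_le; apply.
  near=> n; split.
  - by near: n; exact: nbhs_infty_gt.
  - by near: n; apply: eps_le.
  - rewrite /e mulrA -ler_pdivlMl ?mulr_gt0 //.
    near: n; apply: eps_le; apply: mulr_gt0 => //.
    by rewrite invr_gt0 mulr_gt0.
  - rewrite ler_pdivrMr ?mulr_gt0 // mul1r /e -ler_pdivlMl //.
    near: n; apply: eps_le; apply: mulr_gt0; first by rewrite invr_gt0.
    exact: mulr_gt0.
  - by near: n; apply: near_fluct_le => //; [exact: mulr_ge0|exact: divr_gt0].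
move=> [n0 _ cond].
near=> p => nu rf fl q qQ nuq lim.
have cond_p n : (p <= n)%N -> [/\ (1 <= n)%N, eps n <= 1, L * e n <= kap,
    e n / (2 * M2) <= 1 & Q * d + M0 * fluct n <= L / 2 * (n%:R * eps n)].
  move=> pn; apply: cond; apply: leq_trans pn.
  by near: p; exact: nbhs_infty_ge.
have tail : (\sum_(p <= n <oo) (C1 * series_term M a n)%:E <= (2^-1)%:E)%E.
  by near: p; exact: near_series_term_tail.
set f := weight nu in rf fl *; set g := weight nuq.
set beta := derive1 tau q.
have gf := gibbs_limit_bounds lim d0 rf qQ.
have g1 : g [::] = 1 by rewrite /g /weight cyl_nil probability_setT.
have gD w : g w = \sum_a g (rcons w a).
  apply: EFin_inj; rewrite -sumEFin -(weightE nuq) (measure_cyl_rcons nuq).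
  by apply: eq_bigr => i _; exact: (weightE nuq).
have e_gt0 n : (1 <= n)%N -> 0 < e n by move=> n1; rewrite mulr_gt0 ?eps_gt0.
have lP n : (1 <= n)%N -> kap * (l n)%:R <= n%:R * (L * e n).
  move=> n1; rewrite mulrC -ler_pdivlMr // truncn_le.
  apply: divr_ge0; last exact: ltW.
  by rewrite mulr_ge0 // ltW // mulr_gt0 // e_gt0.
have l_le n : (p <= n)%N -> (l n <= n)%N.
  move=> /cond_p[n1 _ eL _ _]; rewrite -(ler_nat R).
  rewrite -(ler_pM2l kap0) (le_trans (lP n n1)) // mulrC.
  by rewrite ler_wpM2r.
pose bad (v : word) := atypical f beta N (l (size v)) ((size v)%:R * (L * e (size v))) v.
have good n v w : (p <= n)%N -> size v = n -> size w = n -> ~~ bad v ->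
    (delta w v <= N)%N -> `|offset f beta w| <= 2 * (n%:R * (L * e n)).
  move=> pn sv sw bv dN; have [n1 _ _ _ _] := cond_p n pn.
  have lv : (l (size v) <= size v)%N by rewrite sv l_le.
  have h := offset_neighbour rf (etrans sw (esym sv)) lv bv dN.
  rewrite (le_trans h) // sv; have := lP n n1; lra.
have mass n : (p <= n)%N ->
    (\sum_(v : n.-tuple 'I_b | bad v) nuq (cyl v) <= (C1 * series_term M a n)%:E)%E.
  move=> pn; have [n1 eps1 eL sM fll] := cond_p n pn.
  have nR : 0 < n%:R :> R by rewrite ltr0n.
  have epsn := eps_gt0 n1.
  rewrite (eq_bigr (fun v : n.-tuple 'I_b => (g v)%:E)); last first.
    by move=> v _; rewrite -(weightE nuq).
  rewrite sumEFin lee_fin.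
  apply: (@le_trans _ _ (\sum_(w : n.-tuple 'I_b | near_edge N (drop (n - l n) w)) g w
     + \sum_(w : n.-tuple 'I_b | n%:R * (L * e n) < `|offset f beta w|) g w)).
    rewrite big_mkcond [X in _ <= X + _]big_mkcond [X in _ <= _ + X]big_mkcond.
    rewrite -big_split /=; apply: ler_sum => w _.
    rewrite /bad /atypical size_tuple.
    have gw : 0 <= g w by exact: (gibbs_ge0 rf gf).
    by case: ltP => _; case: near_edge; rewrite /= ?addr0 ?add0r // lerDr.
  rewrite /C1 mulrDl; apply: lerD.
    apply: (le_trans (near_edge_mass N (ltW kap0) d0 rf qQ g1 gD gf (l_le n pn))).
    rewrite -mulrA ler_wpM2l // -/rr ler_pdivlMl //.
    rewrite -exprS -[rr in leLHS](lnK (_ : rr \is Num.pos)) ?posrE //.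
    rewrite -expRM_natl series_termE ler_expR.
    have l1 : n%:R * (L * e n) / kap <= (l n).+1%:R by exact/ltW/truncnS_gt.
    have lrr : (l n).+1%:R * ln rr <= n%:R * (L * e n) / kap * ln rr.
      by rewrite ler_wnM2r // ltW.
    apply: (le_trans lrr).
    have -> : n%:R * (L * e n) / kap * ln rr = - (n%:R * eps n * a2).
      by rewrite /e /a2; ring.
    have h1 : L * (n%:R * a * eps n ^+ 2) <= n%:R * eps n * a2.
      have aL : L * a <= a2.
        rewrite -ler_pdivlMl // mulrC.
        by rewrite ge_min lexx orbT.
      have -> : L * (n%:R * a * eps n ^+ 2) = n%:R * eps n * ((L * a) * eps n) by ring.
      rewrite ler_pM2l ?mulr_gt0 // (le_trans _ aL) // ler_piMr // mulr_ge0 // ltW //.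
    have h2 : 0 <= L * (M * fluct n).
      by apply: mulr_ge0; [exact: ltW|apply: mulr_ge0; [exact: ltW|exact: fluct_ge0]].
    lra.
  apply: (le_trans (tail_mass rf gf (tau := tau) (M2 := M2) (x := M0 * fluct n)
    (e_gt0 n n1) M20 _ _)).
  - move=> q' q's; apply: fl => //.
    rewrite -(subrK q q') addrC (le_trans (ler_normD _ _)) // lerD //.
    exact: le_trans sM.
  - by move=> h hs; apply: taylor => //; exact: le_trans sM.
  rewrite -[leRHS]mulrA ler_wpM2l // series_termE -expRD ler_expR -addrA lerD2l.
  have aM : a <= c0 ^+ 2 / (4 * M2) by rewrite ge_min lexx.
  have h1 : L * (n%:R * a * eps n ^+ 2) <= n%:R * (L * (e n ^+ 2 / (4 * M2))).
    have -> : n%:R * (L * (e n ^+ 2 / (4 * M2))) =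
       n%:R * L * eps n ^+ 2 * (c0 ^+ 2 / (4 * M2)) by rewrite /e; ring.
    have -> : L * (n%:R * a * eps n ^+ 2) = n%:R * L * eps n ^+ 2 * a by ring.
    by rewrite ler_wpM2l // mulr_ge0 ?sqr_ge0 // mulr_ge0 // ltW.
  have h2 : L * (M * fluct n) = 2 * (M0 * fluct n) + L * fluct n.
    by rewrite /M; field; rewrite gt_eqF.
  have h3 : 0 <= L * fluct n by apply: mulr_ge0; [exact: ltW|exact: fluct_ge0].
  lra.
split.
  apply: (sing_set_mass (bad := bad) _ mass tail) => n v w pn sv sw bv dN.
  have [n1 _ _ _ _] := cond_p n pn.
  rewrite (weightE_of_regular w rf) !lee_fin -sw.
  apply: offset_band; first exact: (rw_gt0 rf).
  rewrite (le_trans (good n v w pn sv sw bv dN)) // sw /e.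
  have -> : 2 * (n%:R * (L * (c0 * eps n))) = 2 * c0 * (n%:R * (L * eps n)) by ring.
  rewrite ler_piMl ?mulr_ge0 ?(ltW L0) ?(ltW (eps_gt0 n1)) //.
  by move: c01 c00; lra.
apply: (sing_set_mass (bad := bad) _ mass tail) => n v w pn sv sw bv dN.
have [n1 _ _ _ fll] := cond_p n pn.
rewrite weightE !lee_fin -sw.
apply: offset_band; first exact: (gibbs_gt0 rf gf).
have zq : `|ln (zeta f q (size w)) + (size w)%:R * (L * tau q)| <= M0 * fluct n.
  by rewrite sw; apply: fl => //; rewrite (le_trans qQ) // lerDl.
rewrite [derive1 tau q * q]mulrC.
rewrite (le_trans (offset_gibbs beta rf qQ gf zq)) //.
have h := ler_wpM2l Q0 (good n v w pn sv sw bv dN).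
have nLe : 0 <= n%:R * (L * eps n).
  by rewrite !mulr_ge0 ?(ltW L0) ?(ltW (eps_gt0 n1)).
have h2 : Q * (2 * (n%:R * (L * e n))) <= 2^-1 * (n%:R * (L * eps n)).
  have -> : Q * (2 * (n%:R * (L * e n))) = 2 * (Q * c0) * (n%:R * (L * eps n)).
    by rewrite /e; ring.
  by rewrite ler_wpM2r //; move: c0Q; lra.
rewrite sw; move: h h2 fll; lra.
Unshelve. all: by end_near. Qed.

End growth.
End deterministic.

(** * Bounded random variables *)

Section bounded_random_variables.
Context {d : measure_display} {Omega : measurableType d} {R : realType}.
Variable P : probability Omega R.
Implicit Types f g X Y U V : Omega -> R.

Definition bounded_rv f := measurable_fun setT f /\ exists M, forall w, `|f w| <= M.

Definition mean f : R := \int[P]_w f w.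

Lemma bounded_rv_integrable f : bounded_rv f -> P.-integrable setT (EFin \o f).
Proof.
move=> [mf [M fM]]; apply: measurable_bounded_integrable => //.
  by rewrite ltey_eq fin_num_measure.
exists M; split; first exact: num_real.
by move=> x Mx w _ /=; rewrite (le_trans (fM w)) // ltW.
Qed.

Lemma bounded_rv_cst c : bounded_rv (cst c).
Proof. by split => //; exists `|c|. Qed.

Lemma bounded_rvD f g : bounded_rv f -> bounded_rv g -> bounded_rv (fun w => f w + g w).
Proof.
move=> [mf [M fM]] [mg [K gK]]; split; first exact: measurable_funD.
by exists (M + K) => w; rewrite (le_trans (ler_normD _ _)) // lerD.
Qed.

Lemma bounded_rvM f g : bounded_rv f -> bounded_rv g -> bounded_rv (fun w => f w * g w).
Proof.
move=> [mf [M fM]] [mg [K gK]]; split; first exact: measurable_funM.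
by exists (M * K) => w; rewrite normrM ler_pM.
Qed.

Lemma bounded_rvZ c f : bounded_rv f -> bounded_rv (fun w => c * f w).
Proof. exact: (bounded_rvM (bounded_rv_cst c)). Qed.

Lemma bounded_rv_expR f : bounded_rv f -> bounded_rv (fun w => expR (f w)).
Proof.
move=> [mf [M fM]]; split; first exact: measurableT_comp.
exists (expR M) => w; rewrite ger0_norm ?expR_ge0 // ler_expR.
by rewrite (le_trans (ler_norm _)).
Qed.

Lemma meanD f g : bounded_rv f -> bounded_rv g ->
  mean (fun w => f w + g w) = mean f + mean g.
Proof. by move=> bf bg; apply: RintegralD => //; exact: bounded_rv_integrable. Qed.

Lemma meanZ c f : bounded_rv f -> mean (fun w => c * f w) = c * mean f.
Proof. by move=> bf; apply: RintegralZl => //; exact: bounded_rv_integrable. Qed.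

Lemma mean_cst c : mean (cst c) = c.
Proof.
transitivity (c * fine (P setT)); first exact: Rintegral_cst.
by rewrite probability_setT mulr1.
Qed.

Lemma mean_le_ae f g : bounded_rv f -> bounded_rv g ->
  {ae P, forall w, f w <= g w} -> mean f <= mean g.
Proof.
move=> bf bg fg.
have bfg : bounded_rv (fun w => Num.min (f w) (g w)).
  have [mf [M fM]] := bf; have [mg [K gK]] := bg; split.
    exact: measurable_minr.
  exists (Num.max M K) => w; rewrite le_max.
  by rewrite minEle; case: ifP => _; rewrite ?fM ?gK ?orbT.
have -> : mean f = mean (fun w => Num.min (f w) (g w)).
  rewrite /mean /Rintegral; congr fine; apply: ae_eq_integral => //.
  - by apply/measurable_EFinP; exact: bf.1.
  - by apply/measurable_EFinP; exact: bfg.1.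
  - by move: fg; apply: filterS => w fgw _; rewrite min_l.
apply: le_Rintegral => //; try exact: bounded_rv_integrable.
by move=> w _; rewrite ge_min lexx orbT.
Qed.

Lemma mean_le f g : bounded_rv f -> bounded_rv g ->
  (forall w, f w <= g w) -> mean f <= mean g.
Proof. by move=> bf bg fg; apply: mean_le_ae => //; exact: aeW. Qed.

Lemma mean_ge0 f : (forall w, 0 <= f w) -> 0 <= mean f.
Proof. by move=> f0; apply: Rintegral_ge0 => w _; exact: f0. Qed.

Definition same_dist U V := forall A : set R, measurable A ->
  P (U @^-1` A) = P (V @^-1` A).

Definition indep U V := forall A B : set R, measurable A -> measurable B ->
  P (U @^-1` A `&` V @^-1` B) = (P (U @^-1` A) * P (V @^-1` B))%E.

Lemma same_dist_mean U V (h : R -> R) : measurable_fun setT U ->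
  measurable_fun setT V -> measurable_fun setT h -> same_dist U V ->
  bounded_rv (h \o U) -> bounded_rv (h \o V) -> mean (h \o U) = mean (h \o V).
Proof.
move=> mU mV mh UV bU bV; rewrite /mean /Rintegral; congr fine.
have mhE : measurable_fun setT (EFin \o h) by exact/measurable_EFinP.
have iU := bounded_rv_integrable bU; have iV := bounded_rv_integrable bV.
rewrite -(@integral_pushforward _ _ _ _ _ _ mU P setT (EFin \o h) mhE iU) //.
rewrite -(@integral_pushforward _ _ _ _ _ _ mV P setT (EFin \o h) mhE iV) //.
apply: eq_measure_integral => A mA _; exact: UV.
Qed.

(** Independence identifies the law of the pair [(U, V)] with the product of the
    two laws, and Tonelli's theorem factors the integral. *)
Lemma indep_mean U V (f h : R -> R) : measurable_fun setT U -> measurable_fun setT V ->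
  measurable_fun setT f -> measurable_fun setT h ->
  (forall x, 0 <= f x) -> (forall x, 0 <= h x) -> indep U V ->
  bounded_rv (f \o U) -> bounded_rv (h \o V) ->
  mean (fun w => f (U w) * h (V w)) = mean (f \o U) * mean (h \o V).
Proof.
move=> mU mV mf mh f0 h0 UV bU bV.
pose U' : {mfun Omega >-> R} := HB.pack U (isMeasurableFun.Build _ _ _ _ _ mU).
pose V' : {mfun Omega >-> R} := HB.pack V (isMeasurableFun.Build _ _ _ _ _ mV).
have mW : measurable_fun setT (fun w => (U w, V w)) by exact: measurable_fun_pair.
pose W : {mfun Omega >-> (R * R)%type} := HB.pack (fun w => (U w, V w))
  (isMeasurableFun.Build _ _ _ _ _ mW).
pose F (z : R * R) := (f z.1 * h z.2)%:E.
have mF : measurable_fun setT F.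
  apply/measurable_EFinP; apply: measurable_funM.
    exact: (measurableT_comp mf measurable_fst).
  exact: (measurableT_comp mh measurable_snd).
have F0 z : (0 <= F z)%E by rewrite lee_fin mulr_ge0.
have iU := bounded_rv_integrable bU; have iV := bounded_rv_integrable bV.
have E : (\int[P]_w (f (U w) * h (V w))%:E =
    (\int[P]_w (f (U w))%:E) * (\int[P]_w (h (V w))%:E))%E.
  transitivity (\int[distribution P W]_z F z)%E.
    by rewrite ge0_integral_distribution.
  transitivity (\int[distribution P U' \x distribution P V']_z F z)%E.
    apply: eq_measure_integral => A mA _; apply/esym.
    exact: product_measure_unique.
  rewrite fubini_tonelli1 // /fubini_F /F /=.
  under eq_integral => x _.
    under eq_integral => y _ do rewrite EFinM.
    rewrite ge0_integralZl //; last 3 first.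
    - exact/measurable_EFinP.
    - by move=> y _; rewrite lee_fin.
    - by rewrite lee_fin.
    over.
  rewrite /= ge0_integralZr //; last 3 first.
  - exact/measurable_EFinP.
  - by move=> x _; rewrite lee_fin.
  - by apply: integral_ge0 => y _; rewrite lee_fin.
  congr (_ * _)%E.
    apply: (@ge0_integral_distribution _ _ _ _ _ P U' (EFin \o f)).
      exact/measurable_EFinP.
    by move=> y; rewrite lee_fin.
  apply: (@ge0_integral_distribution _ _ _ _ _ P V' (EFin \o h)).
    exact/measurable_EFinP.
  by move=> y; rewrite lee_fin.
by rewrite /mean /Rintegral E fineM //; exact: integrable_fin_num.
Qed.

End bounded_random_variables.

(** * Concentration of almost additive sequences *)

Section almost_additive.
Variable R : realType.

(** Computing [a (k * n)] in two ways gives [(a k - c) / k <= (a n + c) / n] for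
    all [k] and [n]; any [x] separating the two families will do. *)
Lemma almost_additive_linear (a : nat -> R) (c : R) :
  (forall k l, (0 < k)%N -> (0 < l)%N -> `|a (k + l)%N - a k - a l| <= c) ->
  exists x, forall n, (0 < n)%N -> `|a n - n%:R * x| <= c.
Proof.
move=> ac.
have mul k n : (0 < n)%N -> `|a (k.+1 * n)%N - k.+1%:R * a n| <= k%:R * c.
  move=> n0; elim: k => [|k IH]; first by rewrite mul1n mul1r subrr normr0 mul0r.
  have -> : (k.+2 * n = k.+1 * n + n)%N by rewrite mulSn addnC.
  have -> : a (k.+1 * n + n)%N - k.+2%:R * a n =
    (a (k.+1 * n + n)%N - a (k.+1 * n)%N - a n) + (a (k.+1 * n)%N - k.+1%:R * a n).
    by rewrite -[k.+2%:R]natr1; ring.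
  rewrite (le_trans (ler_normD _ _)) //.
  have -> : k.+1%:R * c = c + k%:R * c by rewrite -natr1; ring.
  rewrite lerD //.
  by rewrite ac // muln_gt0.
have c0 : 0 <= c by rewrite (le_trans _ (ac 1%N 1%N isT isT)).
have cmp k n : (0 < k)%N -> (0 < n)%N -> (a k - c) / k%:R <= (a n + c) / n%:R.
  case: k n => [//|k] [//|n] _ _.
  have := mul k n.+1 isT; have := mul n k.+1 isT; rewrite mulnC.
  rewrite !ler_norml => /andP[lo _] /andP[_ hi].
  rewrite ler_pdivrMr // mulrAC ler_pdivlMr //.
  have : n%:R * c <= n.+1%:R * c by rewrite ler_wpM2r // ler_nat.
  have : k%:R * c <= k.+1%:R * c by rewrite ler_wpM2r // ler_nat.
  lra.
pose S := [set y | exists2 k, (0 < k)%N & y = (a k - c) / k%:R].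
have S0 : S !=set0 by exists ((a 1%N - c) / 1%:R); exists 1%N.
have ubS n : (0 < n)%N -> ubound S ((a n + c) / n%:R).
  by move=> n0 _ [k k0 ->]; exact: cmp.
have hS : has_sup S by split => //; exists ((a 1%N + c) / 1%:R); exact: ubS.
exists (sup S) => n n0; have nR : 0 < n%:R :> R by rewrite ltr0n.
have lo : (a n - c) / n%:R <= sup S by apply: ub_le_sup; [exact: hS.2|exists n].
have hi : sup S <= (a n + c) / n%:R by apply: ge_sup => //; exact: ubS.
move: lo hi; rewrite ler_pdivrMr // ler_pdivlMr // ler_norml => lo hi.
by apply/andP; split; lra.
Qed.

Lemma expR_le_quadratic (y : R) : y <= 2^-1 -> expR y <= 1 + y + 2 * y ^+ 2.
Proof.
move=> y1; have y2 : 0 < 1 - y by lra.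
have h : expR y <= (1 - y)^-1.
  rewrite -[y in leLHS]opprK expRN lef_pV2 ?posrE ?expR_gt0 //.
  exact: expR_ge1Dx.
apply: (le_trans h); rewrite -div1r ler_pdivrMr //.
have : 0 <= y ^+ 2 * (1 - 2 * y) by rewrite mulr_ge0 ?sqr_ge0 //; lra.
lra.
Qed.

End almost_additive.

Section concentration.
Context {d : measure_display} {Omega : measurableType d} {R : realType}.
Variable P : probability Omega R.

Lemma prob_le_mean (A : set Omega) (f : Omega -> R) : measurable A ->
  bounded_rv f -> (forall w, 0 <= f w) -> (forall w, A w -> 1 <= f w) ->
  (P A <= (mean P f)%:E)%E.
Proof.
move=> mA bf f0 f1; have intf := @bounded_rv_integrable _ _ _ P _ bf.
rewrite /mean /Rintegral fineK; last exact: integrable_fin_num.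
rewrite -[A]setIT -integral_indic //; apply: ge0_le_integral => //.
- exact/measurable_EFinP/measurable_indic.
- by apply/measurable_EFinP; exact: bf.1.
- move=> w _; rewrite lee_fin indicE.
  by case: (boolP (w \in A)) => [/set_mem/f1|_] //; exact: f0.
Qed.

Variables (X : nat -> Omega -> R) (kap c : R).
Hypotheses (kap0 : 0 <= kap) (c0 : 0 <= c).
Hypothesis mX : forall n, measurable_fun setT (X n).
Hypothesis bX : forall n w, `|X n w| <= kap * n%:R.
(** The block after time [k] is, up to [c], independent of the first one and
    distributed as a block started at time [0]. Only pairs of blocks are required
    to be independent, and this suffices to multiply Laplace transforms. *)
Hypothesis splitX : forall k l, (0 < k)%N -> (0 < l)%N ->
  exists U V : Omega -> R, [/\ bounded_rv U, bounded_rv V, indep P U V,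
    same_dist P V (X l) &
    {ae P, forall w, `|X k w - U w| <= c /\ `|X (k + l)%N w - U w - V w| <= c}].

Let bXn n : bounded_rv (X n).
Proof. by split; [exact: mX|exists (kap * n%:R); exact: bX]. Qed.

Let a n := mean P (X n).
Let phi (la : R) n := mean P (fun w => expR (la * X n w)).

Let aD k l : (0 < k)%N -> (0 < l)%N -> `|a (k + l)%N - a k - a l| <= 2 * c.
Proof.
move=> k0 l0; have [U [V [bU bV _ VX UV]]] := splitX k0 l0.
have aV : mean P V = a l.
  exact: (same_dist_mean (h := id) bV.1 (mX l) (@measurable_id _ _ _) VX bV (bXn l)).
have bs := bounded_rvD (bXn k) bV.
rewrite -aV ler_norml; apply/andP; split.
  have : mean P (fun w => (X k w + V w) + - (2 * c)) <= a (k + l)%N.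
    apply: mean_le_ae => //; first exact: (bounded_rvD bs (bounded_rv_cst _)).
    apply: filterS UV => w []; rewrite !ler_norml => /andP[? ?] /andP[? ?]; lra.
  rewrite (meanD P (f := fun w => X k w + V w)) //; last exact: bounded_rv_cst.
  rewrite (meanD P (f := X k)) // mean_cst -/(a k); lra.
have : a (k + l)%N <= mean P (fun w => (X k w + V w) + 2 * c).
  apply: mean_le_ae => //; first exact: (bounded_rvD bs (bounded_rv_cst _)).
  apply: filterS UV => w []; rewrite !ler_norml => /andP[? ?] /andP[? ?]; lra.
rewrite (meanD P (f := fun w => X k w + V w)) //; last exact: bounded_rv_cst.
rewrite (meanD P (f := X k)) // mean_cst -/(a k); lra.
Qed.

Let bexp la (f : Omega -> R) : bounded_rv f -> bounded_rv (fun w : Omega => expR (la * f w)).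
Proof. by move=> bf; apply: bounded_rv_expR; exact: bounded_rvZ. Qed.

Let mexp (la : R) : measurable_fun setT (fun x : R => expR (la * x)).
Proof.
apply: measurableT_comp => //; exact: measurable_funM.
Qed.

Let phiD la k l : (0 < k)%N -> (0 < l)%N ->
  phi la (k + l)%N <= expR (2 * c * `|la|) * (phi la k * phi la l).
Proof.
move=> k0 l0; have [U [V [bU bV iUV VX UV]]] := splitX k0 l0.
have E : expR (2 * c * `|la|) = expR (c * `|la|) * expR (c * `|la|).
  by rewrite -expRD; congr expR; ring.
have phiV : mean P (fun w => expR (la * V w)) = phi la l.
  apply: (same_dist_mean (h := fun x => expR (la * x)) bV.1 (mX l) (mexp la) VX).
    exact: bexp.
  exact: bexp.
have bexpUV := bounded_rvM (bexp la bU) (bexp la bV).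
have h1 : phi la (k + l)%N <=
    expR (c * `|la|) * mean P (fun w => expR (la * U w) * expR (la * V w)).
  rewrite -meanZ //; apply: mean_le_ae; [exact: bexp|exact: bounded_rvZ|].
  apply: filterS UV => w [_ uv]; rewrite -!expRD ler_expR.
  have := ler_wpM2l (normr_ge0 la) uv; rewrite -normrM => h.
  have := le_trans (ler_norm _) h; lra.
have h2 : mean P (fun w => expR (la * U w)) <= expR (c * `|la|) * phi la k.
  rewrite -meanZ //; last exact: bexp.
  apply: mean_le_ae; [exact: bexp|by apply: bounded_rvZ; exact: bexp|].
  apply: filterS UV => w [uv _]; rewrite -!expRD ler_expR.
  have := ler_wpM2l (normr_ge0 la) uv; rewrite -normrM => h.
  have := le_trans (ler_norm _) h; rewrite ler_norml in h; move/andP: h => [? ?].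
  lra.
apply: (le_trans h1); rewrite E -mulrA ler_wpM2l ?expR_ge0 //.
have eg0 (x : R) : 0 <= expR (la * x) by exact: expR_ge0.
have iUVE := indep_mean bU.1 bV.1 (mexp la) (mexp la) eg0 eg0 iUV
  (bexp la bU) (bexp la bV).
rewrite [leLHS]iUVE.
rewrite [X in _ * X <= _]phiV mulrA ler_wpM2r //.
by apply: mean_ge0 => w; exact: expR_ge0.
Qed.

(** On a single block of length at most [k] the variables are bounded, and a
    second order expansion bounds the Laplace transform. *)
Let phi_small la k n : 4 * kap * k%:R * `|la| <= 1 -> (n <= k)%N ->
  phi la n <= expR (la * a n + 8 * (kap * la * k%:R) ^+ 2).
Proof.
move=> small nk.
have an : `|a n| <= kap * n%:R.
  rewrite ler_norml; apply/andP; split.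
    rewrite -[leLHS](mean_cst P); apply: mean_le => //; first exact: bounded_rv_cst.
    by move=> w; have := bX n w; rewrite ler_norml => /andP[].
  rewrite -[leRHS](mean_cst P); apply: mean_le => //; first exact: bounded_rv_cst.
  by move=> w; have := bX n w; rewrite ler_norml => /andP[].
set B := 8 * (kap * la * k%:R) ^+ 2.
have knk : kap * n%:R <= kap * k%:R by rewrite ler_wpM2l // ler_nat.
have ptw w : expR (la * X n w) <= expR (la * a n) * ((1 + B - la * a n) + la * X n w).
  have -> : la * X n w = la * a n + la * (X n w - a n) by ring.
  rewrite expRD ler_wpM2l ?expR_ge0 //.
  have d2 : `|X n w - a n| <= 2 * (kap * k%:R).
    by rewrite (le_trans (ler_normB _ _)) //; have := bX n w; lra.
  have h : `|la * (X n w - a n)| <= 2 * (kap * k%:R) * `|la|.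
    by rewrite normrM mulrC ler_wpM2r.
  have h2 : la * (X n w - a n) <= 2^-1.
    by rewrite (le_trans (ler_norm _)) // (le_trans h) //; lra.
  apply: (le_trans (expR_le_quadratic h2)).
  have h3 : (la * (X n w - a n)) ^+ 2 <= (2 * (kap * k%:R) * `|la|) ^+ 2.
    by rewrite -[leLHS]real_normK ?num_real // lerXn2r ?nnegrE // !mulr_ge0.
  have h4 : 2 * (2 * (kap * k%:R) * `|la|) ^+ 2 = B.
    rewrite /B [in LHS]exprMn real_normK ?num_real //; ring.
  lra.
have bl : bounded_rv (fun w => (1 + B - la * a n) + la * X n w).
  exact: (bounded_rvD (bounded_rv_cst _) (bounded_rvZ _ _)).
apply: (@le_trans _ _ (expR (la * a n) * (1 + B))).
  have -> : 1 + B = mean P (fun w => (1 + B - la * a n) + la * X n w).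
    rewrite (meanD P (f := cst (1 + B - la * a n)) (bounded_rv_cst _)); last exact: bounded_rvZ.
    by rewrite mean_cst meanZ // -/(a n); ring.
  rewrite -meanZ //; apply: mean_le => //; first exact: bexp.
  exact: bounded_rvZ.
by rewrite expRD ler_wpM2l ?expR_ge0 // expR_ge1Dx.
Qed.

Let slope_ex : exists x, forall n, (0 < n)%N -> `|a n - n%:R * x| <= 2 * c.
Proof. exact: almost_additive_linear aD. Qed.

(** Cutting [n] into blocks of size [k] costs one error [c] per block, hence the
    factor [n / k] in front of both the error and the variance of one block. *)
Let phi_bound x la k n : (forall n, (0 < n)%N -> `|a n - n%:R * x| <= 2 * c) ->
  (0 < k)%N -> (0 < n)%N -> 4 * kap * k%:R * `|la| <= 1 ->
  phi la n <= expR (la * (n%:R * x)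
    + (n%:R / k%:R + 1) * (4 * c * `|la| + 8 * (kap * la * k%:R) ^+ 2)).
Proof.
move=> ax k0 n0 small; set g := _ + 8 * _.
have kR : 0 < k%:R :> R by rewrite ltr0n.
have cl : 0 <= c * `|la| by rewrite mulr_ge0.
have g0 : 0 <= g.
  by apply: addr_ge0; [rewrite !mulr_ge0|rewrite mulr_ge0 ?sqr_ge0].
have base j : (0 < j)%N -> (j <= k)%N -> phi la j <=
    expR (la * (j%:R * x) + (g - 2 * c * `|la|)).
  move=> j0 jk; apply: (le_trans (phi_small small jk)).
  rewrite ler_expR /g; have := ler_wpM2l (normr_ge0 la) (ax j j0); rewrite -normrM => h.
  have := le_trans (ler_norm _) h; lra.
elim/ltn_ind: n n0 => n IH n0.
have [nk|kn] := leqP n k.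
  apply: (le_trans (base n n0 nk)); rewrite ler_expR lerD2l.
  have : 0 <= n%:R / k%:R * g by rewrite mulr_ge0 // divr_ge0.
  lra.
have nkn : (n - k < n)%N by rewrite ltn_subrL k0.
have nk0 : (0 < n - k)%N by rewrite subn_gt0.
have := phiD la k0 nk0; rewrite subnKC ?(ltnW kn) // => /le_trans; apply.
apply: (@le_trans _ _ (expR (2 * c * `|la|) *
   (expR (la * (k%:R * x) + (g - 2 * c * `|la|)) *
    expR (la * ((n - k)%:R * x) + ((n - k)%:R / k%:R + 1) * g)))).
  rewrite ler_wpM2l ?expR_ge0 // ler_pM //.
  - by apply: mean_ge0 => w; exact: expR_ge0.
  - by apply: mean_ge0 => w; exact: expR_ge0.
  - exact: base.
  - exact: IH.
rewrite -!expRD ler_expR natrB ?(ltnW kn) //.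
have -> : (n%:R - k%:R) / k%:R = n%:R / k%:R - 1 :> R by field; rewrite gt_eqF.
lra.
Qed.

Let tail_bound x la k n t : (forall n, (0 < n)%N -> `|a n - n%:R * x| <= 2 * c) ->
  (0 < k)%N -> (0 < n)%N -> 0 <= la -> 4 * kap * k%:R * la <= 1 ->
  (P [set w | t < `|X n w - n%:R * x|]%R <=
    (2 * expR (- (la * t) +
     (n%:R / k%:R + 1) * (4 * c * la + 8 * (kap * la * k%:R) ^+ 2)))%:E)%E.
Proof.
move=> ax k0 n0 la0 small.
have abs_la : `|la| = la by rewrite ger0_norm.
have mdev : measurable_fun setT (fun w => `|X n w - n%:R * x|).
  apply: measurableT_comp => //; exact: measurable_funB.
have mA : measurable [set w | t < `|X n w - n%:R * x|].
  rewrite -[X in measurable X]setTI.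
  have h := measurable_fun_ltr (@measurable_cst _ _ _ _ setT t) mdev.
  by have := h measurableT [set true]; apply.
pose E s := expR (- (la * t) - s * (n%:R * x)).
pose f w := E la * expR (la * X n w) + E (- la) * expR (- la * X n w).
have bf : bounded_rv f.
  by apply: bounded_rvD; apply: bounded_rvZ; exact: bexp.
apply: (le_trans (prob_le_mean mA bf _ _)).
- by move=> w; rewrite addr_ge0 // mulr_ge0 ?expR_ge0.
- move=> w /=; rewrite lter_normr => /orP[] h; rewrite /f /E -!expRD.
    have : 1 <= expR (- (la * t) - la * (n%:R * x) + la * X n w).
      by rewrite -[leLHS]expR0 ler_expR; have := ler_wpM2l la0 (ltW h); lra.
    by move=> /le_trans; apply; rewrite lerDl expR_ge0.
  have : 1 <= expR (- (la * t) - - la * (n%:R * x) + - la * X n w).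
    by rewrite -[leLHS]expR0 ler_expR; have := ler_wpM2l la0 (ltW h); lra.
  by move=> /le_trans; apply; rewrite lerDr expR_ge0.
rewrite lee_fin /f (meanD P (f := fun w => E la * expR (la * X n w))); first last.
- by apply: bounded_rvZ; exact: bexp.
- by apply: bounded_rvZ; exact: bexp.
rewrite !meanZ; try exact: bexp.
rewrite [leRHS](_ : _ = expR (- (la * t) +
     (n%:R / k%:R + 1) * (4 * c * la + 8 * (kap * la * k%:R) ^+ 2)) +
  expR (- (la * t) +
     (n%:R / k%:R + 1) * (4 * c * la + 8 * (kap * la * k%:R) ^+ 2))); last by ring.
have small1 : 4 * kap * k%:R * `|la| <= 1 by rewrite abs_la.
have small2 : 4 * kap * k%:R * `|- la| <= 1 by rewrite normrN.
apply: lerD.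
  apply: (le_trans (ler_wpM2l (expR_ge0 _) (phi_bound ax k0 n0 small1))).
  by rewrite -expRD ler_expR abs_la; lra.
apply: (le_trans (ler_wpM2l (expR_ge0 _) (phi_bound ax k0 n0 small2))).
rewrite -expRD ler_expR normrN abs_la.
have -> : (kap * - la * k%:R) ^+ 2 = (kap * la * k%:R) ^+ 2 by ring.
lra.
Qed.

(** With blocks of length about [sqrt n] the errors of the blocks add up to
    [sqrt n], while [sqrt n] independent fluctuations of size [sqrt n] add up to
    [n^(3/4)]; the factor [ln n] in [fluct] makes the probability as small as any
    [expR (- A * (ln n) ^ 2)]. *)
Theorem almost_additive_concentration : exists x, forall (A : R) n, (0 < n)%N ->
  1 <= ln n%:R :> R -> 8 * kap * ln n%:R <= n%:R `^ (1 / 4) ->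
  (P [set w | (8 * c + 64 * kap ^+ 2 + A) * fluct R n < `|X n w - n%:R * x|]%R <=
   (2 * expR (- (A * ln n%:R ^+ 2)))%:E)%E.
Proof.
have [x ax] := slope_ex; exists x => A n n0 ln1 small.
have nR : 0 < n%:R :> R by rewrite ltr0n.
(* The blocks have length about [y ^+ 2 = sqrt n]. *)
pose y : R := n%:R `^ (1 / 4).
have n1 : 1 <= n%:R :> R by rewrite ler1n.
have y1 : 1 <= y.
  have := @ge0_ler_powR R (1 / 4) _ 1 n%:R.
  by rewrite powR1 !nnegrE; apply => //; lra.
have y0 : 0 < y by lra.
have yk (k : nat) : n%:R `^ (1 / 4 * k%:R) = y ^+ k.
  by rewrite powRrM powR_mulrn ?powR_ge0.
have E4 : n%:R = y ^+ 4.
  by rewrite -yk -[LHS]powRr1 ?ltW //; congr (_ `^ _); field.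
have E3 : n%:R `^ (3 / 4) = y ^+ 3 by rewrite -yk; congr (_ `^ _); field.
set l := ln n%:R in ln1 small *.
have l0 : 0 < l by lra.
pose k := (Num.truncn (y ^+ 2)).+1.
have y2 : 1 <= y ^+ 2 by rewrite exprn_ege1.
have k1 : y ^+ 2 <= k%:R by exact/ltW/truncnS_gt.
have k2 : k%:R <= 2 * y ^+ 2.
  have : (Num.truncn (y ^+ 2))%:R <= y ^+ 2 by rewrite truncn_le; lra.
  by rewrite /k -natr1; lra.
pose la := l / y ^+ 3.
have la0 : 0 <= la by rewrite divr_ge0 ?exprn_ge0 // ltW.
have smallk : 4 * kap * k%:R * la <= 1.
  rewrite /la mulrA ler_pdivrMr ?exprn_gt0 // mul1r.
  apply: (@le_trans _ _ (4 * kap * (2 * y ^+ 2) * l)).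
    by rewrite ler_wpM2r ?(ltW l0) // ler_wpM2l ?mulr_ge0.
  have -> : 4 * kap * (2 * y ^+ 2) * l = (8 * kap * l) * y ^+ 2 by ring.
  by rewrite [y ^+ 3]exprS ler_wpM2r ?exprn_ge0 ?(ltW y0).
apply: (le_trans (tail_bound _ ax (ltn0Sn _ : 0 < k)%N n0 la0 smallk)).
rewrite lee_fin ler_wpM2l // ler_expR.
have -> : la * ((8 * c + 64 * kap ^+ 2 + A) * fluct R n) =
    (8 * c + 64 * kap ^+ 2 + A) * l ^+ 2.
  by rewrite /fluct E3 -/l /la; field; rewrite gt_eqF.
have nk : n%:R / k%:R + 1 <= 2 * y ^+ 2.
  have : n%:R / k%:R <= y ^+ 2.
    rewrite ler_pdivrMr ?ltr0n // E4 (_ : y ^+ 4 = y ^+ 2 * y ^+ 2); last by ring.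
    by rewrite ler_wpM2l ?exprn_ge0 ?(ltW y0).
  lra.
have g0 : 0 <= 4 * c * la + 8 * (kap * la * k%:R) ^+ 2.
  apply: addr_ge0; [by apply: mulr_ge0 => //; apply: mulr_ge0|by rewrite mulr_ge0 ?sqr_ge0].
have gle : 4 * c * la + 8 * (kap * la * k%:R) ^+ 2 <=
    4 * c * la + 8 * (kap * la * (2 * y ^+ 2)) ^+ 2.
  have kl0 : 0 <= kap * la by exact: mulr_ge0.
  have lo : 0 <= kap * la * k%:R by exact: mulr_ge0.
  have le : kap * la * k%:R <= kap * la * (2 * y ^+ 2) by exact: ler_wpM2l.
  by rewrite lerD2l ler_wpM2l // lerXn2r ?nnegrE // (le_trans lo).
have : (n%:R / k%:R + 1) * (4 * c * la + 8 * (kap * la * k%:R) ^+ 2) <=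
    (8 * c + 64 * kap ^+ 2) * l ^+ 2.
  apply: (@le_trans _ _ (2 * y ^+ 2 * (4 * c * la + 8 * (kap * la * (2 * y ^+ 2)) ^+ 2))).
    by apply: ler_pM => //; rewrite addr_ge0 // divr_ge0.
  have -> : 2 * y ^+ 2 * (4 * c * la + 8 * (kap * la * (2 * y ^+ 2)) ^+ 2) =
     8 * c * (l / y) + 64 * kap ^+ 2 * l ^+ 2.
    by rewrite /la; field; rewrite gt_eqF.
  rewrite [leRHS]mulrDl lerD2r ler_wpM2l ?mulr_ge0 //.
  rewrite ler_pdivrMr // expr2 -mulrA ler_peMr ?(ltW l0) //.
  by rewrite (le_trans ln1) // ler_peMr // ltW.
lra.
Qed.

End concentration.

(** * Laws of families of random variables *)

Section generated_sigma_algebras.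
Variable R : realType.

(** The measurable space on which the laws of families [(X i)_(i in D)] live. *)
Definition coord_space (I : Type) (D : set I) := g_sigma_algebraType
  [set A : set (I -> \bar R) | exists i (B : set (\bar R)),
    [/\ D i, measurable B & A = (fun x => x i) @^-1` B]].

HB.instance Definition _ I D := Measurable.on (coord_space (I := I) D).

Section one_family.
Variables (I : Type) (D : set I).

Lemma measurable_coord i : D i ->
  measurable_fun setT (fun x : coord_space D => x i).
Proof.
move=> Di _ B mB; rewrite setTI; apply: sub_sigma_algebra.
by exists i, B.
Qed.

(** An event about a family is measurable for any sigma-algebra that makes the
    members of the family measurable. *)
Lemma measurable_family (T : pointedType) (X : I -> T -> \bar R) (G : set (set T)) :
  (forall i B, D i -> measurable B -> <<s G >> (X i @^-1` B)) ->
  forall A : set (coord_space D), measurable A ->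
    <<s G >> [set t | A (X ^~ t)].
Proof.
move=> XG A mA.
have mX : measurable_fun (setT : set (g_sigma_algebraType G))
    (fun t => X ^~ t : coord_space D).
  apply: (@measurability _ _ _ (coord_space D) setT _
    [set A : set (I -> \bar R) | exists i (B : set (\bar R)),
    [/\ D i, measurable B & A = (fun x => x i) @^-1` B]]) => //.
  move=> _ [_ [i [B [Di mB ->]]] <-]; rewrite setTI; exact: XG.
by have := mX measurableT A mA; rewrite setTI.
Qed.

Lemma sigma_gen_family (T : pointedType) (X : I -> T -> \bar R) A :
  measurable (A : set (coord_space D)) -> sigma_gen D X [set t | A (X ^~ t)].
Proof.
apply: measurable_family => i B Di mB.
by apply: sub_sigma_algebra; exists i, B.
Qed.

Lemma measurable_family_event d (T : measurableType d) (X : I -> T -> \bar R) A :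
  (forall i, D i -> measurable_fun setT (X i)) ->
  measurable (A : set (coord_space D)) -> measurable [set t | A (X ^~ t)].
Proof.
move=> mX mA.
have sT : <<s (@measurable d T) >> = @measurable d T.
  by apply: sigma_algebra_id; exact: sigma_algebra_measurable.
rewrite -sT; apply: (measurable_family _ mA) => i B Di mB.
by rewrite sT -[X i @^-1` B]setTI; exact: mX.
Qed.

Lemma measurable_forall d (T : measurableType d) (J : countType) (B : J -> set T) :
  (forall j, measurable (B j)) -> measurable [set t | forall j, B j t].
Proof.
move=> mB; have -> : [set t | forall j, B j t] = ~` (\bigcup_j ~` B j).
  apply/seteqP; split => t /=; first by move=> Bt [j _ /(_ (Bt j))].
  by move=> nB j; apply: contrapT => Bj; apply: nB; exists j.
apply: measurableC; apply: countable_bigcupT_measurable => [|j]; first exact: countableP.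
exact: measurableC.
Qed.

Lemma measurable_imply d (T : measurableType d) (Q : Prop) (B : set T) :
  (Q -> measurable B) -> measurable [set t | Q -> B t].
Proof.
move=> mB; have [q|nq] := pselect Q.
  rewrite (_ : [set t | _] = B); first exact: mB.
  by apply/seteqP; split => t /=; [apply|].
rewrite (_ : [set t | _] = setT); first exact: measurableT.
by apply/seteqP; split => // t _ /= q; have := nq q.
Qed.

End one_family.

Section laws.
Context {d : measure_display} {Omega : measurableType d}.
Variables (P : probability Omega R) (I : Type) (D : set I).
Variables X Y : I -> Omega -> \bar R.
Hypotheses (mX : forall i, D i -> measurable_fun setT (X i))
  (mY : forall i, D i -> measurable_fun setT (Y i)).
Hypothesis XY : same_law P D X Y.

Lemma same_law_ae (B : set (coord_space D)) : measurable B ->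
  {ae P, forall w, B (Y ^~ w)} -> {ae P, forall w, B (X ^~ w)}.
Proof.
move=> mB BY.
have mBX := measurable_family_event mX mB; have mBY := measurable_family_event mY mB.
have mBXC : measurable [set w | ~ B (X ^~ w)] by exact: (measurableC mBX).
have mBYC : measurable [set w | ~ B (Y ^~ w)] by exact: (measurableC mBY).
have PY : P [set w | ~ B (Y ^~ w)] = 0%E by exact: (measure_negligible mBYC BY).
have PX : P [set w | ~ B (X ^~ w)] = 0%E.
  by rewrite -PY; exact: (XY (measurableC mB)).
by exists [set w | ~ B (X ^~ w)]; split.
Qed.

End laws.
End generated_sigma_algebras.

(** * The quasi-Bernoulli property at one sample point *)

Section regular_event.
Variables (R : realType) (m : nat).
Local Notation b := m.+2.
Local Notation word := (seq 'I_b).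

Definition nonempty_words : set word := [set w | w != [::]].

Local Notation path_space := (@coord_space R word nonempty_words).

(** [regular_weight] as an event on the values of the cylinders of nonempty
    words, the only ones whose law is prescribed. *)
Definition regular_event (kap d : R) : set (word -> \bar R) :=
  [set x | (\sum_(a < b) x [:: a] = 1)%E] `&`
  [set x | forall a : 'I_b, ((expR (- kap))%:E <= x [:: a])%E] `&`
  [set x | forall w : word, w != [::] -> forall a : 'I_b,
    ((expR (- kap))%:E * x w <= x (rcons w a))%E] `&`
  [set x | forall v v' w : word, [&& size v == size v', v != [::] & w != [::]] ->
    (x (v ++ w) * x v' <= (expR d)%:E * (x v * x (v' ++ w)))%E].

Let mcoord (w : word) : w != [::] -> measurable_fun setT (fun x : path_space => x w).
Proof. by move=> w0; exact: (@measurable_coord R word nonempty_words w w0). Qed.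

Let mle (g h : path_space -> \bar R) : measurable_fun setT g -> measurable_fun setT h ->
  measurable [set x | (g x <= h x)%E].
Proof. by move=> mg mh; rewrite -[X in measurable X]setTI; exact: measurable_lee. Qed.

Lemma measurable_sum_letters :
  measurable ([set x | (\sum_(a < b) x [:: a] = 1)%E] : set path_space).
Proof.
have ms : measurable_fun setT (fun x : path_space => \sum_(a < b) x [:: a])%E.
  exact: (emeasurable_sum (index_enum 'I_b) (fun a => mcoord (w := [:: a]) isT)).
have := ms measurableT _ (emeasurable_set1 1%E).
by rewrite setTI.
Qed.

Lemma measurable_low_letters (r : R) :
  measurable ([set x | forall a : 'I_b, (r%:E <= x [:: a])%E] : set path_space).
Proof.
by apply: measurable_forall => a; apply: mle; [exact: measurable_cst|exact: mcoord].
Qed.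

Lemma measurable_regular_event kap d :
  measurable (regular_event kap d : set path_space).
Proof.
apply: measurableI; last first.
  apply: measurable_forall => v; apply: measurable_forall => v'.
  apply: measurable_forall => w; apply: measurable_imply => /and3P[/eqP sv v0 w0].
  have v'0 : v' != [::] by rewrite -size_eq0 -sv size_eq0.
  have vw0 : v ++ w != [::] by case: (v) v0.
  have v'w0 : v' ++ w != [::] by case: (v') v'0.
  apply: mle; first by apply: emeasurable_funM; exact: mcoord.
  apply: emeasurable_funM; first exact: measurable_cst.
  by apply: emeasurable_funM; exact: mcoord.
apply: measurableI; last first.
  apply: measurable_forall => w; apply: measurable_imply => w0.
  apply: measurable_forall => a; apply: mle; last by apply: mcoord; case: (w).
  by apply: emeasurable_funM; [exact: measurable_cst|exact: mcoord].
apply: measurableI; first exact: measurable_sum_letters.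
exact: measurable_low_letters.
Qed.

Lemma regular_event_weight (nu : {measure set (symb m) -> \bar R}) kap d :
  0 <= d -> regular_event kap d (fun w => nu (cyl w)) -> regular_weight kap d (weight nu).
Proof.
move=> d0 [[[sum1 low1] low] qb].
have nuT : nu (cyl [::]) = 1%E by rewrite measure_cyl_rcons.
have fin w : nu (cyl w) = (weight nu w)%:E.
  rewrite /weight fineK // ge0_fin_numE // (@le_lt_trans _ _ 1%E) ?ltry //.
  rewrite -nuT; apply: le_measure; rewrite ?inE ?cyl_nil //; exact: measurable_cyl.
split.
- by rewrite /weight nuT.
- move=> w; apply: EFin_inj; rewrite -sumEFin -fin measure_cyl_rcons.
  by apply: eq_bigr => a _; rewrite fin.
- move=> w a; rewrite -lee_fin EFinM -!fin; case: (altP (w =P [::])) => [->|w0].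
    by rewrite nuT mule1; exact: low1.
  exact: low.
- move=> v v' w svv'; rewrite -lee_fin !EFinM -!fin.
  have ed : (1 <= (expR d)%:E)%E by rewrite lee_fin -[leLHS]expR0 ler_expR.
  case: (altP (v =P [::])) svv' => [->|v0] svv'.
    have -> : v' = [::] by case: v' svv'.
    rewrite nuT mule1 mul1e; exact: lee_pemull.
  case: (altP (w =P [::])) => [->|w0].
    rewrite !cats0; apply: lee_pemull => //; exact: mule_ge0.
  by apply: qb; rewrite svv' eqxx v0 w0.
Qed.

End regular_event.

(** The bounds of the quasi-Bernoulli property at one sample point. *)
Record quasi_bernoulli_at (R : realType) (m : nat)
    (mu : {measure set (symb m) -> \bar R})
    (pre post : nat -> {measure set (symb m) -> \bar R}) (C rho : R) : Prop :=
  QuasiBernoulliAt {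
  qba_total : mu setT = 1%E;
  qba_low : forall a : 'I_m.+2, (rho%:E <= mu (cyl [:: a]))%E;
  qba_post_sum : forall k, (0 < k)%N ->
    (\sum_(a < m.+2) post k (cyl [:: a]) = 1)%E;
  qba_post_low : forall k, (0 < k)%N -> forall a : 'I_m.+2,
    (rho%:E <= post k (cyl [:: a]))%E;
  qba_P1 : forall k, (0 < k)%N -> forall (v : k.-tuple 'I_m.+2) (w : seq 'I_m.+2),
    w != [::] ->
    (C^-1%:E * (pre k (cyl v) * post k (cyl w)) <= mu (cyl (v ++ w))
       <= C%:E * (pre k (cyl v) * post k (cyl w)))%E }.

Section pointwise.
Variables (R : realType) (m : nat).
Local Notation b := m.+2.
Local Notation word := (seq 'I_b).
Variables (mu : {measure set (symb m) -> \bar R}).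
Variables (pre post : nat -> {measure set (symb m) -> \bar R}) (C rho : R).
Hypotheses (C1 : 1 <= C) (rho0 : 0 < rho).
Hypothesis qb : quasi_bernoulli_at mu pre post C rho.

Let mu_low := qba_low qb.
Let post_sum := qba_post_sum qb.
Let post_low k a (k0 : (0 < k)%N) := qba_post_low qb k0 a.
Let P1 := qba_P1 qb.

Local Notation f := (weight mu).
Local Notation u := (fun k => weight (pre k)).
Local Notation h := (fun k => weight (post k)).

Let C0 : 0 < C. Proof. exact: lt_le_trans C1. Qed.

Let muE w : mu (cyl w) = (f w)%:E.
Proof.
rewrite /weight fineK // ge0_fin_numE // (@le_lt_trans _ _ 1%E) ?ltry //.
rewrite -(qba_total qb); apply: le_measure; rewrite ?inE //; first exact: measurable_cyl.
Qed.


Lemma post_setT k : (0 < k)%N -> post k (cyl [::]) = 1%E.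
Proof. by move=> k0; rewrite measure_cyl_rcons; exact: post_sum. Qed.

Lemma post_fin k w : (0 < k)%N -> post k (cyl w) = (h k w)%:E.
Proof.
move=> k0; rewrite /weight fineK // ge0_fin_numE // (@le_lt_trans _ _ 1%E) ?ltry //.
rewrite -(post_setT k0); apply: le_measure; rewrite ?inE ?cyl_nil //.
exact: measurable_cyl.
Qed.

Lemma pre_fin k (v : k.-tuple 'I_b) : (0 < k)%N -> pre k (cyl v) = (u k v)%:E.
Proof.
move=> k0; rewrite /weight fineK // ge0_fin_numE // ltNge leye_eq; apply/negP => /eqP E.
have /andP[+ _] := @P1 k k0 v [:: ord0] isT.
rewrite E muE gt0_mulye; last first.
  by rewrite (lt_le_trans _ (post_low ord0 k0)) // lte_fin.
by rewrite gt0_muley ?lte_fin ?invr_gt0 // leye_eq.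
Qed.

Lemma split_weight k (v : k.-tuple 'I_b) (w : word) : (0 < k)%N -> w != [::] ->
  C^-1 * (u k v * h k w) <= f (v ++ w) <= C * (u k v * h k w).
Proof.
move=> k0 w0; have := P1 k0 v w0.
by rewrite (pre_fin v k0) (post_fin w k0) muE -!EFinM !lee_fin.
Qed.

(** Sum the splitting inequality over the first letter of the continuation, whose
    total mass is [1]. *)
Lemma pre_weight k (v : k.-tuple 'I_b) : (0 < k)%N ->
  C^-1 * u k v <= f v <= C * u k v.
Proof.
move=> k0.
have h1 : \sum_(a < b) h k [:: a] = 1.
  apply: EFin_inj; rewrite -sumEFin -(post_sum k0).
  by apply: eq_bigr => a _; rewrite post_fin.
have -> : f v = \sum_(a < b) f (v ++ [:: a]).
  apply: EFin_inj; rewrite -sumEFin -muE (measure_cyl_rcons mu).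
  by apply: eq_bigr => a _; rewrite cats1 -muE.
have E (c : R) : c * u k v = \sum_(a < b) c * (u k v * h k [:: a]).
  by rewrite -mulr_sumr -mulr_sumr h1 mulr1.
by rewrite !E; apply/andP; split; apply: ler_sum => a _;
  have /andP[] := @split_weight k v [:: a] k0 isT.
Qed.

Definition qb_kap : R := 2 * ln C - ln rho.
Definition qb_d : R := 4 * ln C.

Let ulow k (v : k.-tuple 'I_b) : (0 < k)%N -> C^-1 * f v <= u k v.
Proof.
by move=> k0; rewrite ler_pdivrMl //; have /andP[] := pre_weight v k0.
Qed.

Let uup k (v : k.-tuple 'I_b) : (0 < k)%N -> u k v <= C * f v.
Proof.
by move=> k0; rewrite -ler_pdivrMl //; have /andP[] := pre_weight v k0.
Qed.

Let expC : expR (ln C) = C. Proof. by rewrite lnK // posrE. Qed.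

Let f_ge0 w : 0 <= f w. Proof. by rewrite fine_ge0. Qed.
Let h_ge0 k w : 0 <= h k w. Proof. by rewrite fine_ge0. Qed.
Let u_ge0 k w : 0 <= u k w. Proof. by rewrite fine_ge0. Qed.

(** Both [f (v ++ w) / f v] and [f (v' ++ w) / f v'] are the weight of [w] under
    the continuation measure of level [size v], up to a factor [C ^ 2]. *)
Lemma quasi_bernoulli_regular : regular_weight qb_kap qb_d f.
Proof.
have rhoE : expR (ln rho) = rho by rewrite lnK // posrE.
have kapE : expR (- qb_kap) = C^-1 * C^-1 * rho.
  rewrite /qb_kap -[in RHS]rhoE -[in RHS]expC -!expRN -!expRD; congr expR; ring.
have dE : expR qb_d = C * C * (C * C).
  rewrite /qb_d -[in RHS]expC -!expRD; congr expR; ring.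
have f1 : f [::] = 1 by rewrite /weight cyl_nil (qba_total qb).
split.
- exact: f1.
- move=> w; apply: EFin_inj; rewrite -sumEFin -muE (measure_cyl_rcons mu).
  by apply: eq_bigr => a _; exact: muE.
- move=> w a; rewrite kapE; case: (altP (w =P [::])) => [->|w0].
    rewrite f1 mulr1 (@le_trans _ _ rho) //.
      by rewrite ler_piMl ?(ltW rho0) // -invfM invf_le1 ?mulr_gt0 // mulr_ege1.
    by have := mu_low a; rewrite muE lee_fin.
  have k0 : (0 < size w)%N by rewrite lt0n size_eq0.
  have /andP[+ _] := @split_weight _ (in_tuple w) [:: a] k0 isT.
  rewrite cats1; apply: le_trans.
  have ha : rho <= h (size w) [:: a].
    by have := post_low a k0; rewrite post_fin // lee_fin.
  have -> : C^-1 * C^-1 * rho * f w = C^-1 * (C^-1 * f w * rho) by ring.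
  rewrite ler_wpM2l ?invr_ge0 ?(ltW C0) // ler_pM ?mulr_ge0 ?invr_ge0 ?(ltW C0) ?(ltW rho0) //.
  exact: (ulow (in_tuple w) k0).
- move=> v v' w svv'; rewrite dE.
  have CC : 1 <= C * C * (C * C) by rewrite !mulr_ege1.
  case: (altP (v =P [::])) svv' => [->|v0] svv'.
    have -> : v' = [::] by case: v' svv'.
    by rewrite !cat0s f1 mulr1 mul1r ler_peMl.
  case: (altP (w =P [::])) => [->|w0].
    by rewrite !cats0 ler_peMl // mulr_ge0.
  have k0 : (0 < size v)%N by rewrite lt0n size_eq0.
  have /andP[_ a1] := split_weight (in_tuple v) k0 w0.
  have sv' : size v' == size v by rewrite svv'.
  have /andP[a2 _] := split_weight (Tuple sv') k0 w0.
  have a3 := uup (in_tuple v) k0.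
  have /andP[_ a4] := pre_weight (Tuple sv') k0.
  rewrite /= in a1 a2 a3 a4.
  apply: (le_trans (ler_pM (f_ge0 _) (f_ge0 _) a1 a4)).
  have -> : C * C * (C * C) * (f v * f (v' ++ w)) =
     (C * C) * ((C * f v) * (C * f (v' ++ w))) by ring.
  have -> : C * (u (size v) v * h (size v) w) * (C * u (size v) v') =
     (C * C) * (u (size v) v * (u (size v) v' * h (size v) w)) by ring.
  rewrite ler_wpM2l ?mulr_ge0 ?(ltW C0) // ler_pM ?mulr_ge0 //.
  by rewrite -ler_pdivrMl.
Qed.

Let f_gt0 w : 0 < f w. Proof. exact: (rw_gt0 quasi_bernoulli_regular). Qed.

Lemma pre_gt0 k (v : k.-tuple 'I_b) : (0 < k)%N -> 0 < u k v.
Proof. by move=> k0; apply: lt_le_trans (ulow v k0); rewrite mulr_gt0 ?invr_gt0. Qed.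

Lemma post_gt0 k w : (0 < k)%N -> w != [::] -> 0 < h k w.
Proof.
move=> k0 w0; pose v : k.-tuple 'I_b := [tuple of nseq k ord0].
have /andP[_ le] := split_weight v k0 w0.
have := lt_le_trans (f_gt0 _) le; rewrite pmulr_rgt0 // pmulr_rgt0 //.
exact: pre_gt0.
Qed.

Let card_tuple_gt0 k : (0 < #|{: k.-tuple 'I_b}|)%N.
Proof. by rewrite card_tuple card_ord expn_gt0. Qed.

Let lnC0 : 0 <= ln C. Proof. by rewrite ln_ge0. Qed.

Lemma zeta_pre q k : (0 < k)%N ->
  `|ln (zeta f q k) - ln (zeta (u k) q k)| <= `|q| * ln C.
Proof.
move=> k0; apply: ln_sum_ratio => //; first by move=> v; exact: pre_gt0.
  by move=> v; rewrite expC; have /andP[] := pre_weight v k0.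
by move=> v; rewrite expC; exact: uup.
Qed.

(** Splitting a word into its first [k] letters and the rest factors the
    partition sum up to a constant. *)
Lemma zeta_split q k l : (0 < k)%N -> (0 < l)%N ->
  `|ln (zeta f q (k + l)) - ln (zeta (u k) q k) - ln (zeta (h k) q l)| <= `|q| * ln C.
Proof.
move=> k0 l0.
have ne (w : l.-tuple 'I_b) : (w : word) != [::].
  by rewrite -size_eq0 size_tuple -lt0n.
have u0 (v : k.-tuple 'I_b) := pre_gt0 v k0.
have h0 (w : l.-tuple 'I_b) := post_gt0 k0 (ne w).
have su : 0 < zeta (u k) q k by exact: sum_powR_gt0.
have sh : 0 < zeta (h k) q l by exact: sum_powR_gt0.
rewrite -addrA -opprD -lnM ?posrE //.
have -> : zeta (u k) q k * zeta (h k) q l =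
    \sum_(p : k.-tuple 'I_b * l.-tuple 'I_b) (u k p.1 * h k p.2) `^ q.
  rewrite /zeta mulr_suml -(pair_bigA _ (fun (v : k.-tuple 'I_b) (w : l.-tuple 'I_b) => (u k v * h k w) `^ q)) /=.
  apply: eq_bigr => v _; rewrite mulr_sumr; apply: eq_bigr => w _.
  by rewrite powRM.
have -> : zeta f q (k + l) = \sum_(p : k.-tuple 'I_b * l.-tuple 'I_b) f (p.1 ++ p.2) `^ q.
  rewrite /zeta (@sum_tuple_cat _ _ k l (fun w => f w `^ q)).
  by rewrite -(pair_bigA _ (fun (v : k.-tuple 'I_b) (w : l.-tuple 'I_b) => f (v ++ w) `^ q)).
apply: ln_sum_ratio => //.
- by move=> p; exact: mulr_gt0.
- by rewrite card_prod muln_gt0 !card_tuple_gt0.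
- by move=> p; rewrite expC; have /andP[] := split_weight p.1 k0 (ne p.2).
- move=> p; rewrite expC -ler_pdivrMl //.
  by have /andP[] := split_weight p.1 k0 (ne p.2).
Qed.

End pointwise.

Section zeta_in_q.
Variables (R : realType) (m : nat).
Local Notation b := m.+2.
Local Notation word := (seq 'I_b).
Local Notation L := (ln b%:R : R).
Variables (f : word -> R) (kap d : R).
Hypothesis rf : regular_weight kap d f.

Lemma zeta_lipschitz q q' n :
  `|ln (zeta f q n) - ln (zeta f q' n)| <= kap * n%:R * `|q - q'|.
Proof.
have f0 := rw_gt0 rf; have z0 := zeta_gt0 rf.
have half q1 q2 : ln (zeta f q1 n) <= kap * n%:R * `|q1 - q2| + ln (zeta f q2 n).
  rewrite -[X in X + _]expRK -lnM ?posrE ?expR_gt0 //.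
  rewrite ler_ln // ?posrE ?z0 // ?mulr_gt0 ?expR_gt0 // /zeta mulr_sumr.
  apply: ler_sum => w _; rewrite !powR_expR // -expRD ler_expR -lerBlDr -mulrBl.
  rewrite (le_trans (ler_norm _)) // normrM mulrC ler_wpM2r //.
  have f1 := rw_le1 rf w.
  have := rw_ge rf w; rewrite size_tuple => fn.
  rewrite ler0_norm; last by rewrite ln_le0.
  by rewrite lerNl -mulNr -[leLHS]expRK ler_ln ?posrE ?expR_gt0.
have h1 := half q q'; have h2 := half q' q; rewrite distrC in h2.
by rewrite ler_norml; apply/andP; split; lra.
Qed.

Lemma zeta_bound q n : `|ln (zeta f q n)| <= (L + kap * `|q|) * n%:R.
Proof.
have := zeta_lipschitz q 0 n; rewrite subr0.
have -> : zeta f 0 n = b%:R ^+ n.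
  rewrite /zeta (eq_bigr (fun=> 1)); last by move=> w _; rewrite powRr0.
  by rewrite sumr_const card_tuple card_ord -natrX.
have -> : ln (b%:R ^+ n) = L * n%:R :> R by rewrite lnXn // mulr_natr.
move=> h; rewrite -[ln (zeta f q n)](subrK (L * n%:R)).
rewrite (le_trans (ler_normD _ _)) //.
rewrite [`|L * n%:R|]ger0_norm ?mulr_ge0 ?(ltW (lnb_gt0 _ _)) //.
lra.
Qed.

End zeta_in_q.

(** * Almost sure bounds *)

Section clip.
Variable R : realType.

(** Logarithms of partition sums are only almost surely bounded; clipping makes
    them bounded everywhere without changing them almost surely. *)
Definition clip (K x : R) : R := Num.max (- K) (Num.min K x).

Lemma clip_id K x : `|x| <= K -> clip K x = x.
Proof.
rewrite ler_norml => /andP[h1 h2].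
by rewrite /clip (min_r h2) (max_r h1).
Qed.

Lemma clip_le K x : 0 <= K -> `|clip K x| <= K.
Proof.
move=> K0; rewrite ler_norml /clip le_max lexx /= ge_max ge_min lexx /= andbT.
by rewrite (le_trans _ K0) // oppr_le0.
Qed.

Lemma measurable_clip K : measurable_fun setT (clip K).
Proof. by apply: measurable_maxr => //; exact: measurable_minr. Qed.

Definition log_zeta (I : Type) (J : finType) (e : J -> I) (K q : R) (x : I -> \bar R) : R :=
  clip K (ln (\sum_j fine (x (e j)) `^ q)).

Lemma measurable_log_zeta (I : Type) (D : set I) (J : finType) (e : J -> I) K q :
  (forall j, D (e j)) ->
  measurable_fun (setT : set (coord_space R D)) (log_zeta e K q).
Proof.
move=> De; apply: (measurableT_comp (measurable_clip K)).
apply: (measurableT_comp (@measurable_ln R)).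
apply: measurable_sum => j; apply: (measurableT_comp (@measurable_powR R q)).
apply: (measurableT_comp (fine_measurable (@measurableT _ (\bar R)))).
exact: measurable_coord.
Qed.

End clip.

Section almost_sure_bounds.
Context {R : realType} {m : nat} {d : measure_display} {Omega : measurableType d}.
Variables (P : probability Omega R) (mu : R.-pker Omega ~> symb m) (C0 : R).
Variables (mupre mupost : nat -> R.-ker Omega ~> symb m).
Hypothesis hmu : quasi_bernoulli P mu C0 mupre mupost.
Local Notation b := m.+2.
Local Notation word := (seq 'I_b).

Lemma mu_sum_letters w : (\sum_(a < b) mu w (cyl [:: a]) = 1)%E.
Proof.
by rewrite -(measure_cyl_rcons (mu w) [::]) cyl_nil prob_kernel.
Qed.

Lemma measurable_cyl_kernel (k : R.-ker Omega ~> symb m) (w : word) :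
  measurable_fun setT (fun omega => k omega (cyl w)).
Proof. by apply: measurable_kernel; exact: measurable_cyl. Qed.

Lemma letters_lower_bound : exists2 rho : R, 0 < rho < 1 &
  {ae P, forall omega, forall a : 'I_b, (rho%:E <= mu omega (cyl [:: a]))%E}.
Proof.
pose X (a : 'I_b) omega := mu omega (cyl [:: a]).
have /choice[r rP] : forall a : 'I_b, exists r : R, 0 < r /\ (r%:E <= ess_inf P (X a))%E.
  move=> a; have [X0 _] := qb_P2 hmu a.
  case: (ess_inf P (X a)) X0 => [r r0|_|//]; first by exists r; rewrite -lte_fin.
  by exists 1; split => //; rewrite leey.
pose rho := \big[Num.min/2^-1]_(a < b) r a.
exists rho.
  apply/andP; split.
    by apply: lt_bigmin => [|a _]; [rewrite invr_gt0|have [] := rP a].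
  by rewrite (le_lt_trans (bigmin_le_id _ _ _ _)) // invf_lt1 // ltr1n.
apply: filter_forall => a; have [_ ra] := rP a.
have := ess_inf_le P (X a); apply: filterS => omega; apply: le_trans.
by apply: le_trans ra; rewrite lee_fin bigmin_le.
Qed.

Lemma post_transfer (k : nat) (B : set (word -> \bar R)) : (0 < k)%N ->
  measurable (B : set (coord_space R (@nonempty_words m))) ->
  {ae P, forall omega, B (fun w => mu omega (cyl w))} ->
  {ae P, forall omega, B (fun w => mupost k omega (cyl w))}.
Proof.
move=> k0 mB; apply: (same_law_ae _ _ (qb_P3 hmu k0) mB).
- by move=> w _; exact: measurable_cyl_kernel.
- by move=> w _; exact: measurable_cyl_kernel.
Qed.

(** (P3) carries total mass and lower bounds from [mu] to its copies. *)
Lemma quasi_bernoulli_ae : exists C rho : R, [/\ 1 <= C, 0 < rho < 1 &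
  {ae P, forall omega, quasi_bernoulli_at (mu omega)
    (fun k => mupre k omega) (fun k => mupost k omega) C rho}].
Proof.
have [rho rho01 low] := letters_lower_bound.
pose C := Num.max C0 1; have C1 : 1 <= C by rewrite le_max lexx orbT.
have CC0 : C0 <= C by rewrite le_max lexx.
have C00 := qb_C_gt0 hmu.
exists C, rho; split => //.
have post : {ae P, forall omega, forall k, (0 < k)%N ->
    (\sum_(a < b) mupost k omega (cyl [:: a]) = 1)%E /\
    (forall a : 'I_b, (rho%:E <= mupost k omega (cyl [:: a]))%E)}.
  apply: ae_foralln => -[|k]; first exact: aeW.
  pose B := [set x : word -> \bar R | (\sum_(a < b) x [:: a] = 1)%E] `&`
    [set x : word -> \bar R | forall a : 'I_b, (rho%:E <= x [:: a])%E].
  have mB : measurable (B : set (coord_space R (@nonempty_words m))).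
    by apply: measurableI; [exact: measurable_sum_letters|exact: measurable_low_letters].
  have BY : {ae P, forall omega, B (fun w => mu omega (cyl w))}.
    by apply: filterS low => omega lo; split; [exact: mu_sum_letters|exact: lo].
  by apply: filterS (post_transfer (isT : (0 < k.+1)%N) mB BY) => omega H _.
have pre : {ae P, forall omega, forall k, (0 < k)%N ->
    forall (v : k.-tuple 'I_b) (w : word), w != [::] ->
    (C^-1%:E * (mupre k omega (cyl v) * mupost k omega (cyl w))
       <= mu omega (cyl (v ++ w))
       <= C%:E * (mupre k omega (cyl v) * mupost k omega (cyl w)))%E}.
  apply: ae_foralln => -[|k]; first exact: aeW.
  have := qb_P1 hmu (isT : (0 < k.+1)%N); apply: filterS => omega H _ v w w0.
  have x0 : (0 <= mupre k.+1 omega (cyl v) * mupost k.+1 omega (cyl w))%E.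
    by rewrite mule_ge0.
  have /andP[lo hi] := H v w w0; apply/andP; split.
    apply: le_trans lo; rewrite lee_wpmul2r // lee_fin lef_pV2 ?posrE //.
    exact: lt_le_trans C1.
  by apply: (le_trans hi); rewrite lee_wpmul2r // lee_fin.
apply: filterS3 low post pre => omega low post pre; split => //.
- exact: prob_kernel.
- by move=> k k0; have [] := post k k0.
- by move=> k k0; have [] := post k k0.
Qed.

End almost_sure_bounds.

(** * Concentration of partition sums *)

Lemma weight_regular_event (R : realType) (m : nat)
    (nu : {measure set (symb m) -> \bar R}) kap d :
  regular_weight kap d (weight nu) -> regular_event kap d (fun w => nu (cyl w)).
Proof.
move=> rf; have E w := weightE_of_regular w rf.
repeat split => /=.
- under eq_bigr => a _ do rewrite E.
  by rewrite sumEFin -(rw_nil rf) (rw_add rf [::]).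
- by move=> a; rewrite E lee_fin; have := rw_low rf [::] a; rewrite (rw_nil rf) mulr1.
- by move=> w _ a; rewrite !E lee_fin; exact: (rw_low rf).
- by move=> v v' w /and3P[/eqP sv _ _]; rewrite !E lee_fin; exact: (rw_qb rf).
Qed.

Section concentration_of_partition_sums.
Context {R : realType} {m : nat} {d : measure_display} {Omega : measurableType d}.
Variables (P : probability Omega R) (mu : R.-pker Omega ~> symb m) (C0 : R).
Variables (mupre mupost : nat -> R.-ker Omega ~> symb m).
Hypothesis hmu : quasi_bernoulli P mu C0 mupre mupost.
Variables (C rho : R).
Hypotheses (C1 : 1 <= C) (rho01 : 0 < rho < 1).
Hypothesis hae : {ae P, forall omega, quasi_bernoulli_at (mu omega)
    (fun k => mupre k omega) (fun k => mupost k omega) C rho}.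
Local Notation b := m.+2.
Local Notation word := (seq 'I_b).
Local Notation L := (ln b%:R : R).
Local Notation kap := (qb_kap C rho).
Local Notation dd := (qb_d C).

Lemma qb_kap_gt0 : 0 < kap.
Proof.
rewrite /qb_kap; have := ln_lt0 rho01; have : 0 <= ln C by rewrite ln_ge0.
lra.
Qed.

Lemma qb_d_ge0 : 0 <= dd.
Proof. by rewrite /qb_d mulr_ge0 // ln_ge0. Qed.

Let rho0 : 0 < rho. Proof. by case/andP: rho01. Qed.

Lemma mu_regular_ae :
  {ae P, forall omega, regular_weight kap dd (weight (mu omega))}.
Proof. by apply: filterS hae => omega qb; exact: quasi_bernoulli_regular qb. Qed.

Lemma post_regular_ae : {ae P, forall omega, forall k, (0 < k)%N ->
  regular_weight kap dd (weight (mupost k omega))}.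
Proof.
apply: ae_foralln => -[|k]; first exact: aeW.
have BY : {ae P, forall omega, regular_event kap dd (fun w => mu omega (cyl w))}.
  by apply: filterS mu_regular_ae => omega; exact: weight_regular_event.
have := post_transfer hmu (isT : (0 < k.+1)%N) (@measurable_regular_event R m kap dd) BY.
apply: filterS => omega re _; exact: regular_event_weight qb_d_ge0 re.
Qed.

Variables (Q q : R).
Hypothesis qQ : `|q| <= Q.

Let Q0 : 0 <= Q. Proof. exact: le_trans qQ. Qed.
Let lnC0 : 0 <= ln C. Proof. by rewrite ln_ge0. Qed.

Definition zeta_slope : R := L + kap * Q.
Definition zeta_defect : R := Q * ln C.

Lemma zeta_slope_ge0 : 0 <= zeta_slope.
Proof. by rewrite addr_ge0 ?mulr_ge0 ?(ltW qb_kap_gt0) ?(ltW (lnb_gt0 _ _)). Qed.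

Lemma zeta_defect_ge0 : 0 <= zeta_defect.
Proof. exact: mulr_ge0. Qed.

Definition clipped_log_zeta (n : nat) (x : word -> \bar R) : R :=
  log_zeta (fun w : n.-tuple 'I_b => tval w) (zeta_slope * n%:R) q x.

Lemma measurable_clipped_log_zeta n : (0 < n)%N ->
  measurable_fun (setT : set (coord_space R (@nonempty_words m))) (clipped_log_zeta n).
Proof.
move=> n0; apply: measurable_log_zeta => w.
by rewrite /nonempty_words /= -size_eq0 size_tuple -lt0n.
Qed.

Lemma clipped_log_zetaE (nu : {measure set (symb m) -> \bar R}) n :
  regular_weight kap dd (weight nu) ->
  clipped_log_zeta n (fun w => nu (cyl w)) = ln (zeta (weight nu) q n).
Proof.
move=> rf; apply: clip_id; have zb := zeta_bound rf q n.
rewrite -/(zeta (weight nu) q n) (le_trans zb) //.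
by rewrite ler_wpM2r // lerD2l ler_wpM2l // ltW // qb_kap_gt0.
Qed.

Lemma clipped_log_zeta_le n x : `|clipped_log_zeta n x| <= zeta_slope * n%:R.
Proof. by apply: clip_le; rewrite mulr_ge0 // zeta_slope_ge0. Qed.

Let XX n omega := if n is 0%N then 0 else clipped_log_zeta n (fun w => mu omega (cyl w)).

Let mcoord_fun (X : word -> Omega -> \bar R) (Phi : (word -> \bar R) -> R) :
  (forall w, measurable_fun setT (X w)) ->
  measurable_fun (setT : set (coord_space R (@nonempty_words m))) Phi ->
  measurable_fun setT (fun omega => Phi (X ^~ omega)).
Proof.
move=> mX mPhi _ A mA; rewrite setTI.
have mPA : measurable (Phi @^-1` A : set (coord_space R (@nonempty_words m))).
  by rewrite -[X in measurable X]setTI; exact: mPhi.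
exact: (measurable_family_event (fun w _ => mX w) mPA).
Qed.

Let mXX n : measurable_fun setT (XX n).
Proof.
case: n => [|n]; first exact: measurable_cst.
apply: (mcoord_fun (X := fun w omega => mu omega (cyl w))).
  by move=> w; exact: measurable_cyl_kernel.
exact: measurable_clipped_log_zeta.
Qed.

(** The two blocks are functions of [mu_k] and of [mu^(k)]: (P4) makes them
    independent, and (P3) gives the second one the law of [ln Z_l]. *)
Let splitXX k l : (0 < k)%N -> (0 < l)%N ->
  exists U V : Omega -> R, [/\ bounded_rv U, bounded_rv V, indep P U V,
    same_dist P V (XX l) &
    {ae P, forall w, `|XX k w - U w| <= zeta_defect /\
                     `|XX (k + l)%N w - U w - V w| <= zeta_defect}].
Proof.
move=> k0 l0; pose KU := zeta_slope * k%:R + zeta_defect.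
have KU0 : 0 <= KU.
  by rewrite addr_ge0 ?zeta_defect_ge0 // mulr_ge0 // zeta_slope_ge0.
pose PhiU := @log_zeta R (k.-tuple 'I_b) {: k.-tuple 'I_b} id KU q.
pose U omega := PhiU (fun v : k.-tuple 'I_b => mupre k omega (cyl v)).
pose V omega := clipped_log_zeta l (fun w => mupost k omega (cyl w)).
have mPhiU : measurable_fun (setT : set (coord_space R [set: k.-tuple 'I_b])) PhiU.
  exact: measurable_log_zeta.
have UF A : measurable A -> sigma_gen [set: k.-tuple 'I_b]
    (fun (v : k.-tuple 'I_b) omega => mupre k omega (cyl v)) (U @^-1` A).
  move=> mA; apply: (@sigma_gen_family R _ [set: k.-tuple 'I_b] Omega
    (fun (v : k.-tuple 'I_b) omega => mupre k omega (cyl v)) (PhiU @^-1` A)).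
  by rewrite -[X in measurable X]setTI; exact: mPhiU.
have mPhiV := measurable_clipped_log_zeta l0.
have mPV A : measurable A ->
    measurable (clipped_log_zeta l @^-1` A : set (coord_space R (@nonempty_words m))).
  by move=> mA; rewrite -[X in measurable X]setTI; exact: mPhiV.
have VF A : measurable A -> sigma_gen (@nonempty_words m)
    (fun w omega => mupost k omega (cyl w)) (V @^-1` A).
  move=> mA; exact: (@sigma_gen_family R _ (@nonempty_words m) Omega
    (fun w omega => mupost k omega (cyl w)) (clipped_log_zeta l @^-1` A) (mPV A mA)).
have mU : measurable_fun setT U.
  move=> _ A mA; rewrite setTI.
  apply: (@measurable_family_event R _ [set: k.-tuple 'I_b] _ Omega
    (fun (v : k.-tuple 'I_b) omega => mupre k omega (cyl v)) (PhiU @^-1` A)).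
    by move=> v _; exact: measurable_cyl_kernel.
  by rewrite -[X in measurable X]setTI; exact: mPhiU.
have mV : measurable_fun setT V.
  apply: (mcoord_fun (X := fun w omega => mupost k omega (cyl w))) => //.
  by move=> w; exact: measurable_cyl_kernel.
exists U, V; split.
- by split => //; exists KU => w; exact: clip_le.
- by split => //; exists (zeta_slope * l%:R) => w; exact: clipped_log_zeta_le.
- by move=> A B mA mB; exact: (qb_P4 hmu k0 (UF A mA) (VF B mB)).
- move=> A mA; case: l l0 @V mPhiV mPV VF mV => // l _ V mPhiV mPV VF mV.
  exact: (qb_P3 hmu k0 (mPV A mA)).
- apply: filterS3 hae mu_regular_ae post_regular_ae => omega qb rf rp.
  have XE n : (0 < n)%N -> XX n omega = ln (zeta (weight (mu omega)) q n).
    by case: n => // n _; exact: clipped_log_zetaE.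
  have VE : V omega = ln (zeta (weight (mupost k omega)) q l).
    by apply: clipped_log_zetaE; exact: rp.
  have qd : `|q| * ln C <= zeta_defect by rewrite ler_wpM2r.
  have z1 := le_trans (zeta_pre C1 rho0 qb q k0) qd.
  have z2 := le_trans (zeta_split C1 rho0 qb q k0 l0) qd.
  have UE : U omega = ln (zeta (weight (mupre k omega)) q k).
    apply: clip_id.
    have := clipped_log_zeta_le k (fun w => mu omega (cyl w)).
    rewrite clipped_log_zetaE // => bd.
    rewrite -/(zeta (weight (mupre k omega)) q k).
    move: z1 bd; rewrite !ler_norml /KU => /andP[? ?] /andP[? ?].
    by apply/andP; split; lra.
  by rewrite !XE ?addn_gt0 ?k0 // UE VE.
Qed.

Theorem partition_sum_concentration : exists x, forall (A : R) n, (0 < n)%N ->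
  1 <= ln n%:R :> R -> 8 * zeta_slope * ln n%:R <= n%:R `^ (1 / 4) ->
  (P [set omega | (8 * zeta_defect + 64 * zeta_slope ^+ 2 + A) * fluct R n <
     `|clipped_log_zeta n (fun w => mu omega (cyl w)) - n%:R * x|]%R <=
   (2 * expR (- (A * ln n%:R ^+ 2)))%:E)%E.
Proof.
have bXX n w : `|XX n w| <= zeta_slope * n%:R.
  by case: n => [|n]; [rewrite normr0 mulr0|exact: clipped_log_zeta_le].
have [x xP] := almost_additive_concentration zeta_slope_ge0 zeta_defect_ge0
  mXX bXX splitXX.
by exists x => A [//|n] n0 ln1 small; exact: (xP A n.+1 n0 ln1 small).
Qed.

End concentration_of_partition_sums.

(** * Summability *)

Section inverse_squares.
Variable R : realType.

Lemma sum_inverse_squares_le (n : nat) :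
  \sum_(0 <= k < n) (k%:R ^- 2 : R) <= 2.
Proof.
have H k : \sum_(0 <= i < k.+2) (i%:R ^- 2 : R) <= 2 - k.+1%:R^-1.
  elim: k => [|k IH].
    by rewrite !big_nat_recl // big_geq // expr0n /= invr0 !expr1n invr1; lra.
  rewrite big_nat_recr //= (le_trans (lerD IH (lexx _))) //.
  set x : R := k.+1%:R; have x0 : 0 < x by rewrite ltr0n.
  have -> : k.+2%:R = x + 1 :> R by rewrite natr1.
  rewrite -subr_ge0.
  have -> : 2 - (x + 1)^-1 - (2 - x^-1 + (x + 1) ^- 2) = (x * (x + 1) ^+ 2)^-1.
    by field; rewrite !gt_eqF // ltr_wpDl // ltW.
  by rewrite invr_ge0 mulr_ge0 ?sqr_ge0 // ltW.
case: n => [|n]; first by rewrite big_geq.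
case: n => [|n]; first by rewrite big_nat1 expr0n invr0.
by rewrite (le_trans (H n)) // lerBlDr lerDl invr_ge0.
Qed.

Lemma nneseries_inverse_squares (c : R) : 0 <= c ->
  (\sum_(k <oo) (c * k%:R ^- 2)%:E <= (2 * c)%:E)%E.
Proof.
move=> c0; apply: lime_le.
  by apply: is_cvg_nneseries => k _ _; rewrite lee_fin mulr_ge0 // invr_ge0 sqr_ge0.
apply: nearW => n; rewrite sumEFin lee_fin -mulr_sumr mulrC ler_wpM2r //.
exact: sum_inverse_squares_le.
Qed.

Lemma expR_neg_square_ln (A : R) n : 2 <= A -> (0 < n)%N -> 1 <= ln n%:R :> R ->
  expR (- (A * ln n%:R ^+ 2)) <= n%:R ^- 2 :> R.
Proof.
move=> A2 n0 ln1; have nR : 0 < n%:R :> R by rewrite ltr0n.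
have -> : n%:R ^- 2 = expR (- (2 * ln n%:R)) :> R.
  by rewrite expRN expRM_natl lnK // posrE.
rewrite ler_expR lerN2 expr2 mulrA ler_wpM2r ?(le_trans ler01 ln1) //.
by rewrite (le_trans A2) // ler_peMr // (le_trans _ A2).
Qed.

Lemma near_fluct_small (e : R) : 0 < e -> \forall n \near \oo, fluct R n <= e * n%:R.
Proof.
move=> e0; near=> n.
have n1 : (0 < n)%N by near: n; exact: nbhs_infty_gt.
have nR : 0 < n%:R :> R by rewrite ltr0n.
have ye : 8 / e <= n%:R `^ 8^-1 by near: n; apply: near_powR_ge; rewrite invr_gt0.
have := ln_le_powR (8^-1) nR; set y := n%:R `^ 8^-1 in ye * => lny.
have y0 : 0 < y by rewrite powR_gt0.
have yk (k : nat) : n%:R `^ (8^-1 * k%:R) = y ^+ k.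
  by rewrite powRrM powR_mulrn ?powR_ge0.
have E8 : n%:R = y ^+ 8 by rewrite -yk -[LHS]powRr1 ?ltW //; congr (_ `^ _); field.
have E6 : n%:R `^ (3 / 4) = y ^+ 6 by rewrite -yk; congr (_ `^ _); field.
rewrite /fluct E6 [X in _ <= _ * X]E8.
have {}ye : 8 <= e * y by rewrite -ler_pdivrMl // mulrC.
have -> : e * y ^+ 8 = y ^+ 6 * (e * y * y) by ring.
rewrite ler_wpM2l ?exprn_ge0 ?(ltW y0) //.
apply: (@le_trans _ _ (8 * y)); last by rewrite ler_wpM2r // ltW.
by rewrite -ler_pdivrMl.
Unshelve. all: by end_near. Qed.

Lemma near_sqrt_ln_ge (B : R) : \forall n \near \oo, B <= Num.sqrt (ln n%:R).
Proof.
near=> n.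
have B1 : B <= `|B| by exact: ler_norm.
rewrite (le_trans B1) // -(ger0_norm (normr_ge0 B)) -sqrtr_sqr ler_sqrt.
  rewrite -[leLHS]expRK ler_ln ?posrE ?expR_gt0 //.
    by near: n; exact: nbhs_infty_ger.
  by rewrite ltr0n; near: n; exact: nbhs_infty_gt.
rewrite ln_ge0 // ler1n; near: n; exact: nbhs_infty_gt.
Unshelve. all: by end_near. Qed.

End inverse_squares.

Section borel_cantelli.
Context {R : realType} {d : measure_display} {Omega : measurableType d}.
Variable P : probability Omega R.

Lemma borel_cantelli_inverse_squares (F : nat -> set Omega) (c : R) : 0 <= c ->
  (\forall n \near \oo, measurable (F n) /\ (P (F n) <= (c * n%:R ^- 2)%:E)%E) ->
  {ae P, forall omega, \forall n \near \oo, ~ F n omega}.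
Proof.
move=> c0 [n0 _ HF].
pose G n := if (n0 <= n)%N then F n else set0.
have mG n : measurable (G n).
  by rewrite /G; case: ifP => // nn; have [] := HF n nn.
have PG n : (P (G n) <= (c * n%:R ^- 2)%:E)%E.
  rewrite /G; case: ifP => [nn|_]; first by have [] := HF n nn.
  by rewrite measure0 lee_fin mulr_ge0 // invr_ge0 sqr_ge0.
have fin : (\sum_(n <oo) P (G n) < +oo)%E.
  apply: (@le_lt_trans _ _ (2 * c)%:E); last exact: ltry.
  apply: le_trans (nneseries_inverse_squares c0).
  by apply: lee_nneseries => n // _; exact: PG.
have lim0 := lim_sup_set_cvg0 mG fin.
exists (lim_sup_set G); split => //.
  by apply: bigcap_measurable => // k _; exact: bigcup_measurable.
move=> omega /= H; rewrite /lim_sup_set => k _.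
apply: contrapT => nk; apply: H; exists (maxn k n0) => // n /=.
rewrite geq_max => /andP[kn nn] Fn; apply: nk; exists n => //.
by rewrite /G nn.
Qed.

End borel_cantelli.

(** * Concentration uniform in [q], along the renewal scale *)

Section uniform_concentration.
Context {R : realType} {m : nat} {d : measure_display} {Omega : measurableType d}.
Variables (P : probability Omega R) (mu : R.-pker Omega ~> symb m) (C0 : R).
Variables (mupre mupost : nat -> R.-ker Omega ~> symb m).
Hypothesis hmu : quasi_bernoulli P mu C0 mupre mupost.
Variables (C rho : R).
Hypotheses (C1 : 1 <= C) (rho01 : 0 < rho < 1).
Hypothesis hae : {ae P, forall omega, quasi_bernoulli_at (mu omega)
    (fun k => mupre k omega) (fun k => mupost k omega) C rho}.
Variables (tau : R -> R) (Q : nat).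
Hypothesis htau : is_tau P mu tau.
Local Notation b := m.+2.
Local Notation word := (seq 'I_b).
Local Notation L := (ln b%:R : R).
Local Notation kap := (qb_kap C rho).
Local Notation dd := (qb_d C).
Local Notation slope := (@zeta_slope R m C rho Q%:R).
Local Notation clz q n := (@clipped_log_zeta R m C rho Q%:R q n).
Local Notation path_space := (coord_space R (@nonempty_words m)).

Let slope_ge0 : 0 <= slope.
Proof. by apply: (@zeta_slope_ge0 R m C rho C1 rho01 Q%:R 0); rewrite normr0. Qed.

Let defect_ge0 : 0 <= zeta_defect C Q%:R.
Proof. by rewrite mulr_ge0 // ln_ge0. Qed.

Definition level_const (A : R) : R :=
  8 * zeta_defect C Q%:R + 64 * slope ^+ 2 + A.

Lemma near_concentration_cond :
  \forall n \near \oo, [/\ (0 < n)%N, 1 <= ln n%:R :> R &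
    8 * slope * ln n%:R <= n%:R `^ (1 / 4)].
Proof.
have s0 := slope_ge0.
near=> n.
have n1 : (0 < n)%N by near: n; exact: nbhs_infty_gt.
have nR : 0 < n%:R :> R by rewrite ltr0n.
split => //; first by near: n; exact: near_ln_ge1.
have ye : 64 * slope <= n%:R `^ (1 / 8) by near: n; apply: near_powR_ge.
have := ln_le_powR (1 / 8) nR; set y := n%:R `^ (1 / 8) in ye * => lny.
have y0 : 0 < y by rewrite powR_gt0.
have -> : n%:R `^ (1 / 4) = y * y.
  rewrite /y -powRD; first by congr (_ `^ _); field.
  by rewrite (gt_eqF nR) implybT.
have -> : 8 * slope * ln n%:R = 64 * slope * (1 / 8 * ln n%:R) by field.
rewrite (@le_trans _ _ (64 * slope * y)) //.
  by rewrite ler_wpM2l // mulr_ge0.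
by rewrite ler_wpM2r // ltW.
Unshelve. all: by end_near. Qed.

Let mPhi q n (n0 : (0 < n)%N) := @measurable_clipped_log_zeta R m C rho Q%:R q n n0.

Definition deviation_set (A q t : R) (n : nat) : set (word -> \bar R) :=
  [set x | level_const A * fluct R n < `|clz q n x - t|].

Lemma measurable_deviation_set A q t n : (0 < n)%N ->
  measurable (deviation_set A q t n : set path_space).
Proof.
move=> n0; rewrite -[X in measurable X]setTI.
have md : measurable_fun (setT : set path_space) (fun x => `|clz q n x - t|).
  apply: measurableT_comp => //; apply: measurable_funB => //; exact: mPhi.
have h := measurable_fun_ltr (@measurable_cst _ _ path_space _ setT
  (level_const A * fluct R n)) md.
by have := h measurableT [set true]; apply.
Qed.

Let measurable_mu_event (B : set (word -> \bar R)) :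
  measurable (B : set path_space) ->
  measurable [set omega | B (fun w => mu omega (cyl w))].
Proof.
move=> mB; apply: (measurable_family_event
  (X := fun w omega => mu omega (cyl w))) mB.
by move=> w _; exact: measurable_cyl_kernel.
Qed.

Let measurable_post_event k (B : set (word -> \bar R)) :
  measurable (B : set path_space) ->
  measurable [set omega | B (fun w => mupost k omega (cyl w))].
Proof.
move=> mB; apply: (measurable_family_event
  (X := fun w omega => mupost k omega (cyl w))) mB.
by move=> w _; exact: measurable_cyl_kernel.
Qed.

(** The almost sure growth rate of [ln (zeta q n)] that concentration provides
    can only be the one given by [tau]. *)
Lemma concentration_tau (A q : R) n : `|q| <= Q%:R -> (0 < n)%N ->
  1 <= ln n%:R :> R -> 8 * slope * ln n%:R <= n%:R `^ (1 / 4) ->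
  (P [set omega | deviation_set A q (n%:R * (- (L * tau q)))%R n
        (fun w => mu omega (cyl w))]
     <= (2 * expR (- (A * ln n%:R ^+ 2)))%:E)%E.
Proof.
move=> qQ.
have [x xP] := partition_sum_concentration hmu C1 rho01 hae qQ.
suff -> : - (L * tau q) = x by exact: xP.
have L0 : 0 < L by exact: lnb_gt0.
have s0 := slope_ge0.
have ev : {ae P, forall omega, \forall n \near \oo,
    ~ deviation_set 2 q (n%:R * x) n (fun w => mu omega (cyl w))}.
  apply: (@borel_cantelli_inverse_squares _ _ _ P
    (fun n => [set omega | deviation_set 2 q (n%:R * x) n (fun w => mu omega (cyl w))]) 2) => //.
  near=> k.
  have [k0 k1 k2] : [/\ (0 < k)%N, 1 <= ln k%:R :> R &
    8 * slope * ln k%:R <= k%:R `^ (1 / 4)].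
    by near: k; exact: near_concentration_cond.
  split; first by apply: measurable_mu_event; exact: measurable_deviation_set.
  apply: (le_trans (xP 2 k k0 k1 k2)).
  by rewrite lee_fin ler_wpM2l // expR_neg_square_ln.
have : {ae P, forall omega, x = - (L * tau q)}.
  apply: filterS3 (mu_regular_ae C1 rho01 hae) ev htau => omega rf dev tauE.
  pose y j := - (j%:R^-1 * (ln (zeta (weight (mu omega)) q j) / L)).
  have ycvg : y j @[j --> \oo] --> - (x / L).
    have M0 : 0 <= level_const 2.
      rewrite /level_const; apply: addr_ge0 => //; apply: addr_ge0; [exact: mulr_ge0|by rewrite mulr_ge0 ?sqr_ge0].
    apply/cvgrPdist_le => e e0; near=> j.
    have j0 : (0 < j)%N by near: j; exact: nbhs_infty_gt.
    have jR : 0 < j%:R :> R by rewrite ltr0n.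
    have : ~ deviation_set 2 q (j%:R * x) j (fun w => mu omega (cyl w)) by near: j.
    rewrite /deviation_set /= clipped_log_zetaE // => /negP; rewrite -leNgt => h.
    have sm : fluct R j <= e * L / (level_const 2 + 1) * j%:R.
      near: j; apply: near_fluct_small; apply: divr_gt0; first exact: mulr_gt0.
      by rewrite ltr_wpDl.
    rewrite /y.
    have -> : - (x / L) - - (j%:R^-1 * (ln (zeta (weight (mu omega)) q j) / L)) =
      (ln (zeta (weight (mu omega)) q j) - j%:R * x) / (j%:R * L).
      by field; rewrite !gt_eqF.
    rewrite normrM normfV [`|j%:R * L|]gtr0_norm ?mulr_gt0 //.
    rewrite ler_pdivrMr ?mulr_gt0 // (le_trans h) //.
    have h2 := ler_wpM2l M0 sm.
    apply: (le_trans h2).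
    have -> : level_const 2 * (e * L / (level_const 2 + 1) * j%:R) =
       (level_const 2 / (level_const 2 + 1)) * (e * (j%:R * L)).
      by field; rewrite gt_eqF // ltr_wpDl.
    rewrite ler_piMl ?mulr_ge0 ?(ltW L0) ?(ltW e0) //.
    by rewrite ler_pdivrMr ?ltr_wpDl // mul1r lerDl.
  have yE : (y j)%:E @[j --> \oo] --> (- (x / L))%:E.
    by apply: cvg_EFin => //; exact: nearW.
  have [E _] := cvg_limn_einf_sup yE.
  have tauqE : (- (x / L))%:E = (tau q)%:E by rewrite -E; exact: (tauE q).
  have -> : tau q = - (x / L) by apply: EFin_inj; rewrite tauqE.
  by field; rewrite gt_eqF.
move=> [N [mN PN0 sub]]; apply: contrapT => neq.
have : (P setT <= P N)%E.
  apply: le_measure; rewrite ?inE // => omega _; apply: sub => /= e.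
  by apply: neq; rewrite e.
by rewrite PN0 probability_setT lee_fin ler10.
Unshelve. all: by end_near. Qed.

Definition grid (n i : nat) : R := i%:R / n%:R - Q%:R.

Lemma grid_le n i : (0 < n)%N -> (i < (2 * Q * n).+1)%N -> `|grid n i| <= Q%:R.
Proof.
move=> n0; rewrite ltnS => iQ; have nR : 0 < n%:R :> R by rewrite ltr0n.
have h : i%:R / n%:R <= 2 * Q%:R :> R.
  by rewrite ler_pdivrMr // -!natrM ler_nat.
have h0 : 0 <= i%:R / n%:R :> R by rewrite divr_ge0.
by rewrite ler_norml /grid; apply/andP; split; lra.
Qed.

Definition bad_level (A : R) (n : nat) : set (word -> \bar R) :=
  \big[setU/set0]_(i < (2 * Q * n).+1)
    deviation_set A (grid n i) (n%:R * (- (L * tau (grid n i)))) n.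

Definition bad_tail (A : R) (p : nat) : set (word -> \bar R) :=
  \bigcup_(n in [set n | (p <= n)%N]) bad_level A n.

Lemma measurable_bad_level A n : (0 < n)%N ->
  measurable (bad_level A n : set path_space).
Proof.
by move=> n0; apply: bigsetU_measurable => i _; exact: measurable_deviation_set.
Qed.

Lemma measurable_bad_tail A p : (0 < p)%N ->
  measurable (bad_tail A p : set path_space).
Proof.
move=> p0; apply: (bigcup_measurable (T := path_space)) => n /= pn.
by apply: measurable_bad_level; exact: leq_trans pn.
Qed.

Let muw omega (w : word) := mu omega (cyl w).

(** The [2 * Q * n + 1] grid points cost one factor [n]; taking [A = 11] leaves
    [expR (- 8 * (ln n) ^ 2)] after [n^(-3)] has paid for them and for the sum
    over [n]. *)
Lemma prob_bad_level n : (0 < n)%N -> 1 <= ln n%:R :> R ->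
  8 * slope * ln n%:R <= n%:R `^ (1 / 4) ->
  (P [set omega | bad_level 11 n (muw omega)] <=
    ((2 * Q.*2.+1%:R) * n%:R ^- 2 * expR (- (8 * ln n%:R ^+ 2)))%:E)%E.
Proof.
move=> n0 ln1 small; have nR : 0 < n%:R :> R by rewrite ltr0n.
pose D i := deviation_set 11 (grid n i) (n%:R * (- (L * tau (grid n i)))) n.
have -> : [set omega | bad_level 11 n (muw omega)] =
    \big[setU/set0]_(i < (2 * Q * n).+1) [set omega | D i (muw omega)].
  apply/seteqP; rewrite /bad_level -!(bigcup_mkord _ D).
  rewrite -(bigcup_mkord _ (fun i => [set omega | D i (muw omega)])).
  by split => omega /= [i ? ?]; exists i.
have mD i : measurable [set omega | D i (muw omega)].
  by apply: measurable_mu_event; exact: measurable_deviation_set.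
have := @Boole_inequality _ _ _ P (fun i => [set omega | D i (muw omega)])
  (2 * Q * n).+1 (fun i _ => mD i).
move=> /le_trans; apply.
apply: (@le_trans _ _ (\sum_(i < (2 * Q * n).+1) (2 * expR (- (11 * ln n%:R ^+ 2)))%:E)%E).
  by apply: lee_sum => i _; apply: concentration_tau => //; exact: grid_le.
rewrite sumEFin lee_fin sumr_const card_ord -[leLHS]mulr_natr.
have cnt : (2 * Q * n).+1%:R <= Q.*2.+1%:R * n%:R :> R.
  by rewrite -natrM ler_nat -mul2n mulSn -add1n leq_add2r.
have -> : - (11 * ln n%:R ^+ 2) = - (3 * ln n%:R ^+ 2) + - (8 * ln n%:R ^+ 2) :> R by ring.
rewrite expRD.
have e3 : expR (- (3 * ln n%:R ^+ 2)) * n%:R <= n%:R ^- 2 :> R.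
  have -> : n%:R ^- 2 = expR (- (2 * ln n%:R)) :> R.
    by rewrite expRN expRM_natl lnK // posrE.
  rewrite -[X in _ * X <= _](lnK (_ : n%:R \is Num.pos)) ?posrE // -expRD ler_expR.
  have : ln n%:R <= ln n%:R ^+ 2 :> R by rewrite expr2 ler_peMl // (le_trans ler01).
  lra.
apply: (le_trans (ler_wpM2l _ cnt)); first by rewrite !mulr_ge0 ?expR_ge0.
have -> : 2 * (expR (- (3 * ln n%:R ^+ 2)) * expR (- (8 * ln n%:R ^+ 2))) *
    (Q.*2.+1%:R * n%:R) = 2 * Q.*2.+1%:R * (expR (- (3 * ln n%:R ^+ 2)) * n%:R) *
    expR (- (8 * ln n%:R ^+ 2)) :> R by ring.
by rewrite ler_wpM2r ?expR_ge0 // ler_wpM2l ?mulr_ge0.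
Qed.

Lemma prob_bad_tail : \forall p \near \oo,
  (P [set omega | bad_tail 11 p (muw omega)] <=
    (2 * (2 * Q.*2.+1%:R) * expR (- (8 * ln p%:R ^+ 2)))%:E)%E.
Proof.
have [n0 _ cond] := near_concentration_cond.
near=> p.
have np : (n0 <= p)%N by near: p; exact: nbhs_infty_ge.
have [p0 lnp _] := cond p np.
have lnp0 : 0 <= ln p%:R :> R by rewrite (le_trans ler01).
pose K : R := 2 * Q.*2.+1%:R; set E := expR _.
have K0 : 0 <= K by rewrite mulr_ge0.
have -> : [set omega | bad_tail 11 p (muw omega)] =
    \bigcup_(n in [set n | (p <= n)%N]) [set omega | bad_level 11 n (muw omega)].
  by apply/seteqP; split => omega [n /= ? ?]; exists n.
pose F n := if (p <= n)%N then [set omega | bad_level 11 n (muw omega)] else set0.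
have mF n : measurable (F n).
  rewrite /F; case: ifP => // pn; apply: measurable_mu_event.
  by apply: measurable_bad_level; exact: leq_trans pn.
have -> : \bigcup_(n in [set n | (p <= n)%N]) [set omega | bad_level 11 n (muw omega)] =
    \bigcup_n F n.
  apply/seteqP; split => omega [n /=]; first by move=> pn ?; exists n; rewrite // /F pn.
  by rewrite /F; case: ifP => // pn _ ?; exists n.
apply: (@le_trans _ _ (\sum_(n <oo) P (F n))%E).
  by apply: measure_sigma_subadditive => //; exact: bigcupT_measurable.
apply: (@le_trans _ _ (\sum_(n <oo) (K * E * n%:R ^- 2)%:E)%E).
  apply: lee_nneseries => // n _; rewrite /F; case: ifP => [pn|_]; last first.
    by rewrite measure0 lee_fin !mulr_ge0 ?expR_ge0 // invr_ge0 sqr_ge0.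
  have [n1 ln1 small] := cond n (leq_trans np pn).
  apply: (le_trans (prob_bad_level n1 ln1 small)).
  rewrite lee_fin -/K mulrAC ler_wpM2r ?invr_ge0 ?sqr_ge0 // ler_wpM2l //.
  rewrite ler_expR lerN2 ler_wpM2l // lerXn2r ?nnegrE ?(le_trans ler01 ln1) //.
  by rewrite ler_ln ?posrE ?ltr0n // ler_nat.
apply: (le_trans (nneseries_inverse_squares _)); first by rewrite mulr_ge0 ?expR_ge0.
by rewrite lee_fin -/K mulrA.
Unshelve. all: by end_near. Qed.

Lemma prob_bad_tail_post k p : (0 < k)%N -> (0 < p)%N ->
  P [set omega | bad_tail 11 p (fun w => mupost k omega (cyl w))] =
  P [set omega | bad_tail 11 p (muw omega)].
Proof. by move=> k0 p0; exact: (qb_P3 hmu k0 (measurable_bad_tail 11 p0)). Qed.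

Section renewal_scale.
Variable alpha : R.
Hypothesis alpha1 : 1 < alpha.

Definition renewal_scale (j : nat) : nat :=
  Num.truncn (expR (Num.sqrt (alpha * ln j%:R))).

Lemma near_renewal_scale_ge p0 : \forall j \near \oo, (p0 <= renewal_scale j)%N.
Proof.
near=> j; rewrite truncn_ge_nat ?expR_ge0 //.
have j1 : (0 < j)%N by near: j; exact: nbhs_infty_gt.
have lnj : 0 <= ln j%:R :> R by rewrite ln_ge0 // ler1n.
have s : p0%:R <= Num.sqrt (ln j%:R) :> R by near: j; exact: near_sqrt_ln_ge.
have s2 : Num.sqrt (ln j%:R) <= Num.sqrt (alpha * ln j%:R).
  have aj : 0 <= alpha * ln j%:R by rewrite mulr_ge0 // (le_trans ler01) // ltW.
  by rewrite ler_sqrt // ler_peMl // ltW.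
have := expR_ge1Dx (Num.sqrt (alpha * ln j%:R)); lra.
Unshelve. all: by end_near. Qed.

(** With [S = exp (sqrt (alpha * ln j))] the failure probability
    [exp (- 8 * (ln S) ^ 2)] is summable in [j]. *)
Lemma near_renewal_scale_ln : \forall j \near \oo,
  expR (- (8 * ln (renewal_scale j)%:R ^+ 2)) <= j%:R ^- 2 :> R.
Proof.
near=> j.
have j1 : (0 < j)%N by near: j; exact: nbhs_infty_gt.
have jR : 0 < j%:R :> R by rewrite ltr0n.
have lnj : 0 <= ln j%:R :> R by rewrite ln_ge0 // ler1n.
have aj : 0 <= alpha * ln j%:R by rewrite mulr_ge0 // (le_trans ler01) // ltW.
set s := Num.sqrt (alpha * ln j%:R).
have s0 : 0 <= s by exact: sqrtr_ge0.
have s2 : s ^+ 2 = alpha * ln j%:R by rewrite sqr_sqrtr.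
have s4 : 4 <= s.
  rewrite (@le_trans _ _ (Num.sqrt (ln j%:R))) //.
    by near: j; exact: near_sqrt_ln_ge.
  by rewrite ler_sqrt // ler_peMl // ltW.
have lo : expR (s / 2) <= (renewal_scale j)%:R.
  have : expR s < (renewal_scale j).+1%:R by exact: truncnS_gt.
  rewrite -natr1 => /ltW h.
  have e : expR s = expR (s / 2) * expR (s / 2) by rewrite -expRD; congr expR; field.
  have e1 : 2 <= expR (s / 2) by have := expR_ge1Dx (s / 2); lra.
  have := ler_wpM2r (expR_ge0 (s / 2)) e1; rewrite -e; lra.
have lns : s / 2 <= ln (renewal_scale j)%:R.
  rewrite -[leLHS]expRK ler_ln ?posrE ?expR_gt0 //.
  exact: lt_le_trans (expR_gt0 _) lo.
have -> : j%:R ^- 2 = expR (- (2 * ln j%:R)) :> R.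
  by rewrite expRN expRM_natl lnK // posrE.
rewrite ler_expR lerN2.
have h : (s / 2) ^+ 2 <= ln (renewal_scale j)%:R ^+ 2.
  by rewrite lerXn2r ?nnegrE ?divr_ge0 // (le_trans _ lns) // divr_ge0.
have := ler_wpM2r lnj (ltW alpha1); rewrite expr_div_n s2 in h; lra.
Unshelve. all: by end_near. Qed.

Lemma eventually_not_bad : {ae P, forall omega, \forall j \near \oo,
  ~ bad_tail 11 (renewal_scale j) (fun w => mupost j omega (cyl w))}.
Proof.
have [p0 _ Hp] := prob_bad_tail.
apply: (@borel_cantelli_inverse_squares _ _ _ P (fun j =>
  [set omega | bad_tail 11 (renewal_scale j) (fun w => mupost j omega (cyl w))])
  (2 * (2 * Q.*2.+1%:R))); first by rewrite !mulr_ge0.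
near=> j.
have j0 : (0 < j)%N by near: j; exact: nbhs_infty_gt.
have pS : (maxn p0 1 <= renewal_scale j)%N by near: j; exact: near_renewal_scale_ge.
move: pS; rewrite geq_max => /andP[pS S0].
split; first by apply: measurable_post_event; exact: measurable_bad_tail.
rewrite prob_bad_tail_post // (le_trans (Hp _ pS)) // lee_fin ler_wpM2l ?mulr_ge0 //.
by near: j; exact: near_renewal_scale_ln.
Unshelve. all: by end_near. Qed.

End renewal_scale.

(** Between grid points both [ln (zeta q n)] and [n * tau q] vary by a constant,
    because the grid has step [1 / n]. *)
Lemma good_fluctuation : twice_continuously_differentiable tau ->
  exists M : R, 0 <= M /\ \forall p \near \oo,
  forall nu : {measure set (symb m) -> \bar R}, regular_weight kap dd (weight nu) ->
  ~ bad_tail 11 p (fun w => nu (cyl w)) ->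
  forall n q, (p <= n)%N -> `|q| <= Q%:R ->
    `|ln (zeta (weight nu) q n) + n%:R * (L * tau q)| <= M * fluct R n.
Proof.
move=> [dtau ddtau _].
have L0 : 0 < L by exact: lnb_gt0.
have cdtau : continuous (derive1 tau).
  by move=> z; apply: differentiable_continuous; exact/derivable1_diffP.
have [Mt [Mt0 HMt]] := continuous_ball_bounded 0 Q%:R cdtau.
have kap0 : 0 < kap := qb_kap_gt0 C1 rho01.
have M0 : 0 <= level_const 11.
  by rewrite /level_const; apply: addr_ge0 => //; apply: addr_ge0;
    [exact: mulr_ge0|rewrite mulr_ge0 ?sqr_ge0].
have K0 : 0 <= kap + L * Mt by rewrite addr_ge0 ?mulr_ge0 // ltW.
exists (level_const 11 + (kap + L * Mt)); split; first exact: addr_ge0.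
have [n0 _ cond] := near_concentration_cond.
near=> p => nu rf good n q pn qQ.
have np : (n0 <= p)%N by near: p; exact: nbhs_infty_ge.
have [n1 ln1 _] := cond n (leq_trans np pn).
have nR : 0 < n%:R :> R by rewrite ltr0n.
move: (qQ); rewrite ler_norml => /andP[q1 q2].
have qn0 : 0 <= (q + Q%:R) * n%:R by rewrite mulr_ge0 //; lra.
pose i := Num.truncn ((q + Q%:R) * n%:R).
have i1 : i%:R <= (q + Q%:R) * n%:R by rewrite truncn_le.
have i2 : (q + Q%:R) * n%:R < i%:R + 1 by rewrite natr1; exact: truncnS_gt.
have iQ : (i < (2 * Q * n).+1)%N.
  rewrite ltnS -(ler_nat R) (le_trans i1) // !natrM ler_wpM2r //; lra.
set g := grid n i.
have gq : `|q - g| <= n%:R^-1.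
  have -> : q - g = ((q + Q%:R) * n%:R - i%:R) / n%:R.
    by rewrite /g /grid; field; rewrite gt_eqF.
  rewrite normrM [`|n%:R^-1|]gtr0_norm ?invr_gt0 // ler_piMl ?invr_ge0 //.
  by rewrite ler_norml; apply/andP; split; lra.
have gQ : `|g| <= Q%:R by exact: grid_le.
have dev : `|ln (zeta (weight nu) g n) - n%:R * - (L * tau g)| <= level_const 11 * fluct R n.
  rewrite leNgt; apply/negP => h; apply: good; exists n => //.
  rewrite /bad_level -(bigcup_mkord _ (fun i =>
    deviation_set 11 (grid n i) (n%:R * (- (L * tau (grid n i)))) n)).
  by exists i => //=; rewrite /deviation_set /= clipped_log_zetaE.
have z1 : `|ln (zeta (weight nu) q n) - ln (zeta (weight nu) g n)| <= kap.
  apply: (le_trans (zeta_lipschitz rf q g n)).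
  apply: (@le_trans _ _ (kap * n%:R * n%:R^-1)).
    by rewrite ler_wpM2l // mulr_ge0 // ltW.
  by rewrite -mulrA mulfV ?mulr1 // gt_eqF.
have t1 : `|tau q - tau g| <= Mt * n%:R^-1.
  have h := derive_ball_lipschitz (x := q) (y := g) dtau HMt.
  rewrite !subr0 in h; apply: (le_trans (h qQ gQ)).
  by rewrite ler_wpM2l // ltW.
have t2 : `|n%:R * (L * (tau q - tau g))| <= L * Mt.
  rewrite !normrM [`|n%:R|]gtr0_norm // [`|L|]gtr0_norm //.
  have -> : L * Mt = n%:R * (L * (Mt * n%:R^-1)) by field; rewrite gt_eqF.
  by rewrite ler_wpM2l // ler_wpM2l // ltW.
have fl1 : 1 <= fluct R n.
  rewrite /fluct mulr_ege1 //.
  have := @ge0_ler_powR R (3 / 4) _ 1 n%:R.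
  by rewrite powR1 !nnegrE; apply => //; rewrite ?ler1n //; lra.
have -> : ln (zeta (weight nu) q n) + n%:R * (L * tau q) =
  (ln (zeta (weight nu) g n) - n%:R * - (L * tau g)) +
  (ln (zeta (weight nu) q n) - ln (zeta (weight nu) g n) + n%:R * (L * (tau q - tau g))).
  by ring.
rewrite (le_trans (ler_normD _ _)) // [leRHS]mulrDl lerD //.
rewrite (le_trans (ler_normD _ _)) // (@le_trans _ _ (kap + L * Mt)) ?lerD //.
by rewrite ler_peMr.
Unshelve. all: by end_near. Qed.

End uniform_concentration.

(** * Growth speed along the copies *)

Lemma growth_speed_le (R : realType) (m : nat) (mm : set (symb m) -> \bar R)
    nu beta N eps p : (0 < p)%N ->
  ((2^-1)%:E <= mm (sing_set nu beta N eps p))%E ->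
  (growth_speed mm nu beta N eps <= p%:R%:E)%E.
Proof. by move=> p0 h; apply: ereal_inf_lbound; exists p. Qed.

Theorem theorem2 (R : realType) (m : nat)
    (d : measure_display) (Omega : measurableType d) (P : probability Omega R)
    (mu : R.-pker Omega ~> symb m) (C : R)
    (mupre mupost : nat -> R.-ker Omega ~> symb m)
    (hmu : quasi_bernoulli P mu C mupre mupost)
    (tau : R -> R) (htau : is_tau P mu tau)
    (htau2 : twice_continuously_differentiable tau)
    (muq : nat -> R -> Omega -> probability (symb m) R)
    (hmuq : {ae P, forall omega, forall (j : nat) (q : R),
       gibbs_weak_limit (mupost j omega) q (muq j q omega)})
    (eta : R) (heta : 0 < eta) (N : nat) (hN : (1 <= N)%N)
    (eps : nat -> R) (heps_gt0 : forall n, (1 <= n)%N -> 0 < eps n)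
    (heps_cvg : eps n @[n --> \oo] --> 0)
    (heps_series : forall M a : R, 0 < M -> 0 < a ->
       cvgn (series (fun k : nat => let n := k.+1 in
         m.+2%:R `^ (M * n%:R `^ (3 / 4) * ln n%:R)
         * m.+2%:R `^ (- (n%:R * a * eps n ^+ 2)))))
    (heps_ge : forall n, (1 <= n)%N ->
       n%:R `^ (- (1 / 8)) * ln n%:R `^ (1 / 2 + eta) <= eps n)
    (alpha : R) (halpha : 1 < alpha)
    (K : set R) (hKcompact : compact K) (hKinterval : is_interval K)
    (hKJ : K `<=` [set q | 0 < derive1 tau q * q - tau q]) :
  {ae P, forall omega, \forall j \near \oo, forall q, K q ->
    (maxe
       (growth_speed (muq j q omega) (mupost j omega) (derive1 tau q) N eps)
       (growth_speed (muq j q omega) (muq j q omega)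
          (derive1 tau q * q - tau q) N eps)
     <= (Num.floor (expR (Num.sqrt (alpha * ln j%:R))))%:~R%:E)%E}.
Proof.
have [M [_ KM]] := compact_bounded hKcompact.
pose Q := (Num.truncn (`|M| + 1)).+1.
have KQ q : K q -> `|q| <= Q%:R.
  move=> Kq; apply: (@le_trans _ _ (`|M| + 1)); last exact/ltW/truncnS_gt.
  by apply: (KM (`|M| + 1)) => //; rewrite ltr_pwDr // ler_norm.
have [Cq [rho [C1 rho01 hae]]] := quasi_bernoulli_ae hmu.
have [M0 [M00 fluctP]] := @good_fluctuation R m Cq rho C1 rho01 tau Q.+1 htau2.
have growth := deterministic_growth N htau2 heta heps_gt0 heps_cvg heps_series
  heps_ge (qb_kap_gt0 C1 rho01) (qb_d_ge0 C1) (ler0n R Q) M00.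
have rare := eventually_not_bad hmu C1 rho01 hae Q.+1 htau halpha.
have reg := post_regular_ae hmu C1 rho01 hae.
have [p1 _ P1] := growth; have [p2 _ P2] := fluctP.
apply: filterS3 rare reg hmuq => omega rare reg lim.
have scale := near_renewal_scale_ge halpha (maxn 1 (maxn p1 p2)).
near=> j => q Kq.
have j0 : (0 < j)%N by near: j; exact: nbhs_infty_gt.
have : (maxn 1 (maxn p1 p2) <= renewal_scale alpha j)%N by near: j.
have nbad : ~ bad_tail Cq rho tau Q.+1 11 (renewal_scale alpha j)
  (fun w => mupost j omega (cyl w)) by near: j.
set p := renewal_scale alpha j in nbad *; rewrite !geq_max => /and3P[p_gt0 pp1 pp2].
have fl := P2 p pp2 (mupost j omega) (reg j j0) nbad.
have [|h1 h2] := P1 p pp1 (mupost j omega) (reg j j0) _ q (KQ q Kq) _ (lim j q).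
  by move=> n q' pn q'Q; apply: fl => //; rewrite -natr1.
apply: (@le_trans _ _ p%:R%:E).
  by rewrite ge_max; apply/andP; split; exact: growth_speed_le.
rewrite lee_fin -[leLHS]mulrz_nat ler_int floor_ge_int.
by rewrite mulrz_nat /p /renewal_scale truncn_le expR_ge0.
Unshelve. all: by end_near. Qed.
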